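(* Let $n>2$. The submodules of symmetric and antisymmetric tensors in the isotypic components of type $\mathfrak{g}=sl(n)$ are generated by the following highest weight vectors ($\alpha$, $\beta$) and lowest weight vectors ($\delta$): $$\begin{array}{ll} \mathcal{M}^{\otimes2}_{\alpha;+}:\ \alpha^3+\alpha^4,\ \ \alpha^1+\alpha^2+\omega\alpha^3; & \quad \mathcal{M}^{\otimes2}_{\alpha;-}:\ q^{\pm1}\alpha^1-q^{\mp1}\alpha^2\mp\alpha^3\pm\alpha^4;\\ \mathcal{M}^{\otimes2}_{\beta;+}:\ \beta^1+\beta^2-\omega\beta^3,\ \ \beta^3+\beta^4+\omega\beta^1; & \quad \mathcal{M}^{\otimes2}_{\beta;-}:\ \beta^1-\beta^2,\ \ \beta^3-\beta^4;\\ \mathcal{M}^{*\otimes2}_{\delta;+}:\ \delta_3+\delta_4-\omega\delta_2,\ \ \delta_1+\delta_2+\omega\delta_3; & \quad \mathcal{M}^{*\otimes2}_{\delta;-}:\ \delta_1-\delta_2,\ \ \delta_3-\delta_4. \end{array}$$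
   Context: Scalars: $\mathbb{C}(q)$, with fractional powers of $q$ adjoined when needed; $\omega=q-q^{-1}$; $\mathfrak{g}=sl(n)$. $\mathcal{U}_q(\mathfrak{g})$ is the Hopf algebra with generators $H_i,X_i^\pm$ ($1\le i\le n-1$), relations $[H_i,X^\pm_i]=\pm2X_i^\pm$, $[H_i,X^\pm_j]=\mp X^\pm_j$ for $|i-j|=1$, $[H_i,X_j^\pm]=0$ for $|i-j|>1$, $[H_i,H_j]=0$, $[X_i^+,X_j^-]=\delta_{ij}\frac{q^{H_i}-q^{-H_i}}{q-q^{-1}}$, the quantum Serre relations, coproduct $\Delta(H_i)=H_i\otimes1+1\otimes H_i$, $\Delta(X_i^\pm)=X_i^\pm\otimes q^{-H_i/2}+q^{H_i/2}\otimes X_i^\pm$, antipode $\bar H_i=-H_i$, $\overline{X_i^\pm}=-q^{\mp1}X_i^\pm$ (the antipode is denoted by a bar). Sweedler notation $x_{(1)}\otimes x_{(2)}\otimes\cdots$ is used. $\mathcal{M}$ is the algebra of $n\times n$ matrices with units $e^i_j$, $e^i_je^k_l=\delta^k_je^i_l$ (also written $e_j^i$), and $\rho\colon\mathcal{U}_q(\mathfrak{g})\to\mathcal{M}$ is the fundamental representation $\rho(H_i)=e^i_i-e^{i+1}_{i+1}$, $\rho(X_i^+)=e^i_{i+1}$, $\rho(X_i^-)=e^{i+1}_i$. Three module structures on $\mathcal{M}^{\otimes2}$ are considered: (α) right: $(A\otimes B)\triangleleft x=\rho(\overline{x_{(2)}})A\rho(x_{(3)})\otimes\rho(\overline{x_{(1)}})B\rho(x_{(4)})$;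 (β) right: $(A\otimes B)\triangleleft x=\rho(\overline{x_{(1)}})A\rho(x_{(2)})\otimes\rho(\overline{x_{(3)}})B\rho(x_{(4)})$; (δ) left: $x\triangleright(A\otimes B)=\rho(x_{(2)})A\rho(\overline{x_{(1)}})\otimes\rho(x_{(4)})B\rho(\overline{x_{(3)}})$; with this action the module is denoted $\mathcal{M}^{*\otimes2}$, and it is dual to (β) via the trace pairing $\langle A\otimes B,C\otimes D\rangle=\mathrm{Tr}(AC)\mathrm{Tr}(BD)$. Let $\mathcal{M}^{\otimes2}_\alpha$, $\mathcal{M}^{\otimes2}_\beta$, $\mathcal{M}^{*\otimes2}_\delta$ be the isotypic components of type $\mathfrak{g}$ for these actions (in each, the irreducible module $\mathfrak{g}$, i.e. the $q$-deformed adjoint module, has multiplicity four). They are generated respectively by the vectors: $\alpha^1=1\otimes e^1_n$; $\alpha^2=\sum_i a_i\,e^1_n\otimes e^i_i$ with $(a_1,\dots,a_n)=(q,1,\dots,1,q^{-1})$; $\alpha^3=\sum_i a_i\,e^1_i\otimes e^i_n$ with $(a_i)=(q,1,\dots,1)$; $\alpha^4=\sum_i a_i\,e^i_n\otimes e^1_i$ with $(a_i)=(1,\dots,1,q^{-1})$; $\beta^1=1\otimes e^1_n$; $\beta^2=e^1_n\otimes1$; $\beta^3=\sum_i q^{-(2(n-i)+1)}e^1_i\otimes e^i_n$; $\beta^4=\sum_i a_i\,e^i_n\otimes e^1_i$ with $(a_i)=(q,1,\dots,1,q^{-1})$; $\delta_1=\sum_i q^{-2i+1}e^i_i\otimes e^n_1$;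 $\delta_2=\sum_i e^n_1\otimes q^{-2i+1}e^i_i$; $\delta_3=\sum_i e^i_1\otimes e^n_i$; $\delta_4=\sum_i a_i\,e^n_i\otimes e^i_1$ with $a_1=1$, $a_i=q^{-(2i-1)}$ for $1<i<n$, $a_n=q^{-2n}$. Let $S=q\sum_i e^i_i\otimes e^i_i+\sum_{i\ne j}e^i_j\otimes e^j_i+\omega\sum_{i<k}e^i_i\otimes e^k_k$ (the Hecke matrix). Conjugation $\Omega\mapsto S\Omega S^{-1}$ preserves $\mathcal{M}^{\otimes2}_\alpha$ and has eigenvalues $1,-q^{2},-q^{-2}$ there; $\mathcal{M}^{\otimes2}_{\alpha;+}$ is its eigenspace for eigenvalue $1$ and $\mathcal{M}^{\otimes2}_{\alpha;-}$ the sum of its eigenspaces for $-q^{\pm2}$. Let $\sigma\colon\mathcal{M}^{\otimes2}\to\mathcal{M}^{\otimes2}$, $\sigma(\Omega_1\otimes\Omega_2)=(1\otimes\Omega_1)S(1\otimes\Omega_2)$, which is an isomorphism from action (β) to action (α). Put $\mathcal{M}^{\otimes2}_{\beta;\pm}=\sigma^{-1}(\mathcal{M}^{\otimes2}_{\alpha;\pm})$, and let $\mathcal{M}^{*\otimes2}_{\delta;\pm}\subset\mathcal{M}^{*\otimes2}_\delta$ be the annihilator of $\mathcal{M}^{\otimes2}_{\beta;\mp}$ under the trace pairing. The spaces $\mathcal{M}^{*\otimes2}_{\delta;\pm}$ are the symmetric/antisymmetric parts of the $\mathfrak{g}$-component for the involution $\tau_{RE}$ that gives the defining quadratic relations $L_2SL_2S=SL_2SL_2$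 of the reflection equation algebra. *)

(* Defs.v *)
From HB Require Import structures.
From mathcomp Require Import all_boot all_order all_algebra.
From mathcomp Require Import boolp classical_sets reals.
From mathcomp Require Import complex mxtens.
From mathcomp Require Import zify ring.

Set Implicit Arguments.
Unset Strict Implicit.
Unset Printing Implicit Defensive.

Import GRing.Theory.

Local Open Scope classical_set_scope.
Local Open Scope ring_scope.

(* The scalars: C(q^(1/2)), the fractions of C[X] with X = q^(1/2) and
   C = R[i].  No other fractional power of q occurs. *)
Definition Cq (R : realType) : fieldType := {fraction {poly R[i]}}.
Definition sqrt_q (R : realType) : Cq R := tofrac ('X : {poly R[i]}).

(* Everywhere below, t stands for q^(1/2). *)
Definition qpar (K : fieldType) (t : K) : K := t ^+ 2.
Definition omega (K : fieldType) (t : K) : K := qpar t - (qpar t)^-1.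

(* U_q(sl(n)) by generators and relations: elements are represented by
   expressions, and [Uq_eq] is equality in the presented algebra.  The power
   q^(H_i/2), which is not a polynomial in H_i, is a generator [UqK i], with
   inverse [UqKinv i].  Indices start at 0: i : 'I_n.-1 is the i+1 of the usual
   numbering.  All notions of module theory below involve x : Uq only through
   the operator by which it acts, so they do not distinguish expressions that
   represent the same element. *)
Inductive Uq (K : Type) (n : nat) : Type :=
  | UqH of 'I_n.-1
  | UqK of 'I_n.-1
  | UqKinv of 'I_n.-1
  | UqXp of 'I_n.-1
  | UqXm of 'I_n.-1
  | UqC of K
  | UqAdd of Uq K n & Uq K n
  | UqMul of Uq K n & Uq K n.

Arguments UqH {K n} i.
Arguments UqK {K n} i.
Arguments UqKinv {K n} i.
Arguments UqXp {K n} i.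
Arguments UqXm {K n} i.
Arguments UqC {K n} c.

Declare Scope uq_scope.
Delimit Scope uq_scope with U.
Bind Scope uq_scope with Uq.
Notation "x + y" := (UqAdd x y) : uq_scope.
Notation "x * y" := (UqMul x y) : uq_scope.
Notation "c %:U" := (UqC c%R) (at level 2, left associativity, format "c %:U")
  : uq_scope.

Definition adjacent (i j : nat) : bool := (i == j.+1) || (j == i.+1).

Definition cartan (i j : nat) : int :=
  if i == j then 2 else if adjacent i j then -1 else 0.

Inductive Uq_eq (K : fieldType) (t : K) (n : nat) : Uq K n -> Uq K n -> Prop :=
  | Uq_refl x : Uq_eq t x x
  | Uq_sym x y : Uq_eq t x y -> Uq_eq t y x
  | Uq_trans x y z : Uq_eq t x y -> Uq_eq t y z -> Uq_eq t x z
  | Uq_add x x' y y' :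
      Uq_eq t x x' -> Uq_eq t y y' -> Uq_eq t (x + y)%U (x' + y')%U
  | Uq_mul x x' y y' :
      Uq_eq t x x' -> Uq_eq t y y' -> Uq_eq t (x * y)%U (x' * y')%U
  | Uq_addA x y z : Uq_eq t (x + (y + z))%U ((x + y) + z)%U
  | Uq_addC x y : Uq_eq t (x + y)%U (y + x)%U
  | Uq_add0 x : Uq_eq t (0%:U + x)%U x
  | Uq_mulA x y z : Uq_eq t (x * (y * z))%U ((x * y) * z)%U
  | Uq_mul1 x : Uq_eq t (1%:U * x)%U x
  | Uq_mul0 x : Uq_eq t (0%:U * x)%U 0%:U%U
  | Uq_mulDl x y z : Uq_eq t ((x + y) * z)%U (x * z + y * z)%U
  | Uq_mulDr x y z : Uq_eq t (x * (y + z))%U (x * y + x * z)%U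
  | Uq_CD (c d : K) : Uq_eq t (c + d)%:U%U (c%:U + d%:U)%U
  | Uq_CM (c d : K) : Uq_eq t (c * d)%:U%U (c%:U * d%:U)%U
  | Uq_central (c : K) x : Uq_eq t (c%:U * x)%U (x * c%:U)%U
  | Uq_HH (i j : 'I_n.-1) : Uq_eq t (UqH i * UqH j)%U (UqH j * UqH i)%U
  | Uq_KH (i j : 'I_n.-1) : Uq_eq t (UqK i * UqH j)%U (UqH j * UqK i)%U
  | Uq_KK (i j : 'I_n.-1) : Uq_eq t (UqK i * UqK j)%U (UqK j * UqK i)%U
  | Uq_KKinv i : Uq_eq t (UqK i * UqKinv i)%U 1%:U%U
  | Uq_KinvK i : Uq_eq t (UqKinv i * UqK i)%U 1%:U%U
  | Uq_HXp (i j : 'I_n.-1) : Uq_eq t (UqH i * UqXp j)%U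
      (UqXp j * UqH i + (cartan i j)%:~R%:U * UqXp j)%U
  | Uq_HXm (i j : 'I_n.-1) : Uq_eq t (UqH i * UqXm j)%U
      (UqXm j * UqH i + (- cartan i j)%:~R%:U * UqXm j)%U
  | Uq_KXp (i j : 'I_n.-1) : Uq_eq t (UqK i * UqXp j)%U
      ((t ^ cartan i j)%:U * (UqXp j * UqK i))%U
  | Uq_KXm (i j : 'I_n.-1) : Uq_eq t (UqK i * UqXm j)%U
      ((t ^ (- cartan i j))%:U * (UqXm j * UqK i))%U
  | Uq_XpXm (i j : 'I_n.-1) : Uq_eq t (UqXp i * UqXm j)%U
      (UqXm j * UqXp i
       + (if i == j then (omega t)^-1 else 0)%:U
         * (UqK i * UqK i + (-1)%:U * (UqKinv i * UqKinv i)))%U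
  | Uq_XpXp (i j : 'I_n.-1) : i != j -> ~~ adjacent i j ->
      Uq_eq t (UqXp i * UqXp j)%U (UqXp j * UqXp i)%U
  | Uq_XmXm (i j : 'I_n.-1) : i != j -> ~~ adjacent i j ->
      Uq_eq t (UqXm i * UqXm j)%U (UqXm j * UqXm i)%U
  | Uq_SerreXp (i j : 'I_n.-1) : adjacent i j -> Uq_eq t
      (UqXp i * UqXp i * UqXp j + UqXp j * UqXp i * UqXp i)%U
      ((qpar t + (qpar t)^-1)%:U * (UqXp i * UqXp j * UqXp i))%U
  | Uq_SerreXm (i j : 'I_n.-1) : adjacent i j -> Uq_eq t
      (UqXm i * UqXm i * UqXm j + UqXm j * UqXm i * UqXm i)%U
      ((qpar t + (qpar t)^-1)%:U * (UqXm i * UqXm j * UqXm i))%U.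

(* A tensor is a list of tuples, standing for the sum of the corresponding
   simple tensors. *)
Fixpoint coprod (K : fieldType) (n : nat) (x : Uq K n) : seq (Uq K n * Uq K n) :=
  match x with
  | UqH i => [:: (UqH i, 1%:U%U); (1%:U%U, UqH i)]
  | UqK i => [:: (UqK i, UqK i)]
  | UqKinv i => [:: (UqKinv i, UqKinv i)]
  | UqXp i => [:: (UqXp i, UqKinv i); (UqK i, UqXp i)]
  | UqXm i => [:: (UqXm i, UqKinv i); (UqK i, UqXm i)]
  | UqC c => [:: (c%:U%U, 1%:U%U)]
  | UqAdd x y => coprod x ++ coprod y
  | UqMul x y =>
      [seq ((a.1 * b.1)%U, (a.2 * b.2)%U) | a <- coprod x, b <- coprod y]
  end.

(* x_(1) (x) x_(2) (x) x_(3) (x) x_(4), by coassociativity. *)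
Definition coprod4 (K : fieldType) (n : nat) (x : Uq K n) :
    seq (Uq K n * Uq K n * Uq K n * Uq K n) :=
  flatten [seq [seq (a.1, a.2, b.1, b.2) | a <- coprod p.1, b <- coprod p.2]
          | p <- coprod x].

Fixpoint antipode (K : fieldType) (t : K) (n : nat) (x : Uq K n) : Uq K n :=
  match x with
  | UqH i => ((-1)%:U * UqH i)%U
  | UqK i => UqKinv i
  | UqKinv i => UqK i
  | UqXp i => ((- (qpar t)^-1)%:U * UqXp i)%U
  | UqXm i => ((- qpar t)%:U * UqXm i)%U
  | UqC c => c%:U%U
  | UqAdd x y => (antipode t x + antipode t y)%U
  | UqMul x y => (antipode t y * antipode t x)%U
  end.

(* e i j is the matrix unit e^i_j, with labels starting at 1. *)
Definition e (K : fieldType) (n i j : nat) : 'M[K]_n :=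
  \matrix_(a, b) ((a.+1 == i) && (b.+1 == j))%:R.
Arguments e {K n} i j.

(* The fundamental representation.  As rho(H_i) is diagonal, rho(q^(H_i/2)) is
   the diagonal matrix of the numbers q^(h/2), h running over the diagonal of
   rho(H_i).  The usual index of the generator [UqH i] is i.+1. *)
Fixpoint rho (K : fieldType) (t : K) (n : nat) (x : Uq K n) : 'M[K]_n :=
  match x with
  | UqH i => e i.+1 i.+1 - e i.+2 i.+2
  | UqK i => \sum_(1 <= k < n.+1)
      (if k == i.+1 then t else if k == i.+2 then t^-1 else 1) *: e k k
  | UqKinv i => \sum_(1 <= k < n.+1)
      (if k == i.+1 then t^-1 else if k == i.+2 then t else 1) *: e k k
  | UqXp i => e i.+1 i.+2
  | UqXm i => e i.+2 i.+1
  | UqC c => c%:M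
  | UqAdd x y => rho t x + rho t y
  | UqMul x y => rho t x *m rho t y
  end.

(* The tensor square of M = 'M_n is the matrix algebra 'M_(n * n), with the
   Kronecker product [A *t B] of mxtens as A (x) B. *)
Definition M2 (K : fieldType) (n : nat) : lmodType K := 'M[K]_(n * n).

Definition act_alpha (K : fieldType) (t : K) (n : nat) (x : Uq K n)
    (Om : M2 K n) : M2 K n :=
  \sum_(s <- coprod4 x) let: (x1, x2, x3, x4) := s in
    (rho t (antipode t x2) *t rho t (antipode t x1)) *m Om
      *m (rho t x3 *t rho t x4).

Definition act_beta (K : fieldType) (t : K) (n : nat) (x : Uq K n)
    (Om : M2 K n) : M2 K n :=
  \sum_(s <- coprod4 x) let: (x1, x2, x3, x4) := s in
    (rho t (antipode t x1) *t rho t (antipode t x3)) *m Om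
      *m (rho t x2 *t rho t x4).

Definition act_delta (K : fieldType) (t : K) (n : nat) (x : Uq K n)
    (Om : M2 K n) : M2 K n :=
  \sum_(s <- coprod4 x) let: (x1, x2, x3, x4) := s in
    (rho t x2 *t rho t x4) *m Om
      *m (rho t (antipode t x1) *t rho t (antipode t x3)).

Lemma act_alpha_tens (K : fieldType) (t : K) (n : nat) (x : Uq K n)
    (A B : 'M[K]_n) :
  act_alpha t x (A *t B) = \sum_(s <- coprod4 x) let: (x1, x2, x3, x4) := s in
    (rho t (antipode t x2) *m A *m rho t x3)
      *t (rho t (antipode t x1) *m B *m rho t x4).
Proof. by apply: eq_bigr => -[[[x1 x2] x3] x4] _; rewrite !tensmx_mul. Qed.

Lemma act_beta_tens (K : fieldType) (t : K) (n : nat) (x : Uq K n)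
    (A B : 'M[K]_n) :
  act_beta t x (A *t B) = \sum_(s <- coprod4 x) let: (x1, x2, x3, x4) := s in
    (rho t (antipode t x1) *m A *m rho t x2)
      *t (rho t (antipode t x3) *m B *m rho t x4).
Proof. by apply: eq_bigr => -[[[x1 x2] x3] x4] _; rewrite !tensmx_mul. Qed.

Lemma act_delta_tens (K : fieldType) (t : K) (n : nat) (x : Uq K n)
    (A B : 'M[K]_n) :
  act_delta t x (A *t B) = \sum_(s <- coprod4 x) let: (x1, x2, x3, x4) := s in
    (rho t x2 *m A *m rho t (antipode t x1))
      *t (rho t x4 *m B *m rho t (antipode t x3)).
Proof. by apply: eq_bigr => -[[[x1 x2] x3] x4] _; rewrite !tensmx_mul. Qed.

(* Modules are given by the family of operators [act x], x in U_q; the notions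
   below read the same for left and for right modules.  In particular a highest
   weight vector of a right module is also one annihilated by the X_i^+, so that
   e^1_n, not e^n_1, is the highest weight vector of [gR] below. *)
Section Modules.
Variables (K : fieldType) (n : nat).

Definition submodule (V : lmodType K) (act : Uq K n -> V -> V) (W : set V) :
    Prop :=
  [/\ W 0, forall u v, W u -> W v -> W (u + v), forall c v, W v -> W (c *: v)
    & forall x v, W v -> W (act x v)].

Definition generated (V : lmodType K) (act : Uq K n -> V -> V) (vs : seq V) :
    set V :=
  [set v | forall W : set V,
     submodule act W -> (forall w, w \in vs -> W w) -> W v].

Definition isomorphic (V0 V : lmodType K) (act0 : Uq K n -> V0 -> V0)
    (W0 : set V0) (act : Uq K n -> V -> V) (W : set V) : Prop :=
  exists phi : {linear V0 -> V},
    [/\ forall u v, W0 u -> W0 v -> phi u = phi v -> u = v,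
        phi @` W0 = W
      & forall x v, W0 v -> phi (act0 x v) = act x (phi v)].

(* The sum of all submodules of V isomorphic to W0. *)
Definition isotypic (V0 V : lmodType K) (act0 : Uq K n -> V0 -> V0)
    (W0 : set V0) (act : Uq K n -> V -> V) : set V :=
  [set v | exists (k : nat) (W : 'I_k -> set V) (w : 'I_k -> V),
     [/\ forall i, submodule act (W i) /\ isomorphic act0 W0 act (W i),
         forall i, W i (w i) & v = \sum_(i < k) w i]].

Definition highest_weight (V : lmodType K) (act : Uq K n -> V -> V) (v : V) :
    Prop :=
  [/\ v <> 0, forall i, exists c : K, act (UqH i) v = c *: v
    & forall i, act (UqXp i) v = 0].

Definition lowest_weight (V : lmodType K) (act : Uq K n -> V -> V) (v : V) :
    Prop :=
  [/\ v <> 0, forall i, exists c : K, act (UqH i) v = c *: v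
    & forall i, act (UqXm i) v = 0].

End Modules.

(* The q-deformed adjoint module: for either action below, M is the direct sum
   of a one-dimensional trivial module and the irreducible module of type g,
   which is generated by e^1_n (right action), resp. e^n_1 (left action). *)
Definition adR (K : fieldType) (t : K) (n : nat) (x : Uq K n) (A : 'M[K]_n) :
    'M[K]_n :=
  \sum_(s <- coprod x) rho t (antipode t s.1) *m A *m rho t s.2.

Definition adL (K : fieldType) (t : K) (n : nat) (x : Uq K n) (A : 'M[K]_n) :
    'M[K]_n :=
  \sum_(s <- coprod x) rho t s.2 *m A *m rho t (antipode t s.1).

Definition gR (K : fieldType) (t : K) (n : nat) : set 'M[K]_n :=
  generated (adR t (n := n)) [:: e 1 n].

Definition gL (K : fieldType) (t : K) (n : nat) : set 'M[K]_n :=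
  generated (adL t (n := n)) [:: e n 1].

Arguments gR {K} t n _ : assert.
Arguments gL {K} t n _ : assert.

Section IsotypicComponents.
Variables (K : fieldType) (t : K) (n : nat).

Let q : K := qpar t.

Definition M2_alpha : set (M2 K n) :=
  isotypic (adR t (n := n)) (gR t n) (act_alpha t (n := n)).

Definition M2_beta : set (M2 K n) :=
  isotypic (adR t (n := n)) (gR t n) (act_beta t (n := n)).

Definition M2_delta : set (M2 K n) :=
  isotypic (adL t (n := n)) (gL t n) (act_delta t (n := n)).

Definition hecke : M2 K n :=
  q *: (\sum_(1 <= i < n.+1) e i i *t e i i)
  + \sum_(1 <= i < n.+1) \sum_(1 <= j < n.+1 | i != j) e i j *t e j i
  + omega t *: (\sum_(1 <= i < n.+1) \sum_(i.+1 <= k < n.+1) e i i *t e k k).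

Definition M2_alpha_eigen (c : K) : set (M2 K n) :=
  [set Om | M2_alpha Om /\ hecke *m Om *m invmx hecke = c *: Om].

Definition M2_alpha_plus : set (M2 K n) := M2_alpha_eigen 1.

Definition M2_alpha_minus : set (M2 K n) :=
  [set Om | exists u v, [/\ M2_alpha_eigen (- q ^+ 2) u,
                            M2_alpha_eigen (- q ^- 2) v & Om = u + v]].

(* The linear map A (x) B |-> (1 (x) A) S (1 (x) B), defined on the basis of
   the e^i_j (x) e^k_l: the coefficient of Om on e^i_j (x) e^k_l is the entry
   in row (i, k) and column (j, l).  See [sigma_tens]. *)
Definition sigma (Om : M2 K n) : M2 K n :=
  \sum_(i < n) \sum_(j < n) \sum_(k < n) \sum_(l < n)
    Om (mxtens_index (i, k)) (mxtens_index (j, l)) *: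
      ((1%:M *t delta_mx i j) *m hecke *m (1%:M *t delta_mx k l)).

Definition M2_beta_plus : set (M2 K n) := sigma @^-1` M2_alpha_plus.
Definition M2_beta_minus : set (M2 K n) := sigma @^-1` M2_alpha_minus.

(* See [trace_pairing_tens]. *)
Definition trace_pairing (X Y : M2 K n) : K := \tr (X *m Y).

Definition M2_delta_plus : set (M2 K n) :=
  [set Y | M2_delta Y /\ forall X, M2_beta_minus X -> trace_pairing X Y = 0].

Definition M2_delta_minus : set (M2 K n) :=
  [set Y | M2_delta Y /\ forall X, M2_beta_plus X -> trace_pairing X Y = 0].

Definition alpha1 : M2 K n := 1%:M *t e 1 n.
Definition alpha2 : M2 K n := \sum_(1 <= i < n.+1)
  (if i == 1%N then q else if i == n then q^-1 else 1) *: (e 1 n *t e i i).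
Definition alpha3 : M2 K n := \sum_(1 <= i < n.+1)
  (if i == 1%N then q else 1) *: (e 1 i *t e i n).
Definition alpha4 : M2 K n := \sum_(1 <= i < n.+1)
  (if i == n then q^-1 else 1) *: (e i n *t e 1 i).

Definition beta1 : M2 K n := 1%:M *t e 1 n.
Definition beta2 : M2 K n := e 1 n *t 1%:M.
Definition beta3 : M2 K n := \sum_(1 <= i < n.+1)
  q ^- (2 * (n - i) + 1) *: (e 1 i *t e i n).
Definition beta4 : M2 K n := \sum_(1 <= i < n.+1)
  (if i == 1%N then q else if i == n then q^-1 else 1) *: (e i n *t e 1 i).

Definition delta1 : M2 K n := \sum_(1 <= i < n.+1)
  q ^- (2 * i - 1) *: (e i i *t e n 1).
Definition delta2 : M2 K n := \sum_(1 <= i < n.+1)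
  e n 1 *t (q ^- (2 * i - 1) *: e i i).
Definition delta3 : M2 K n := \sum_(1 <= i < n.+1) e i 1 *t e n i.
Definition delta4 : M2 K n := \sum_(1 <= i < n.+1)
  (if i == 1%N then 1 else if i == n then q ^- (2 * n) else q ^- (2 * i - 1))
    *: (e n i *t e i 1).

End IsotypicComponents.

Arguments M2_alpha {K} t n _.
Arguments M2_beta {K} t n _.
Arguments M2_delta {K} t n _.
Arguments M2_alpha_plus {K} t n _.
Arguments M2_alpha_minus {K} t n _.
Arguments M2_beta_plus {K} t n _.
Arguments M2_beta_minus {K} t n _.
Arguments M2_delta_plus {K} t n _.
Arguments M2_delta_minus {K} t n _.

Lemma sigma_tens (K : fieldType) (t : K) (n : nat) (A B : 'M[K]_n) :
  sigma t (A *t B) = (1%:M *t A) *m hecke t n *m (1%:M *t B).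
Proof.
have tensr (I : Type) (r : seq I) (F : I -> 'M[K]_n) :
    (1%:M : 'M[K]_n) *t (\sum_(i <- r) F i) = \sum_(i <- r) 1%:M *t F i.
  apply: (big_morph (fun X : 'M[K]_n => (1%:M : 'M[K]_n) *t X)) => [X Y|].
    by apply/matrixP => a b; rewrite !mxE mulrDr.
  by apply/matrixP => a b; rewrite !mxE mulr0.
have tensZ c (X : 'M[K]_n) : (1%:M : 'M[K]_n) *t (c *: X) = c *: (1%:M *t X).
  by apply/matrixP => a b; rewrite !mxE mulrCA.
rewrite [in RHS](matrix_sum_delta A) [in RHS](matrix_sum_delta B) !tensr.
rewrite !mulmx_suml; apply: eq_bigr => i _.
rewrite tensr !mulmx_suml; apply: eq_bigr => j _.
rewrite mulmx_sumr; apply: eq_bigr => k _.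
rewrite tensr mulmx_sumr; apply: eq_bigr => l _.
by rewrite tensmxE !tensZ -!scalemxAl -scalemxAr scalerA.
Qed.

Lemma trace_pairing_tens (K : fieldType) (n : nat) (A B C D : 'M[K]_n) :
  trace_pairing (A *t B) (C *t D) = \tr (A *m C) * \tr (B *m D).
Proof.
rewrite /trace_pairing tensmx_mul /mxtrace mulr_sum.
by apply: eq_bigr => k _; rewrite !mxE.
Qed.

Section FundamentalRepresentation.
Variables (K : fieldType) (n : nat).

Lemma e_mul (i j k l : nat) : (0 < j <= n)%N ->
  (e i j : 'M[K]_n) *m e k l = if j == k then e i l else 0.
Proof.
case: j => // j /= jn; apply/matrixP => a b; rewrite !mxE.
rewrite (bigD1 (Ordinal jn)) //= big1 => [|c /negP cj]; last first.
  rewrite !mxE; case: eqP => [_|]; case: eqP => [[cE]|]; rewrite ?mul0r //=.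
  by case: cj; apply/eqP/val_inj.
rewrite !mxE eqxx andbT addr0 mulr_natl.
by case: ifP => jk; rewrite !mxE ?jk /= ?mul0rn // -mulr_natl -natrM mulnb.
Qed.

Definition dg (d : nat -> K) : 'M[K]_n := diag_mx (\row_a d a.+1).

Lemma diag_e (d : nat -> K) : \sum_(1 <= k < n.+1) d k *: e k k = dg d.
Proof.
apply/matrixP => a b; rewrite summxE !mxE big_add1 /= big_mkord.
rewrite (bigD1 a) //= big1 => [|c /negP ca]; last first.
  rewrite !mxE; case: eqP => [[cE]|]; rewrite ?mulr0 //.
  by case: ca; apply/eqP/val_inj.
by rewrite !mxE eqxx addr0 mulr_natr eqSS eq_sym.
Qed.

Lemma rho_H (t : K) (i : 'I_n.-1) :
  rho t (UqH i) = dg (fun k => (k == i.+1)%:R - (k == i.+2)%:R).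
Proof.
apply/matrixP => a b; rewrite !mxE -[a == b]/(val a == val b).
case: (eqVneq (val a) (val b)) => [<-|ab] /=; first by rewrite !andbb.
have E k : (a.+1 == k) && (b.+1 == k) = false
  by apply: contraNF ab => /andP[/eqP <-]; rewrite eqSS eq_sym.
by rewrite !E subrr mulr0n.
Qed.

Lemma dg_mul d d' : dg d *m dg d' = dg (fun k => d k * d' k).
Proof. by rewrite mul_diag_mx; apply/matrixP => a b; rewrite !mxE mulrnAr. Qed.

Lemma dg_e d i j : (dg d *m e i j = d i *: e i j).
Proof.
apply/matrixP => a b; rewrite mul_diag_mx !mxE.
by case: eqP => [<-|] //=; rewrite !mulr0.
Qed.

Lemma e_dg d i j : (e i j *m dg d = d j *: e i j).
Proof.
apply/matrixP => a b; rewrite mul_mx_diag !mxE mulrC.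
by case: andP => [[_ /eqP<-]|]; rewrite ?mulr0.
Qed.

Lemma dgD d d' : dg d + dg d' = dg (fun k => d k + d' k).
Proof. by apply/matrixP => a b; rewrite !mxE mulrnDl. Qed.
Lemma dgZ c d : c *: dg d = dg (fun k => c * d k).
Proof. by apply/matrixP => a b; rewrite !mxE mulrnAr. Qed.
Lemma dg1 : dg (fun=> 1) = 1%:M.
Proof. by apply/matrixP => a b; rewrite !mxE. Qed.
Lemma dg_ext d d' : d =1 d' -> dg d = dg d'.
Proof. by move=> dd; apply/matrixP => a b; rewrite !mxE dd. Qed.
Lemma rhoM (t : K) (x y : Uq K n) : rho t (x * y)%U = rho t x *m rho t y.
Proof. by []. Qed.
Lemma rhoD (t : K) (x y : Uq K n) : rho t (x + y)%U = rho t x + rho t y.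
Proof. by []. Qed.
Lemma rhoC (t c : K) : rho t (c%:U : Uq K n)%U = c%:M.
Proof. by []. Qed.
Lemma rhoK (t : K) (i : 'I_n.-1) :
  rho t (UqK i) = dg (fun k => if k == i.+1 then t else if k == i.+2 then t^-1 else 1).
Proof. exact: diag_e. Qed.
Lemma rhoKinv (t : K) (i : 'I_n.-1) :
  rho t (UqKinv i) = dg (fun k => if k == i.+1 then t^-1 else if k == i.+2 then t else 1).
Proof. exact: diag_e. Qed.
Lemma rhoXp (t : K) (i : 'I_n.-1) : rho t (UqXp i) = e i.+1 i.+2.
Proof. by []. Qed.
Lemma rhoXm (t : K) (i : 'I_n.-1) : rho t (UqXm i) = e i.+2 i.+1.
Proof. by []. Qed.
Definition rhoE := (rhoM, rhoD, rhoC, rho_H, rhoK, rhoKinv, rhoXp, rhoXm).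
End FundamentalRepresentation.

(* rho is a representation of the presented algebra. *)
Lemma rho_Uq_eq (K : fieldType) (t : K) (n : nat) (x y : Uq K n) :
  t != 0 -> omega t != 0 -> Uq_eq t x y -> rho t x = rho t y.
Proof.
move=> t0 w0.
have zE : (t ^ 0 = 1) * (t ^ 1 = t) * (t ^ 2 = t * t) * (t ^ (-1) = t^-1)
    * (t ^ (- 2%:Z) = (t * t)^-1).
  by split; [split; [split; [split|]|]|].
elim => {x y}.
- by [].
- by [].
- by move=> x y z _ -> _ ->.
- by move=> x x' y y' _ /= -> _ ->.
- by move=> x x' y y' _ /= -> _ ->.
- by move=> x y z /=; rewrite addrA.
- by move=> x y /=; rewrite addrC.
- by move=> x /=; rewrite raddf0 add0r.
- by move=> x y z /=; rewrite mulmxA.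
- by move=> x /=; rewrite mul1mx.
- by move=> x /=; rewrite raddf0 mul0mx.
- by move=> x y z /=; rewrite mulmxDl.
- by move=> x y z /=; rewrite mulmxDr.
- by move=> c d /=; rewrite raddfD.
- by move=> c d /=; rewrite scalar_mxM.
- by move=> c x /=; rewrite scalar_mxC.
- by move=> i j; rewrite !rhoE !dg_mul; apply: dg_ext => k; rewrite mulrC.
- by move=> i j; rewrite !rhoE !dg_mul; apply: dg_ext => k; rewrite mulrC.
- by move=> i j; rewrite !rhoE !dg_mul; apply: dg_ext => k; rewrite mulrC.
- move=> i; rewrite !rhoE dg_mul -dg1; apply: dg_ext => k.
  by case: ifP => _; [|case: ifP => _]; rewrite ?mulr1 ?divff ?mulVf.
- move=> i; rewrite !rhoE dg_mul -dg1; apply: dg_ext => k.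
  by case: ifP => _; [|case: ifP => _]; rewrite ?mulr1 ?divff ?mulVf.
- move=> i j; rewrite !rhoE dg_e e_dg mul_scalar_mx -scalerDl.
  congr (_ *: _); rewrite /cartan /adjacent.
  move: (nat_of_ord i) (nat_of_ord j) => a b; rewrite !eqSS.
  by do !case: eqP => ? /=; try lia; ring.
- move=> i j; rewrite !rhoE dg_e e_dg mul_scalar_mx -scalerDl.
  congr (_ *: _); rewrite /cartan /adjacent.
  move: (nat_of_ord i) (nat_of_ord j) => a b; rewrite !eqSS.
  by do !case: eqP => ? /=; try lia; ring.
- move=> i j; rewrite !rhoE dg_e e_dg mul_scalar_mx scalerA.
  congr (_ *: _); rewrite /cartan /adjacent.
  move: (nat_of_ord i) (nat_of_ord j) => a b; rewrite !eqSS.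
  by do !case: eqP => ? /=; try lia; rewrite ?opprK ?oppr0 ?zE; field.
- move=> i j; rewrite !rhoE dg_e e_dg mul_scalar_mx scalerA.
  congr (_ *: _); rewrite /cartan /adjacent.
  move: (nat_of_ord i) (nat_of_ord j) => a b; rewrite !eqSS.
  by do !case: eqP => ? /=; try lia; rewrite ?opprK ?oppr0 ?zE; field.
- move=> i j; rewrite !rhoE.
  have ib : (0 < i.+2 <= n)%N by have := ltn_ord i; lia.
  have ia : (0 < i.+1 <= n)%N by lia.
  have jb : (0 < j.+2 <= n)%N by have := ltn_ord j; lia.
  have ja : (0 < j.+1 <= n)%N by lia.
  rewrite !e_mul // !eqSS
    [X in _ = _ + X](_ : _ = if i == j then rho t (UqH i) else 0); last first.
    rewrite mul_scalar_mx !dg_mul mul_scalar_mx dgZ dgD dgZ.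
    case: ifP => _; last by apply/matrixP => a b; rewrite !mxE mul0r mul0rn.
    rewrite rhoE; apply: dg_ext => k.
    have E1 : t * t + -1 * (t^-1 * t^-1) = omega t.
      by rewrite /omega /qpar invfM mulN1r expr2.
    have E2 : t^-1 * t^-1 + -1 * (t * t) = - omega t.
      by rewrite /omega /qpar invfM mulN1r expr2 opprB.
    do 2?[case: eqP => ?] => /=; try lia; rewrite ?E1 ?E2 ?mulrN ?mulVf //; ring.
  case: (eqVneq i j) => [->|ij]; first by rewrite !eqxx /= addrC subrK.
  have /negPf ij' : (i : nat) != j by [].
  by rewrite [(j : nat) == _]eq_sym ij' addr0.
- move=> i j ij nij; rewrite !rhoE.
  have ib : (0 < i.+2 <= n)%N by have := ltn_ord i; lia.
  have jb : (0 < j.+2 <= n)%N by have := ltn_ord j; lia.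
  by rewrite !e_mul //; move: nij; rewrite /adjacent !eqSS; do !case: eqP => ? //=; lia.
- move=> i j ij nij; rewrite !rhoE.
  have ib : (0 < i.+1 <= n)%N by have := ltn_ord i; lia.
  have jb : (0 < j.+1 <= n)%N by have := ltn_ord j; lia.
  by rewrite !e_mul //; move: nij; rewrite /adjacent !eqSS; do !case: eqP => ? //=; lia.
- move=> i j aij; rewrite !rhoE.
  have ib : (0 < i.+2 <= n)%N by have := ltn_ord i; lia.
  have jb : (0 < j.+2 <= n)%N by have := ltn_ord j; lia.
  rewrite -!mulmxA !e_mul // !eqSS; move: aij; rewrite /adjacent.
  by do !case: eqP => ? //=; try lia; 
    rewrite ?mulmx0 ?add0r ?addr0 ?e_mul // ?eqSS;
    do !case: eqP => ? //=; try lia; rewrite ?mulmx0 ?addr0.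
- move=> i j aij; rewrite !rhoE.
  have ib : (0 < i.+1 <= n)%N by have := ltn_ord i; lia.
  have jb : (0 < j.+1 <= n)%N by have := ltn_ord j; lia.
  rewrite -!mulmxA !e_mul // !eqSS; move: aij; rewrite /adjacent.
  by do !case: eqP => ? //=; try lia; 
    rewrite ?mulmx0 ?add0r ?addr0 ?e_mul // ?eqSS;
    do !case: eqP => ? //=; try lia; rewrite ?mulmx0 ?addr0.
Qed.

(* Main.v *)
(** The Hecke matrix S commutes with the image of U_q in the endomorphisms of the
    tensor square V2 of the fundamental representation, so for each pair of its
    spectral projections P_l, P_r (eigenvalues q, -1/q) the map
    A |-> P_l (1 (x) A) P_r intertwines the adjoint action with action (alpha).
    Conversely, a homomorphism from the adjoint module is determined by the image
    v of e^1_n; v commutes with the X_i^+ up to scalars, and V2 is generated under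
    the X_i^+ by its two lowest weight vectors, whose images under v each lie in a
    weight space of dimension two.  So the (alpha)-component is the sum of the
    images of the four maps, on which conjugation by S has eigenvalues 1, 1, -q^2
    and -q^-2.  The maps are injective because partial quantum traces bring the
    invariant form on the image back to a multiple of the one on the adjoint
    module; the multiple of (l, r) = (-, -) is proportional to [n - 2]_q, whence
    n > 2.

    Action (beta) is transported along sigma, which is triangular, hence injective.
    Action (delta) is dual to (beta); transposition twisted by q^(2 rho) turns the
    dual of (alpha) back into (alpha), and under the resulting map the symmetric
    and antisymmetric parts are orthogonal because left and right multiplication
    by S are self-adjoint. *)

(* Every vector of the statement comes from [alpha1] by multiplying with powers of S on both sides.
   The Hecke relation gives S^-1 = S - w, and then [alpha2] = S alpha1 S^-1, [alpha3] = S alpha1,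
   [alpha4] = alpha1 S^-1. The map [sigma] sends [beta1], ..., [beta4] to S alpha1, alpha1 S,
   alpha1, alpha2; and q times [delta1], ..., [delta4] are the images of S^-1 alpha1, alpha1 S^-1,
   alpha1, alpha2 under [alpha_to_delta]. On the image belonging to (l, r), S multiplies from the
   left and from the right by scalars x and y in {q, -1/q}. A combination thus becomes a Laurent
   polynomial in x, y: it is symmetric if this vanishes for x y = -1 and antisymmetric if it
   vanishes for x = y; generation by two vectors is a nonzero 2 by 2 determinant.

   The isotypic component is found without complete reducibility: the possible images of e^1_n are
   bounded, and four explicit homomorphisms attain the bound. Genericity of q enters through a few
   scalars, each a polynomial in q^(1/2) up to a unit, and nonzero since its value at q = 1 is. *)
Require Import Defs.
From HB Require Import structures.
From mathcomp Require Import all_boot all_order all_algebra.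
From mathcomp Require Import boolp classical_sets reals.
From mathcomp Require Import complex mxtens.
From mathcomp Require Import zify ring.

Set Implicit Arguments.
Unset Strict Implicit.
Unset Printing Implicit Defensive.

Import GRing.Theory.

Local Open Scope ring_scope.

#[local] Arguments rho {K} t {n} x : simpl never.
#[local] Notation ix i j := (mxtens_index (i, j)).

(** * Modules and homomorphisms *)

Section Modules.
Variables (K : fieldType) (n : nat).

(** With these clauses an induction on the expression [x] reduces statements about [act x] to the
    five kinds of generators, as in [submodule_gens] and [intertwine_gens]. *)
Definition right_action (V : lmodType K) (act : Uq K n -> V -> V) : Prop :=
  [/\ forall x, linear (act x),
      forall x y v, act (x + y)%U v = act x v + act y v,
      forall x y v, act (x * y)%U v = act y (act x v)
    & forall c v, act c%:U%U v = c *: v].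

Lemma generated_submodule (V : lmodType K) (act : Uq K n -> V -> V) vs :
  submodule act (generated act vs).
Proof.
split=> [W [] // | u v gu gv W sW vsW | c v gv W sW vsW | x v gv W sW vsW];
  case: (sW) => _ WD WZ WA.
- by apply: WD; [apply: gu | apply: gv].
- by apply: WZ; apply: gv.
- by apply: WA; apply: gv.
Qed.

Lemma mem_generated (V : lmodType K) (act : Uq K n -> V -> V) vs v :
  v \in vs -> generated act vs v.
Proof. by move=> vvs W _; apply. Qed.

Lemma generated_sub (V : lmodType K) (act : Uq K n -> V -> V) vs ws :
  (forall w, w \in ws -> generated act vs w) ->
  (generated act ws `<=` generated act vs)%classic.
Proof. by move=> h v; apply=> //; apply: generated_submodule. Qed.

Lemma eq_generated (V : lmodType K) (act : Uq K n -> V -> V) vs ws :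
  (forall w, w \in ws -> generated act vs w) ->
  (forall v, v \in vs -> generated act ws v) ->
  generated act vs = generated act ws.
Proof.
by move=> h1 h2; apply/seteqP; split; apply: generated_sub.
Qed.

Lemma submodule_gens (V : lmodType K) (act : Uq K n -> V -> V) (W : set V) :
  right_action act -> W 0 -> (forall u v, W u -> W v -> W (u + v)) ->
  (forall c v, W v -> W (c *: v)) ->
  (forall v, W v -> [/\ forall i, W (act (UqH i) v),
      forall i, W (act (UqK i) v), forall i, W (act (UqKinv i) v),
      forall i, W (act (UqXp i) v) & forall i, W (act (UqXm i) v)]) ->
  submodule act W.
Proof.
case=> _ aD aM aC W0 WD WZ Wg; split=> //;
  elim=> [i|i|i|i|i|c|x IHx y IHy|x IHx y IHy] v Wv;
  try by case: (Wg v Wv).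
- by rewrite aC; apply: WZ.
- by rewrite aD; apply: WD; [apply: IHx | apply: IHy].
- by rewrite aM; apply/IHy/IHx.
Qed.

Lemma intertwine_gens (V V' : lmodType K) (act : Uq K n -> V -> V)
    (act' : Uq K n -> V' -> V') (F : {linear V -> V'}) :
  right_action act -> right_action act' ->
  (forall i v, F (act (UqH i) v) = act' (UqH i) (F v)) ->
  (forall i v, F (act (UqK i) v) = act' (UqK i) (F v)) ->
  (forall i v, F (act (UqKinv i) v) = act' (UqKinv i) (F v)) ->
  (forall i v, F (act (UqXp i) v) = act' (UqXp i) (F v)) ->
  (forall i v, F (act (UqXm i) v) = act' (UqXm i) (F v)) ->
  forall x v, F (act x v) = act' x (F v).
Proof.
case=> _ aD aM aC [_ aD' aM' aC'] FH FK FKi FXp FXm.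
elim=> [i|i|i|i|i|c|x IHx y IHy|x IHx y IHy] v //.
- by rewrite aC aC' linearZ.
- by rewrite aD aD' linearD IHx IHy.
- by rewrite aM aM' IHy IHx.
Qed.

(** The twist [s] is the identity when both modules are on the same side, as for [sigma], and
    [Uq_transpose] when a right module is turned into a left one. One inclusion pushes submodules
    forward along F, the other pulls them back. *)
Lemma generated_image (V V' : lmodType K) (act : Uq K n -> V -> V)
    (act' : Uq K n -> V' -> V') (F : {linear V -> V'}) (s : Uq K n -> Uq K n) vs :
  involutive s -> (forall x v, F (act (s x) v) = act' x (F v)) ->
  generated act' [seq F v | v <- vs] = (F @` generated act vs)%classic.
Proof.
move=> sK FA; apply/seteqP; split=> [v gv|_ [v gv <-] W sW vsW].
  have [g0 gD gZ gA] := generated_submodule act vs.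
  apply: gv => [|_ /mapP[w wvs ->]]; last by exists w => //; apply: mem_generated.
  split.
  - by exists 0; rewrite ?linear0.
  - by move=> _ _ [u gu <-] [w gw <-]; exists (u + w); rewrite ?linearD //; apply: gD.
  - by move=> c _ [u gu <-]; exists (c *: u); rewrite ?linearZ //; apply: gZ.
  - by move=> x _ [u gu <-]; exists (act (s x) u); rewrite ?FA //; apply: gA.
have [W0 WD WZ WA] := sW.
apply: (gv (fun u => W (F u))) => [|w wvs]; last by apply/vsW/map_f.
split=> [|u w Wu Ww|c u Wu|x u Wu]; rewrite ?linear0 ?linearD ?linearZ //.
- exact: WD.
- exact: WZ.
- by rewrite -[x]sK FA; apply: WA.
Qed.

(** A summand W goes to F(W), and its isomorphism phi with the model to F phi f; for this [f] runs
    from the new model of g to the old one. Both [f] and [F] twist the action by [s], and in the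
    composite the two twists cancel. *)
Lemma isotypic_image (V0 V V0' V' : lmodType K) (act0 : Uq K n -> V0 -> V0)
    (act : Uq K n -> V -> V) (act0' : Uq K n -> V0' -> V0')
    (act' : Uq K n -> V' -> V') (f : {linear V0' -> V0}) (F : {linear V -> V'})
    (s : Uq K n -> Uq K n) (W0 : set V0) (W0' : set V0') :
  injective f -> injective F -> (f @` W0' = W0)%classic ->
  (forall x A, f (act0' (s x) A) = act0 x (f A)) ->
  (forall x v, F (act (s x) v) = act' x (F v)) ->
  involutive s ->
  forall v, isotypic act0 W0 act v -> isotypic act0' W0' act' (F v).
Proof.
move=> fI FI fW fA FA sK v [k [W [w [Wi Ww ->]]]].
exists k, (fun i => (F @` W i)%classic), (F \o w); split.
- move=> i; have [[g0 gD gZ gA] [phi [phiI phiW phiA]]] := Wi i; split.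
    split.
    + by exists 0; rewrite ?linear0.
    + by move=> _ _ [u gu <-] [z gz <-]; exists (u + z); rewrite ?linearD //; apply: gD.
    + by move=> c _ [u gu <-]; exists (c *: u); rewrite ?linearZ //; apply: gZ.
    + by move=> x _ [u gu <-]; exists (act (s x) u); rewrite ?FA //; apply: gA.
  exists (F \o phi \o f : {linear _ -> _}); split.
  + move=> A B gA0 gB0 /= /FI /phiI fAB; apply: fI; apply: fAB; rewrite -fW.
      by exists A.
    by exists B.
  + rewrite -phiW -fW; apply/seteqP; split=> [_ [A gA0 <-]|_ [_ [_ [A gA0 <-] <-] <-]] /=.
      by exists (phi (f A)) => //; exists (f A) => //; exists A.
    by exists A.
  + move=> x A gA0 /=.
    by rewrite -[x in LHS]sK fA phiA -?FA ?sK // -fW; exists A.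
- by move=> i; exists (w i).
- by rewrite linear_sum.
Qed.

End Modules.

(** * The actions on generators *)

Section Tensors.
Variables (K : fieldType) (m n : nat).

Lemma tensmxDl (A A' : 'M[K]_m) (B : 'M[K]_n) : (A + A') *t B = A *t B + A' *t B.
Proof. by apply/matrixP => i j; rewrite !mxE mulrDl. Qed.
Lemma tensmxDr (A : 'M[K]_m) (B B' : 'M[K]_n) : A *t (B + B') = A *t B + A *t B'.
Proof. by apply/matrixP => i j; rewrite !mxE mulrDr. Qed.
Lemma tensmxZl m1 n1 m2 n2 c (A : 'M[K]_(m1, n1)) (B : 'M[K]_(m2, n2)) : (c *: A) *t B =
  c *: (A *t B).
Proof. by apply/matrixP => i j; rewrite !mxE mulrA. Qed.
Lemma tensmxZr m1 n1 m2 n2 c (A : 'M[K]_(m1, n1)) (B : 'M[K]_(m2, n2)) : A *t (c *: B) =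
  c *: (A *t B).
Proof. by apply/matrixP => i j; rewrite !mxE mulrCA. Qed.
Lemma tensmxNr (A : 'M[K]_m) (B : 'M[K]_n) : A *t (- B) = - (A *t B).
Proof. by apply/matrixP => i j; rewrite !mxE mulrN. Qed.
Lemma tensmxNl (A : 'M[K]_m) (B : 'M[K]_n) : (- A) *t B = - (A *t B).
Proof. by apply/matrixP => i j; rewrite !mxE mulNr. Qed.
Lemma tensmx11 : (1%:M : 'M[K]_m) *t (1%:M : 'M[K]_n) = 1%:M.
Proof.
apply/matrixP => x y; case: (mxtens_indexP x) => i j; case: (mxtens_indexP y) => k l.
rewrite tensmxE !mxE (can_eq (@mxtens_indexK _ _)) xpair_eqE.
by case: (i == k); case: (j == l); rewrite ?mulr0 ?mulr1.
Qed.

Lemma tens_mxP (A B : 'M[K]_(m * n)) :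
  (forall i j k l, A (mxtens_index (i, j)) (mxtens_index (k, l))
                 = B (mxtens_index (i, j)) (mxtens_index (k, l))) -> A = B.
Proof.
move=> h; apply/matrixP => x y.
by case: (mxtens_indexP x) => i j; case: (mxtens_indexP y) => k l.
Qed.

Lemma sum_mxtens (V : zmodType) (F : 'I_(m * n) -> V) :
  \sum_x F x = \sum_i \sum_j F (mxtens_index (i, j)).
Proof.
rewrite pair_big (reindex (@mxtens_index m n)) /=.
  by apply: eq_bigr => -[i j].
by exists (@mxtens_unindex m n) => x _; rewrite ?mxtens_indexK ?mxtens_unindexK.
Qed.

End Tensors.


Section Actions.
Variables (K : fieldType) (t : K) (n : nat).
Implicit Types (x y : Uq K n) (v : M2 K n).

Lemma sum_coprod4D (V : zmodType) (F : Uq K n * Uq K n * Uq K n * Uq K n -> V) x y :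
  \sum_(s <- coprod4 (x + y)%U) F s =
    \sum_(s <- coprod4 x) F s + \sum_(s <- coprod4 y) F s.
Proof. by rewrite /coprod4 /= map_cat flatten_cat big_cat. Qed.

Lemma sum_coprod4 (V : zmodType) (F : Uq K n * Uq K n * Uq K n * Uq K n -> V) x :
  \sum_(s <- coprod4 x) F s =
    \sum_(p <- coprod x) \sum_(a <- coprod p.1) \sum_(b <- coprod p.2)
      F (a.1, a.2, b.1, b.2).
Proof.
rewrite /coprod4 big_flatten big_map; apply: eq_bigr => p _.
by rewrite big_allpairs_dep.
Qed.

Lemma sum_coprodM (V : zmodType) (F : Uq K n * Uq K n -> V) x y :
  \sum_(p <- coprod (x * y)%U) F p =
    \sum_(p <- coprod x) \sum_(r <- coprod y) F (p.1 * r.1, p.2 * r.2)%U.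
Proof. by rewrite /= big_allpairs_dep. Qed.

(** The sum over [y] is outermost because in a right module a product acts as act y (act x v). *)
Lemma sum_coprod4M (V : zmodType) (F : Uq K n * Uq K n * Uq K n * Uq K n -> V) x y :
  \sum_(s <- coprod4 (x * y)%U) F s =
    \sum_(r <- coprod4 y) \sum_(s <- coprod4 x)
      F (s.1.1.1 * r.1.1.1, s.1.1.2 * r.1.1.2, s.1.2 * r.1.2, s.2 * r.2)%U.
Proof.
rewrite exchange_big /= !sum_coprod4 sum_coprodM; apply: eq_bigr => p _.
under eq_bigr => r _ do rewrite sum_coprodM.
rewrite exchange_big; apply: eq_bigr => a _ /=.
under eq_bigr => r _ do (under eq_bigr => r' _ do rewrite sum_coprodM).
under [RHS]eq_bigr => b _ do rewrite sum_coprod4.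
rewrite [RHS]exchange_big; apply: eq_bigr => r _ /=.
by rewrite [RHS]exchange_big.
Qed.

Lemma act_alpha_right : right_action (act_alpha t (n := n)).
Proof.
split.
- move=> x c u v; rewrite /act_alpha scaler_sumr -big_split;
  apply: eq_bigr => -[[[x1 x2] x3] x4] _.
  by rewrite mulmxDr mulmxDl -scalemxAr -scalemxAl.
- by move=> x y v; rewrite /act_alpha sum_coprod4D.
- move=> x y v; rewrite /act_alpha sum_coprod4M; apply: eq_bigr => -[[[y1 y2] y3] y4] _ /=.
  rewrite mulmx_sumr mulmx_suml; apply: eq_bigr => -[[[x1 x2] x3] x4] _ /=.
  by rewrite -!tensmx_mul !mulmxA.
- move=> c v; rewrite /act_alpha /coprod4 /= big_seq1 tensmx11 mulmx1.
  rewrite /antipode !rhoC -[c%:M]scalemx1.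
  by rewrite tensmxZr tensmx11 -scalemxAl mul1mx.
Qed.

Lemma act_beta_right : right_action (act_beta t (n := n)).
Proof.
split.
- move=> x c u v; rewrite /act_beta scaler_sumr -big_split;
  apply: eq_bigr => -[[[x1 x2] x3] x4] _.
  by rewrite mulmxDr mulmxDl -scalemxAr -scalemxAl.
- by move=> x y v; rewrite /act_beta sum_coprod4D.
- move=> x y v; rewrite /act_beta sum_coprod4M; apply: eq_bigr => -[[[y1 y2] y3] y4] _ /=.
  rewrite mulmx_sumr mulmx_suml; apply: eq_bigr => -[[[x1 x2] x3] x4] _ /=.
  by rewrite -!tensmx_mul !mulmxA.
- move=> c v; rewrite /act_beta /coprod4 /= big_seq1 tensmx11 mulmx1.
  rewrite /antipode !rhoC -[c%:M]scalemx1.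
  by rewrite tensmxZl tensmx11 -scalemxAl mul1mx.
Qed.

Lemma adR_right : right_action (adR t (n := n) : Uq K n -> 'M[K]_n -> 'M[K]_n).
Proof.
split.
- move=> x c u v; rewrite /adR scaler_sumr -big_split; apply: eq_bigr => s _.
  by rewrite mulmxDr mulmxDl -scalemxAr -scalemxAl.
- by move=> x y v; rewrite /adR big_cat.
- move=> x y v; rewrite /adR sum_coprodM exchange_big; apply: eq_bigr => s _ /=.
  rewrite mulmx_sumr mulmx_suml; apply: eq_bigr => r _ /=.
  by rewrite !mulmxA.
- by move=> c v; rewrite /adR /= big_seq1 /= mulmx1 mul_scalar_mx.
Qed.

(** These are the generators on the tensor square V2 of the fundamental representation. The antipode
    reverses the coproduct, so action (alpha) is the adjoint action on End(V2), and its formulas on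
    generators have the same shape as those of [adR]. *)
Definition H2 i : 'M[K]_(n * n) := rho t (UqH i) *t 1%:M + 1%:M *t rho t (UqH i).
Definition K2 i : 'M[K]_(n * n) := rho t (UqK i) *t rho t (UqK i).
Definition Ki2 i : 'M[K]_(n * n) := rho t (UqKinv i) *t rho t (UqKinv i).
Definition Xp2 i : 'M[K]_(n * n) :=
  rho t (UqXp i) *t rho t (UqKinv i) + rho t (UqK i) *t rho t (UqXp i).
Definition Xm2 i : 'M[K]_(n * n) :=
  rho t (UqXm i) *t rho t (UqKinv i) + rho t (UqK i) *t rho t (UqXm i).

Lemma act_alpha_H i v : act_alpha t (UqH i) v = v *m H2 i - H2 i *m v.
Proof.
rewrite /act_alpha sum_coprod4 /= ?big_cons ?big_nil /= ?big_cons ?big_nil /=.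
rewrite !rhoM !rhoC tensmx11 !mul1mx !mulmx1 !addr0 mul_scalar_mx tensmxZr tensmxZl.
rewrite -!scalemxAl !scaleN1r /H2 mulmxDr mulmxDl.
by rewrite opprD addrC; congr (_ + _); rewrite addrC.
Qed.
Lemma act_alpha_K i v : act_alpha t (UqK i) v = Ki2 i *m v *m K2 i.
Proof. by rewrite /act_alpha /coprod4 [coprod _]/= big_seq1. Qed.
Lemma act_alpha_Ki i v : act_alpha t (UqKinv i) v = K2 i *m v *m Ki2 i.
Proof. by rewrite /act_alpha /coprod4 [coprod _]/= big_seq1. Qed.
Lemma act_alpha_Xp i v : act_alpha t (UqXp i) v =
  Ki2 i *m v *m Xp2 i - (qpar t)^-1 *: (Xp2 i *m v *m Ki2 i).
Proof.
rewrite /act_alpha sum_coprod4 /= ?big_cons ?big_nil /= ?big_cons ?big_nil /=.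
rewrite !rhoM !rhoC mul_scalar_mx !addr0 tensmxZr tensmxZl -!scalemxAl !scaleNr /Xp2 /Ki2.
rewrite mulmxDr !mulmxDl scalerDr opprD.
by rewrite addrC; congr (_ + _); rewrite addrC.
Qed.
Lemma act_alpha_Xm i v : act_alpha t (UqXm i) v =
  Ki2 i *m v *m Xm2 i - qpar t *: (Xm2 i *m v *m Ki2 i).
Proof.
rewrite /act_alpha sum_coprod4 /= ?big_cons ?big_nil /= ?big_cons ?big_nil /=.
rewrite !rhoM !rhoC mul_scalar_mx !addr0 tensmxZr tensmxZl -!scalemxAl !scaleNr /Xm2 /Ki2.
rewrite mulmxDr !mulmxDl scalerDr opprD.
by rewrite addrC; congr (_ + _); rewrite addrC.
Qed.

Implicit Type A : 'M[K]_n.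

Lemma adR_H i A : adR t (UqH i) A = A *m rho t (UqH i) - rho t (UqH i) *m A.
Proof.
rewrite /adR /= !big_cons big_nil /=.
rewrite rhoM !rhoC !mul1mx !mulmx1 addr0.
by rewrite mul_scalar_mx scaleN1r mulNmx addrC.
Qed.
Lemma adR_K i A : adR t (UqK i) A = rho t (UqKinv i) *m A *m rho t (UqK i).
Proof. by rewrite /adR [coprod _]/= big_seq1. Qed.
Lemma adR_Ki i A : adR t (UqKinv i) A = rho t (UqK i) *m A *m rho t (UqKinv i).
Proof. by rewrite /adR [coprod _]/= big_seq1. Qed.
Lemma adR_Xp i A : adR t (UqXp i) A = rho t (UqKinv i) *m A *m rho t (UqXp i)
  - (qpar t)^-1 *: (rho t (UqXp i) *m A *m rho t (UqKinv i)).
Proof.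
rewrite /adR /= !big_cons big_nil addr0 addrC /=.
by rewrite rhoM rhoC mul_scalar_mx scaleNr !mulNmx -!scalemxAl.
Qed.
Lemma adR_Xm i A : adR t (UqXm i) A = rho t (UqKinv i) *m A *m rho t (UqXm i)
  - qpar t *: (rho t (UqXm i) *m A *m rho t (UqKinv i)).
Proof.
rewrite /adR /= !big_cons big_nil addr0 addrC /=.
by rewrite rhoM rhoC mul_scalar_mx scaleNr !mulNmx -!scalemxAl.
Qed.

End Actions.

(** * The Hecke matrix *)

Section Hecke.
Variables (K : fieldType) (t : K) (n : nat).
#[local] Notation q := (qpar t).
#[local] Notation w := (omega t).
#[local] Notation S := (hecke t n : 'M[K]_(n * n)).

Lemma sum_nat1 (V : zmodType) (F : nat -> V) :
  \sum_(1 <= i < n.+1) F i = \sum_(i < n) F i.+1.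
Proof. by rewrite big_add1 big_mkord. Qed.

Lemma sum_nat1_cond (V : zmodType) (P : pred nat) (F : nat -> V) :
  \sum_(1 <= i < n.+1 | P i) F i = \sum_(i < n | P i.+1) F i.+1.
Proof. by rewrite big_add1 big_mkord. Qed.

Lemma sum_pick (V : zmodType) (i0 : 'I_n) (F : 'I_n -> V) :
  (forall i, i != i0 -> F i = 0) -> \sum_i F i = F i0.
Proof. by move=> h; rewrite (bigD1 i0) //= big1 ?addr0. Qed.

Lemma hecke_coef (a j b k : 'I_n) : S (ix a j) (ix b k) =
  if a == j then q *+ ((b == a) && (k == a))
  else ((b == j) && (k == a))%:R + w *+ [&& (a < j)%N, b == a & k == j].
Proof.
have eE (x y u v : 'I_n) : (e x.+1 y.+1 : 'M[K]_n) u v = ((u == x) && (v == y))%:R.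
  by rewrite mxE !eqSS.
rewrite /hecke !mxE !summxE sum_nat1.
rewrite (sum_pick (i0 := a)); last first.
  by move=> i /negPf ia; rewrite tensmxE !eE [a == i]eq_sym ia mul0r.
rewrite tensmxE !eE eqxx /=.
rewrite [X in _ + X + _](_ : _ = ((a != j) && (b == j) && (k == a))%:R); last first.
  rewrite sum_nat1 (sum_pick (i0 := a)); last first.
    move=> i /negPf ia; rewrite summxE big1_seq // => l _.
    by rewrite tensmxE !mxE eqSS -[_ == i :> nat]/(a == i) [a == i]eq_sym ia mul0r.
  rewrite summxE sum_nat1_cond /= big_mkcond (sum_pick (i0 := b)); last first.
    move=> i /negPf ib; case: ifP => // _; rewrite tensmxE !eE.
    by rewrite [b == i]eq_sym ib andbF mul0r.
  rewrite tensmxE !eE !eqxx /= eqSS mul1r -[X in if X then _ else _]/(a != b).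
  rewrite [b == j]eq_sym; case: (eqVneq j b) => [->|].
    by rewrite andbT; case: ifP.
  by rewrite andbF if_same.
rewrite [X in _ + _ + _ * X](_ : _ = [&& (a < j)%N, b == a & k == j]%:R); last first.
  rewrite sum_nat1 (sum_pick (i0 := a)); last first.
    move=> i /negPf ia; rewrite summxE big1_seq // => l _.
    by rewrite tensmxE !mxE eqSS -[_ == i :> nat]/(a == i) [a == i]eq_sym ia mul0r.
  rewrite summxE (big_nat_widenl _ 1) // sum_nat1_cond big_mkcond (sum_pick (i0 := j));
    last first.
    move=> i /negPf ij; case: ifP => // _; rewrite tensmxE !eE.
    by rewrite [j == i]eq_sym ij /= mulr0.
  rewrite tensmxE !eE !eqxx /= !ltnS.
  by case: (a < j)%N; rewrite /= -?natrM ?mulnb.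
rewrite [j == a]eq_sym; case: (eqVneq a j) => [<-|aj] /=.
  by rewrite ltnn /= mulr0 !addr0 -natrM mulnb mulr_natr.
by rewrite !mulr0 add0r mulr_natr.
Qed.

Lemma heckeT : S^T = S.
Proof.
apply: tens_mxP => a j b k; rewrite mxE !hecke_coef.
case: (eqVneq b k) => [<-|bk]; case: (eqVneq a j) => [<-|aj].
- by rewrite [b == a]eq_sym.
- rewrite ![b == _]eq_sym; case: (eqVneq a b) => [<-|ab] /=.
    by rewrite [j == a]eq_sym (negPf aj) !andbF add0r.
  by rewrite !andbF add0r.
- rewrite ![a == _]eq_sym; case: (eqVneq b a) => [<-|ab] /=.
    by rewrite [k == b]eq_sym (negPf bk) /= !andbF add0r.
  by rewrite !andbF add0r.
- rewrite [a == k]eq_sym [j == b]eq_sym [a == b]eq_sym [j == k]eq_sym [(b == j) &&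
  _]andbC; congr (_ + _ *+ _).
  case: (eqVneq b a) => [->|] /=; last by rewrite !andbF.
  by case: (eqVneq k j) => [->|] //=; rewrite !andbF.
Qed.

(** Row (a, j) of S meets only the columns (a, j) and (j, a), so identities about S become case
    distinctions on the indices. *)
Lemma hecke_mulE m (u : 'M_(n * n, m)) a j c : (S *m u) (ix a j) c =
  if a == j then q * u (ix a j) c
  else u (ix j a) c + (w *+ (a < j)%N) * u (ix a j) c.
Proof.
rewrite mxE sum_mxtens; under eq_bigr => b _ do under eq_bigr => k _ do rewrite hecke_coef.
case: (eqVneq a j) => [<-|aj].
  rewrite (sum_pick (i0 := a)) ?(sum_pick (i0 := a)) ?eqxx // => [k /negPf ka|b /negPf ba].
    by rewrite ka mul0r.
  by rewrite big1 // => k _; rewrite ba mul0r.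
under eq_bigr => b _ do (under eq_bigr => k _ do rewrite mulrDl; rewrite big_split).
rewrite big_split; congr (_ + _) => /=.
  rewrite (sum_pick (i0 := j)) ?(sum_pick (i0 := a)) ?eqxx ?mul1r // => [k /negPf ka|b
    /negPf ba].
    by rewrite ka andbF mul0r.
  by rewrite big1 // => k _; rewrite ba mul0r.
rewrite (sum_pick (i0 := a)) ?(sum_pick (i0 := j)) ?eqxx ?andbT // => [k /negPf ka|b
  /negPf ba].
  by rewrite ka !andbF mul0r.
by rewrite big1 // => k _; rewrite ba andbF mul0r.
Qed.

Lemma mul_heckeE m (u : 'M_(m, n * n)) a j c : (u *m S) c (ix a j) =
  if a == j then q * u c (ix a j)
  else u c (ix j a) + (w *+ (a < j)%N) * u c (ix a j).
Proof.
by rewrite -[u *m S]trmxK trmx_mul heckeT mxE hecke_mulE !mxE.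
Qed.

Hypothesis t0 : t != 0.

Lemma qpar0 : q != 0. Proof. by rewrite expf_neq0. Qed.

Lemma omegaE : w = q - q^-1. Proof. by []. Qed.

(** The Hecke relation (S - q)(S + q^-1) = 0; it provides S^-1 = S - w and the two spectral
    projections. *)
Lemma hecke_sqr : S *m S = w *: S + 1%:M.
Proof.
apply: tens_mxP => a j b k.
rewrite [LHS]hecke_mulE [RHS]mxE [X in _ = X + _]mxE [X in _ = _ + X]mxE !hecke_coef
  (can_eq (@mxtens_indexK _ _)) xpair_eqE.
have q0 := qpar0; rewrite ![_ == b]eq_sym ![_ == k]eq_sym ![j == a]eq_sym.
case: (eqVneq a j) => [<-|aj].
  case: (b == a); case: (k == a); rewrite /= ?mulr0 ?addr0 // mulr1n omegaE; field.
  by [].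
move: (aj); rewrite -val_eqE /= => aj'.
case: (eqVneq b j) => [->|bj]; case: (eqVneq k a) => [->|ka] /=;
  rewrite ?(negPf aj) ?[_ == j]eq_sym ?(negPf aj) ?eqxx ?andbF ?andbT /=;
  case: (ltngtP a j) aj' => //= _ _; rewrite ?mulr0n ?mulr1n; try ring.
Qed.

End Hecke.

(** * Commutation of the Hecke matrix with the quantum group *)

Section HeckeCommutes.
Variables (K : fieldType) (t : K) (n : nat).
#[local] Notation q := (qpar t).
#[local] Notation w := (omega t).
#[local] Notation S := (hecke t n : 'M[K]_(n * n)).
Hypothesis t0 : t != 0.

Lemma addmxE m p (A B : 'M[K]_(m, p)) x y : (A + B) x y = A x y + B x y.
Proof. by rewrite mxE. Qed.
Lemma mx1E m x y : (1%:M : 'M[K]_m) x y = (x == y)%:R.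
Proof. by rewrite mxE. Qed.

Lemma dgE (d : nat -> K) (a b : 'I_n) : dg n d a b = d a.+1 *+ (a == b).
Proof. by rewrite !mxE. Qed.

(** S connects (a, j) only with itself and with (j, a), and a diagonal operator that is symmetric in
    the two legs takes the same value on both. *)
Lemma hecke_comm_dg (d : nat -> K) : S *m (dg n d *t dg n d) = (dg n d *t dg n d) *m S.
Proof.
apply: tens_mxP => a j b k; rewrite hecke_mulE mul_heckeE !tensmxE !dgE.
rewrite -!val_eqE /=; move: (val a) (val j) (val b) (val k) => {}a {}j {}b {}k.
by do 6?[case: eqP => [?|?]; try subst]; rewrite //= ?mulr0n ?mulr1n; try lia; ring.
Qed.

Lemma hecke_comm_dgD (d : nat -> K) :
  S *m (dg n d *t 1%:M + 1%:M *t dg n d) = (dg n d *t 1%:M + 1%:M *t dg n d) *m S.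
Proof.
apply: tens_mxP => a j b k; rewrite hecke_mulE mul_heckeE !addmxE !tensmxE !dgE !mx1E.
rewrite -!val_eqE /=; move: (val a) (val j) (val b) (val k) => {}a {}j {}b {}k.
by do 6?[case: eqP => [?|?]; try subst]; rewrite //= ?mulr0n ?mulr1n; try lia; ring.
Qed.

Lemma hecke_comm_H i : S *m H2 t i = H2 t i *m S.
Proof. by rewrite /H2 rho_H hecke_comm_dgD. Qed.
Lemma hecke_comm_K i : S *m K2 t i = K2 t i *m S.
Proof. by rewrite /K2 rhoK hecke_comm_dg. Qed.
Lemma hecke_comm_Ki i : S *m Ki2 t i = Ki2 t i *m S.
Proof. by rewrite /Ki2 rhoKinv hecke_comm_dg. Qed.

Lemma rho_XpE i (a b : 'I_n) : rho t (UqXp i) a b = ((a == i :> nat) && (b == i.+1 :>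
  nat))%:R.
Proof. by rewrite rhoXp mxE !eqSS. Qed.

(** Once the indices are compared with each other and with i and i + 1, each entry is an identity
    between rational functions of t. The case of X_i^- follows by transposition, S being
    symmetric. *)
Lemma hecke_comm_Xp i : S *m Xp2 t i = Xp2 t i *m S.
Proof.
apply: tens_mxP => a j b k; rewrite hecke_mulE mul_heckeE /Xp2.
rewrite !addmxE !tensmxE rhoK rhoKinv !dgE !rho_XpE !eqSS omegaE /qpar.
rewrite -!val_eqE /=; move: (val a) (val j) (val b) (val k) (val i) => {}a {}j {}b {}k {}i.
have tt : t * t^-1 = 1 by rewrite divff.
by do 12?[case: eqP => [?|?]; try subst; try lia]; do 2?[case: ltnP => ?; try lia];
  rewrite //= ?mulr0n ?mulr1n; field.
Qed.

Lemma rho_XmT i : rho t (UqXm i) = (rho t (UqXp i) : 'M[K]_n)^T.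
Proof. by apply/matrixP => a b; rewrite !mxE andbC. Qed.
Lemma dgT (d : nat -> K) : (dg n d)^T = dg n d.
Proof. exact: tr_diag_mx. Qed.
Lemma Xm2T i : Xm2 t i = (Xp2 t i)^T :> 'M[K]_(n * n).
Proof.
by rewrite /Xm2 /Xp2 raddfD /= !trmx_tens !rhoK !rhoKinv !dgT rho_XmT.
Qed.

Lemma hecke_comm_Xm i : S *m Xm2 t i = Xm2 t i *m S.
Proof. by apply: trmx_inj; rewrite Xm2T !trmx_mul trmxK heckeT hecke_comm_Xp. Qed.

End HeckeCommutes.

(** * Intertwining operators *)

Section Intertwiners.
Variables (K : fieldType) (t : K) (n : nat).
#[local] Notation q := (qpar t).
#[local] Notation w := (omega t).
#[local] Notation S := (hecke t n : 'M[K]_(n * n)).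
Hypothesis t0 : t != 0.

Lemma rhoKKi i : rho t (UqK i) *m rho t (UqKinv i) = 1%:M :> 'M[K]_n.
Proof.
rewrite rhoK rhoKinv dg_mul -dg1; apply: dg_ext => k.
by case: ifP => _; [|case: ifP => _]; rewrite ?mulr1 ?divff ?mulVf.
Qed.
Lemma rhoKiK i : rho t (UqKinv i) *m rho t (UqK i) = 1%:M :> 'M[K]_n.
Proof. by apply: mulmx1C; apply: rhoKKi. Qed.
Lemma rhoKi_Xp i : rho t (UqKinv i) *m rho t (UqXp i)
  = q^-1 *: (rho t (UqXp i) *m rho t (UqKinv i)) :> 'M[K]_n.
Proof.
rewrite rhoKinv rhoXp dg_e e_dg eqxx scalerA; congr (_ *: _).
by case: eqP => [|_]; [lia|rewrite eqxx /qpar; field].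
Qed.
Lemma rhoKi_Xm i : rho t (UqKinv i) *m rho t (UqXm i)
  = q *: (rho t (UqXm i) *m rho t (UqKinv i)) :> 'M[K]_n.
Proof.
rewrite rhoKinv rhoXm dg_e e_dg eqxx scalerA; congr (_ *: _).
by case: eqP => [|_]; [lia|rewrite eqxx /qpar; field].
Qed.

Lemma act_alpha_heckel x (v : 'M[K]_(n * n)) :
  act_alpha t x (S *m v : M2 K n) = S *m act_alpha t x v.
Proof.
symmetry; apply: (intertwine_gens (F := mulmx S) (@act_alpha_right K t n)
  (@act_alpha_right K t n)) => {x v} i v /=.
- by rewrite !act_alpha_H mulmxBr !mulmxA hecke_comm_H.
- by rewrite !act_alpha_K !mulmxA hecke_comm_Ki.
- by rewrite !act_alpha_Ki !mulmxA hecke_comm_K.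
- by rewrite !act_alpha_Xp mulmxBr -scalemxAr !mulmxA hecke_comm_Ki hecke_comm_Xp.
- by rewrite !act_alpha_Xm mulmxBr -scalemxAr !mulmxA hecke_comm_Ki hecke_comm_Xm.
Qed.

Lemma act_alpha_hecker x (v : 'M[K]_(n * n)) :
  act_alpha t x (v *m S : M2 K n) = act_alpha t x v *m S.
Proof.
symmetry; apply: (intertwine_gens (F := mulmxr S) (@act_alpha_right K t n)
  (@act_alpha_right K t n)) => {x v} i v /=.
- by rewrite !act_alpha_H mulmxBl -!mulmxA hecke_comm_H.
- by rewrite !act_alpha_K -!mulmxA hecke_comm_K.
- by rewrite !act_alpha_Ki -!mulmxA hecke_comm_Ki.
- by rewrite !act_alpha_Xp mulmxBl -scalemxAl -!mulmxA hecke_comm_Ki hecke_comm_Xp.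
- by rewrite !act_alpha_Xm mulmxBl -scalemxAl -!mulmxA hecke_comm_Ki hecke_comm_Xm.
Qed.

Definition tens1 (A : 'M[K]_n) : M2 K n := 1%:M *t A.
Fact tens1_linear : linear tens1.
Proof. by move=> c A B; rewrite /tens1 tensmxDr tensmxZr. Qed.
HB.instance Definition _ := GRing.isLinear.Build K 'M[K]_n (M2 K n) _ tens1 tens1_linear.

(** With 1 in the first leg, the antipode of x_(2) meets x_(3) directly, and the antipode axiom
    leaves the adjoint action on A. For X_i^+ and X_i^- this means that the two terms with X in the
    first leg cancel, by [rhoKi_Xp] and [rhoKi_Xm]. *)
Lemma act_alpha_tens1 x A : act_alpha t x (tens1 A) = tens1 (adR t x A).
Proof.
symmetry; apply: (intertwine_gens (F := tens1) (@adR_right K t n) (@act_alpha_right K t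
  n)) => {x A} i A /=;
  rewrite /tens1.
- rewrite act_alpha_H adR_H /H2 [in RHS]mulmxDl [in RHS]mulmxDr !tensmx_mul !mul1mx !mulmx1.
  by rewrite opprD addrACA subrr add0r tensmxDr tensmxNr.
- by rewrite act_alpha_K adR_K /K2 /Ki2 !tensmx_mul mulmx1 rhoKiK.
- by rewrite act_alpha_Ki adR_Ki /K2 /Ki2 !tensmx_mul mulmx1 rhoKKi.
- rewrite act_alpha_Xp adR_Xp /Xp2 /Ki2 !mulmxDl !mulmxDr !tensmx_mul mulmx1 !mulmx1
  rhoKKi rhoKiK rhoKi_Xp.
  by rewrite tensmxZl scalerDr opprD addrACA subrr add0r tensmxDr tensmxNr tensmxZr.
- rewrite act_alpha_Xm adR_Xm /Xm2 /Ki2 !mulmxDl !mulmxDr !tensmx_mul mulmx1 !mulmx1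
  rhoKKi rhoKiK rhoKi_Xm.
  by rewrite tensmxZl scalerDr opprD addrACA subrr add0r tensmxDr tensmxNr tensmxZr.
Qed.

Lemma delta_tens (i j k l : 'I_n) :
  delta_mx (ix i j) (ix k l) = delta_mx i k *t delta_mx j l :> 'M[K]_(n * n).
Proof.
apply: tens_mxP => a b c d; rewrite tensmxE !mxE !(can_eq (@mxtens_indexK _ _)) !xpair_eqE.
by rewrite -natrM mulnb andbACA.
Qed.

Lemma tens_linear_ext (V : lmodType K) (F G : {linear M2 K n -> V}) :
  (forall A B : 'M[K]_n, F (A *t B) = G (A *t B)) -> F =1 G.
Proof.
move=> h v; rewrite [v]matrix_sum_delta !linear_sum; apply: eq_bigr => x _.
rewrite !linear_sum; apply: eq_bigr => y _; rewrite !linearZ /=; congr (_ *: _).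
case: (mxtens_indexP x) => i j; case: (mxtens_indexP y) => k l.
by rewrite delta_tens.
Qed.

Fact sigma_linear : linear (sigma t (n := n)).
Proof.
move=> c u v; rewrite /sigma scaler_sumr -big_split; apply: eq_bigr => i _ /=.
rewrite scaler_sumr -big_split; apply: eq_bigr => j _ /=.
rewrite scaler_sumr -big_split; apply: eq_bigr => k _ /=.
rewrite scaler_sumr -big_split; apply: eq_bigr => l _ /=.
by rewrite !mxE scalerDl scalerA.
Qed.
HB.instance Definition _ := GRing.isLinear.Build K (M2 K n) (M2 K n) _ (sigma t (n := n))
  sigma_linear.

End Intertwiners.

(** * The map sigma *)

Section Sigma.
Variables (K : fieldType) (t : K) (n : nat).
#[local] Notation q := (qpar t).
#[local] Notation w := (omega t).
#[local] Notation S := (hecke t n : 'M[K]_(n * n)).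
Hypothesis t0 : t != 0.
Implicit Types A B : 'M[K]_n.

Lemma act_beta_H i A B : act_beta t (UqH i) (A *t B) =
  (A *m rho t (UqH i) - rho t (UqH i) *m A) *t B
  + A *t (B *m rho t (UqH i) - rho t (UqH i) *m B).
Proof.
rewrite act_beta_tens sum_coprod4 /= ?big_cons ?big_nil /= ?big_cons ?big_nil /=.
rewrite !rhoM !rhoC !mul1mx !mulmx1 !addr0 !mul_scalar_mx !scaleN1r !mulNmx.
by rewrite addrA -tensmxDl -addrA -tensmxDr ![- _ + _]addrC.
Qed.
Lemma act_beta_K i A B : act_beta t (UqK i) (A *t B) =
  (rho t (UqKinv i) *m A *m rho t (UqK i)) *t (rho t (UqKinv i) *m B *m rho t (UqK i)).
Proof. by rewrite act_beta_tens /coprod4 [coprod _]/= big_seq1. Qed.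
Lemma act_beta_Ki i A B : act_beta t (UqKinv i) (A *t B) =
  (rho t (UqK i) *m A *m rho t (UqKinv i)) *t (rho t (UqK i) *m B *m rho t (UqKinv i)).
Proof. by rewrite act_beta_tens /coprod4 [coprod _]/= big_seq1. Qed.

(** Covers X_i^+ with c = q^-1 and X_i^- with c = q, the constants of the antipode. *)
Lemma act_beta_X c (x : Uq K n) i A B :
    coprod x = [:: (x, UqKinv i); (UqK i, x)] ->
    rho t (antipode t x) = - (c *: rho t x) :> 'M[K]_n ->
  let X := rho t x in let k := rho t (UqKinv i) in let h := rho t (UqK i) in
  act_beta t x (A *t B) =
    (k *m A *m X) *t (h *m B *m k) - c *: ((X *m A *m k) *t (h *m B *m k))
    + ((k *m A *m h) *t (k *m B *m X) - c *: ((k *m A *m h) *t (X *m B *m k))).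
Proof.
move=> cx ax; rewrite act_beta_tens sum_coprod4 cx /= ?big_cons ?big_nil /= cx ?big_cons
  ?big_nil /=.
rewrite ax !addr0 !mulNmx tensmxNr tensmxNl -!scalemxAl tensmxZl tensmxZr.
by congr (_ + _); rewrite addrC.
Qed.

(* [X], [k], [h] are the images of X_i^+ or X_i^-, q^(-H_i/2), q^(H_i/2), and [T]
   is the Hecke matrix, abstracted because distributivity would otherwise rewrite
   inside the sums that define it. *)
Section OneGenerator.
Variables (X k h : 'M[K]_n) (c : K) (T : 'M[K]_(n * n)).
Hypotheses (kh : k *m h = 1%:M) (hk : h *m k = 1%:M) (kX : k *m X = c *: (X *m k)).
Hypothesis Thh : T *m (h *t h) = (h *t h) *m T.
Hypothesis TX : T *m (X *t k + h *t X) = (X *t k + h *t X) *m T.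
#[local] Notation L A := (1%:M *t A).
#[local] Notation R A := (A *t 1%:M).

Let LM A B : L (A *m B) = L A *m L B :> 'M[K]_(n * n).
Proof. by rewrite tensmx_mul mulmx1. Qed.
Let tRL A B : A *t B = R A *m L B :> 'M[K]_(n * n).
Proof. by rewrite !tensmx_mul !mulmx1 !mul1mx. Qed.

(** As T commutes with h (x) h, a group-like factor around T in the second leg can be replaced by
    its inverse in the first. [legs3] is the analogue for X: it is [TX] multiplied by k (x) 1 on the
    left and by 1 (x) h on the right. *)
Let legs1 : L k *m T *m L h = R h *m T *m R k.
Proof.
have -> : L h = (h *t h) *m R k :> 'M[K]_(n * n) by rewrite tensmx_mul hk mulmx1.
by rewrite -!mulmxA [T *m (_ *m _)]mulmxA Thh !mulmxA tensmx_mul kh mul1mx.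
Qed.

Let legs2 : L h *m T *m L k = R k *m T *m R h.
Proof.
have -> : L h = R k *m (h *t h) :> 'M[K]_(n * n) by rewrite tensmx_mul kh mul1mx.
by rewrite -!mulmxA [(h *t h) *m _]mulmxA -Thh -!mulmxA tensmx_mul hk mulmx1.
Qed.

Let legs3 : L X *m T *m L h - c *: (L h *m T *m L X)
  = R k *m T *m R X - c *: (R X *m T *m R k).
Proof.
have := congr1 (fun M => R k *m M *m L h) TX.
rewrite /= !(mulmxDl, mulmxDr) !mulmxA.
have -> : R k *m T *m (X *t k) *m L h = R k *m T *m R X.
  by rewrite -!mulmxA tensmx_mul mulmx1 kh.
have -> : R k *m T *m (h *t X) *m L h = c *: (L h *m T *m L X).
  rewrite [h *t X]tRL !mulmxA -legs2 -!mulmxA -!LM [k *m _]mulmxA kX.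
  by rewrite -scalemxAl -[X *m k *m h]mulmxA kh mulmx1 tensmxZr -!scalemxAr.
have -> : R k *m (X *t k) *m T *m L h = c *: (R X *m T *m R k).
  rewrite tensmx_mul mul1mx kX tensmxZl -!scalemxAl.
  have -> : (X *m k) *t k = R (X *m k) *m L k :> 'M[K]_(n * n) by rewrite -tRL.
  rewrite -!mulmxA [L k *m _]mulmxA legs1 !mulmxA tensmx_mul -[X *m k *m h]mulmxA kh.
  by rewrite !mulmx1.
have -> : R k *m (h *t X) *m T *m L h = L X *m T *m L h.
  by rewrite tensmx_mul kh mul1mx.
by move=> E; apply/eqP; rewrite subr_eq addrAC eq_sym subr_eq E addrC.
Qed.

Lemma sigma_group_like A B :
  L (k *m A *m h) *m T *m L (k *m B *m h) = (k *t k) *m (L A *m T *m L B) *m (h *t h).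
Proof.
transitivity (L k *m L A *m (L h *m T *m L k) *m L B *m L h); first by rewrite !LM !mulmxA.
by rewrite legs2 !mulmxA !tensmx_mul !mulmx1 !mul1mx -!mulmxA !tensmx_mul !mulmx1 !mul1mx.
Qed.

Lemma sigma_one_generator A B :
  L (k *m A *m X) *m T *m L (h *m B *m k) - c *: (L (X *m A *m k) *m T *m L (h *m B *m k))
  + (L (k *m A *m h) *m T *m L (k *m B *m X) - c *: (L (k *m A *m h) *m T *m L (X *m B *m
    k)))
  = (k *t k) *m (L A *m T *m L B) *m (X *t k + h *t X)
    - c *: ((X *t k + h *t X) *m (L A *m T *m L B) *m (k *t k)).
Proof.
have lA Y Z : (Y *t Z) *m L A = L Z *m L A *m R Y :> 'M[K]_(n * n).
  by rewrite !tensmx_mul !mulmx1 !mul1mx.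
have rB Y Z : L B *m (Y *t Z) = R Y *m L B *m L Z :> 'M[K]_(n * n).
  by rewrite !tensmx_mul !mulmx1 !mul1mx.
have sandwich (Y Z Y' Z' : 'M[K]_n) : (Y *t Z) *m (L A *m T *m L B) *m (Y' *t Z')
    = L Z *m L A *m (R Y *m T *m R Y') *m L B *m L Z'.
  by rewrite !mulmxA lA -[_ *m L B *m _]mulmxA rB !mulmxA.
have spread (Y Z Y' Z' : 'M[K]_n) : L (Y *m A *m Z) *m T *m L (Z' *m B *m Y')
    = L Y *m L A *m (L Z *m T *m L Z') *m L B *m L Y'.
  by rewrite !LM !mulmxA.
rewrite mulmxDr !mulmxDl scalerDr !sandwich !spread legs1 legs2.
(* The terms with X in an outer factor are matched by [legs1] and [legs2]. What remains are the
   terms with X next to T, and for them the claim is [legs3] multiplied by the outer factors. *)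
have := congr1 (fun M => L k *m L A *m M *m L B *m L k) legs3.
rewrite /= !(mulmxBl, mulmxBr) -!(scalemxAl, scalemxAr) => /eqP.
rewrite subr_eq => /eqP ->.
move: (L k *m L A *m (R k *m T *m R X) *m L B *m L k) => a1.
move: (L k *m L A *m (R k *m T *m R h) *m L B *m L X) => a2.
move: (L k *m L A *m (R X *m T *m R k) *m L B *m L k) => a3.
move: (L X *m L A *m (R h *m T *m R k) *m L B *m L k) => a4.
move: (L k *m L A *m (L h *m T *m L X) *m L B *m L k) => a5.
by apply/matrixP => x y; rewrite !mxE; ring.
Qed.

End OneGenerator.

Lemma sigma_act x (v : M2 K n) : sigma t (act_beta t x v) = act_alpha t x (sigma t v).
Proof.
have sB c u z : sigma t (u - c *: z) = sigma t u - c *: sigma t z.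
  by rewrite linearB linearZ.
have ext (y : Uq K n) : (forall A B, sigma t (act_beta t y (A *t B))
    = act_alpha t y (sigma t (A *t B))) ->
    forall v, sigma t (act_beta t y v) = act_alpha t y (sigma t v).
  move=> h; have [lb _ _ _] := @act_beta_right K t n;
    have [la _ _ _] := @act_alpha_right K t n.
  pose F0 v := sigma t (act_beta t y v); pose G0 v := act_alpha t y (sigma t v).
  have F_lin : linear F0 by move=> c u z; rewrite /F0 lb linearP.
  have G_lin : linear G0 by move=> c u z; rewrite /G0 linearP la.
  pose Fm := GRing.isLinear.Build K (M2 K n) (M2 K n) _ F0 F_lin.
  pose Gm := GRing.isLinear.Build K (M2 K n) (M2 K n) _ G0 G_lin.
  pose F := HB.pack_for {linear M2 K n -> M2 K n} F0 Fm.
  pose G := HB.pack_for {linear M2 K n -> M2 K n} G0 Gm.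
  exact: (tens_linear_ext (F := F) (G := G)).
apply: (intertwine_gens (F := sigma t (n := n)) (@act_beta_right K t n) (@act_alpha_right
  K t n)) => {x v} i;
  apply: ext => A B; rewrite sigma_tens.
- rewrite act_beta_H act_alpha_H linearD /= !sigma_tens.
  (* The primitive counterpart of [legs3]: commutation of S with H (x) 1 + 1 (x) H, placed between 1
     (x) A and 1 (x) B, trades H in the second leg next to S for H in the first leg. *)
  have := congr1 (fun M => (1%:M *t A) *m M *m (1%:M *t B)) (hecke_comm_H t i : S *m H2 t
    i = _).
  rewrite /H2; move: (rho t (UqH i)) (hecke t n : 'M[K]_(n * n)) => H T /= comm.
  have {comm} : 1%:M *t (A *m H) *m T *m (1%:M *t B) - 1%:M *t A *m T *m (1%:M *t (H *m B))
     = 1%:M *t A *m T *m (H *t B) - H *t A *m T *m (1%:M *t B).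
    apply/eqP; rewrite subr_eq addrAC eq_sym subr_eq; apply/eqP.
    move: comm; rewrite !(mulmxDl, mulmxDr) !mulmxA !tensmx_mul !mulmx1 !mul1mx.
    by rewrite -!mulmxA !tensmx_mul !mulmx1 !mul1mx => ->; rewrite addrC.
  rewrite !(mulmxDl, mulmxDr) !tensmxDr !tensmxNr !(mulmxDl, mulmxDr) !mulNmx !mulmxN
    !mulmxA.
  rewrite !tensmx_mul !mulmx1 !mul1mx -!mulmxA !tensmx_mul !mulmx1 !mul1mx.
  rewrite !mulmxA => /eqP; rewrite subr_eq => /eqP ->.
  move: (_ *m (H *t B)) (_ *m _ *m (1%:M *t B)) (_ *m (1%:M *t (H *m B)))
    (1%:M *t (H *m A) *m T *m (1%:M *t B)) (_ *m (1%:M *t (B *m H))) => a1 a2 a3 a4 a5.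
  by apply/matrixP => x y; rewrite !mxE; ring.
- by rewrite act_beta_K act_alpha_K sigma_tens sigma_group_like //;
  [exact: rhoKiK|exact: rhoKKi|exact: hecke_comm_K].
- by rewrite act_beta_Ki act_alpha_Ki sigma_tens sigma_group_like //;
  [exact: rhoKKi|exact: rhoKiK|exact: hecke_comm_Ki].
- rewrite (act_beta_X (c := q^-1) (i := i)) //; last first.
    by rewrite /antipode rhoM rhoC mul_scalar_mx scaleNr.
  rewrite linearD /= sB sB !sigma_tens act_alpha_Xp.
  rewrite sigma_one_generator //; first exact: rhoKiK.
  - exact: rhoKKi.
  - exact: rhoKi_Xp.
  - exact: hecke_comm_K.
  - exact: hecke_comm_Xp.
- rewrite (act_beta_X (c := q) (i := i)) //; last first.
    by rewrite /antipode rhoM rhoC mul_scalar_mx scaleNr.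
  rewrite linearD /= sB sB !sigma_tens act_alpha_Xm.
  rewrite sigma_one_generator //; first exact: rhoKiK.
  - exact: rhoKKi.
  - exact: rhoKi_Xm.
  - exact: hecke_comm_K.
  - exact: hecke_comm_Xm.
Qed.
End Sigma.

(** * Entries of sigma, and the alpha and beta vectors in terms of S *)

Section SigmaValues.
Variables (K : fieldType) (t : K) (n : nat).
#[local] Notation q := (qpar t).
#[local] Notation w := (omega t).
#[local] Notation S := (hecke t n : 'M[K]_(n * n)).
Hypothesis t0 : t != 0.

Lemma oppmxE m p (A : 'M[K]_(m, p)) x y : (- A) x y = - A x y.
Proof. by rewrite mxE. Qed.
Lemma scalemxE m p c (A : 'M[K]_(m, p)) x y : (c *: A) x y = c * A x y.
Proof. by rewrite mxE. Qed.

Lemma tens1_mulE m (A : 'M[K]_n) (u : 'M_(n * n, m)) a i c :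
  ((1%:M *t A) *m u) (ix a i) c = \sum_j A i j * u (ix a j) c.
Proof.
rewrite mxE sum_mxtens (sum_pick (i0 := a)) => [|b /negPf ba].
  by apply: eq_bigr => j _; rewrite tensmxE mx1E eqxx mul1r.
by rewrite big1 // => j _; rewrite tensmxE mx1E eq_sym ba !mul0r.
Qed.

Lemma mul_tens1E m (A : 'M[K]_n) (u : 'M_(m, n * n)) a i c :
  (u *m (1%:M *t A)) c (ix a i) = \sum_j u c (ix a j) * A j i.
Proof.
rewrite mxE sum_mxtens (sum_pick (i0 := a)) => [|b /negPf ba].
  by apply: eq_bigr => j _; rewrite tensmxE mx1E eqxx mul1r.
by rewrite big1 // => j _; rewrite tensmxE mx1E ba mul0r mulr0.
Qed.

(** For a different from b, [sigma] only permutes entries; for a = b it mixes them by a matrix that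
    is triangular in a, with q on the diagonal. *)
Lemma sigmaE (v : M2 K n) a i b l : sigma t v (ix a i) (ix b l) =
  if a == b then q * v (ix i a) (ix a l)
    + w * \sum_(j < n | (a < j)%N) v (ix i j) (ix j l)
  else v (ix i a) (ix b l).
Proof.
have -> : sigma t v (ix a i) (ix b l)
    = \sum_j \sum_k v (ix i k) (ix j l) * S (ix a j) (ix b k).
  rewrite /sigma summxE (sum_pick (i0 := i)) => [|x /negPf xi]; last first.
    rewrite summxE big1 // => j _; rewrite summxE big1 // => k _.
    rewrite summxE big1 // => y _; rewrite mxE -mulmxA tens1_mulE.
    by rewrite big1 ?mulr0 // => z _; rewrite mxE eq_sym xi mul0r.
  rewrite summxE; apply: eq_bigr => j _; rewrite summxE; apply: eq_bigr => k _.
  rewrite summxE (sum_pick (i0 := l)) => [|y /negPf yl]; last first.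
    by rewrite mxE mul_tens1E big1 ?mulr0 // => z _;
      rewrite [delta_mx _ _ _ _]mxE [l == y]eq_sym yl andbF mulr0.
  rewrite mxE mul_tens1E (sum_pick (i0 := k)) => [|z /negPf zk]; last first.
    by rewrite [delta_mx _ _ _ _]mxE zk mulr0.
  rewrite tens1_mulE (sum_pick (i0 := j)) => [|z /negPf zj]; last first.
    by rewrite [delta_mx _ _ _ _]mxE zj andbF mul0r.
  by rewrite ![delta_mx _ _ _ _]mxE !eqxx mul1r mulr1.
under eq_bigr => j _ do under eq_bigr => k _ do rewrite hecke_coef.
case: (eqVneq a b) => [<-|ab].
  rewrite (bigD1 a) //= eqxx (sum_pick (i0 := a)) => [|k /negPf ka];
    last by rewrite ka mulr0.
  rewrite eqxx mulrC mulr1n; congr (_ + _).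
  rewrite mulr_sumr [RHS]big_mkcond [LHS]big_mkcond; apply: eq_bigr => j _.
  case: (eqVneq j a) => [->|ja]; first by rewrite ltnn.
  rewrite /= (sum_pick (i0 := j)) => [|k /negPf kj].
    by rewrite eqxx andbT add0r mulrC; case: ifP; rewrite ?mul0r.
  by rewrite kj andbF add0r mulr0.
rewrite (sum_pick (i0 := b)) => [|j /negPf jb]; last first.
  rewrite big1 // => k _; rewrite [b == j]eq_sym jb /=.
  by rewrite andbF mulr0n addr0 if_same mulr0.
rewrite (negPf ab) (sum_pick (i0 := a)) => [|k /negPf ka]; last first.
  by rewrite ka !andbF addr0 mulr0.
by rewrite !eqxx andbF addr0 mulr1.
Qed.

Lemma sigma_inj : injective (sigma t (n := n)).
Proof.
apply: raddf_inj => v v0.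
have E a i b l : sigma t v (ix a i) (ix b l) = 0 by rewrite v0 mxE.
apply: tens_mxP => i a b l; rewrite [RHS]mxE.
case: (eqVneq a b) => [<-{b}|/negPf ab]; last by have := E a i b l; rewrite sigmaE ab.
(* Downward induction on a: the entries with j > a are already zero and drop out of the sum. *)
have [m] := ubnP (n - a); elim: m => // m IHm in a * => am.
have := E a i a l; rewrite sigmaE eqxx big1 => [|j aj].
  by rewrite mulr0 addr0 => /eqP; rewrite mulf_eq0 (negPf (qpar0 t0)) => /eqP.
by apply: IHm; move: (ltn_ord j) am aj; lia.
Qed.

Lemma tens_e_sumE (c : nat -> K) (x y z u : nat -> nat) a j b k :
  (\sum_(1 <= i < n.+1) c i *: (e (x i) (y i) *t e (z i) (u i) : 'M[K]_(n * n)))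
    (ix a j) (ix b k)
  = \sum_(i < n) c i.+1 * ([&& a.+1 == x i.+1, b.+1 == y i.+1,
                              j.+1 == z i.+1 & k.+1 == u i.+1])%:R.
Proof.
rewrite summxE sum_nat1; apply: eq_bigr => i _.
by rewrite mxE tensmxE !mxE -natrM mulnb -andbA.
Qed.

Lemma sum_pick_nat (c : 'I_n -> K) (P : pred 'I_n) (a : 'I_n) :
  (forall i, P i -> i = a) -> \sum_i c i * (P i)%:R = c a * (P a)%:R.
Proof.
move=> h; apply: sum_pick => i ia.
by case: (boolP (P i)) => [/h /eqP|]; rewrite ?(negPf ia) ?mulr0.
Qed.

Hypothesis n1 : (1 < n)%N.

Lemma alpha1E a j b k : alpha1 K n (ix a j) (ix b k)
  = [&& a == b :> nat, j == 0%N :> nat & k.+1 == n]%:R.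
Proof. by rewrite tensmxE !mxE eqSS -natrM mulnb. Qed.

Lemma alpha2E a j b k : alpha2 t n (ix a j) (ix b k)
  = (if j == 0%N :> nat then q else if j.+1 == n then q^-1 else 1)
    * [&& a == 0%N :> nat, b.+1 == n & k == j :> nat]%:R.
Proof.
rewrite /alpha2 tens_e_sumE (@sum_pick_nat _ _ j) => [|i /and4P[_ _ /eqP[ji] _]].
  by rewrite !eqSS eqxx.
exact/val_inj.
Qed.

Lemma alpha3E a j b k : alpha3 t n (ix a j) (ix b k)
  = (if j == 0%N :> nat then q else 1)
    * [&& a == 0%N :> nat, b == j :> nat & k.+1 == n]%:R.
Proof.
rewrite /alpha3 tens_e_sumE (@sum_pick_nat _ _ j) => [|i /and4P[_ _ /eqP[ji] _]].
  by rewrite !eqSS eqxx.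
exact/val_inj.
Qed.

Lemma alpha4E a j b k : alpha4 t n (ix a j) (ix b k)
  = (if a.+1 == n then q^-1 else 1)
    * [&& b.+1 == n, j == 0%N :> nat & k == a :> nat]%:R.
Proof.
rewrite /alpha4 tens_e_sumE (@sum_pick_nat _ _ a) => [|i /and4P[/eqP[ji] _ _ _]].
  by rewrite !eqSS eqxx.
exact/val_inj.
Qed.

Lemma beta3E a j b k : beta3 t n (ix a j) (ix b k)
  = q ^- (2 * (n - j.+1) + 1) * [&& a == 0%N :> nat, b == j :> nat & k.+1 == n]%:R.
Proof.
rewrite /beta3 tens_e_sumE (@sum_pick_nat _ _ j) => [|i /and4P[_ _ /eqP[ji] _]].
  by rewrite !eqSS eqxx.
exact/val_inj.
Qed.

Lemma beta4E a j b k : beta4 t n (ix a j) (ix b k)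
  = (if a == 0%N :> nat then q else if a.+1 == n then q^-1 else 1)
    * [&& b.+1 == n, j == 0%N :> nat & k == a :> nat]%:R.
Proof.
rewrite /beta4 tens_e_sumE (@sum_pick_nat _ _ a) => [|i /and4P[/eqP[ji] _ _ _]].
  by rewrite !eqSS eqxx.
exact/val_inj.
Qed.

Lemma alpha3_hecke : alpha3 t n = S *m alpha1 K n.
Proof.
apply: tens_mxP => a j b k; rewrite hecke_mulE alpha3E !alpha1E -!val_eqE /=.
move: (val a) (val j) (val b) (val k) => {}a {}j {}b {}k.
by do 12?[case: eqP => ?; try lia]; do 2?[case: ltnP => ?; try lia];
  rewrite /= ?mulr0n ?mulr1n; ring.
Qed.

Lemma alpha4_hecke : alpha4 t n = alpha1 K n *m S - w *: alpha1 K n.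
Proof.
apply: tens_mxP => a j b k; rewrite addmxE mul_heckeE oppmxE scalemxE alpha4E !alpha1E
  -!val_eqE /=.
rewrite /omega; have := qpar0 t0; move: (qpar t) => r r0.
have := ltn_ord b; have := ltn_ord k; have := ltn_ord a.
move: (val a) (val j) (val b) (val k) => {}a {}j {}b {}k bn kn an.
by do 12?[case: eqP => ?; try lia]; do 2?[case: ltnP => ?; try lia];
  rewrite /= ?mulr0n ?mulr1n; field.
Qed.

Lemma alpha2_hecke : alpha2 t n = S *m alpha1 K n *m S - w *: (S *m alpha1 K n).
Proof.
rewrite -alpha3_hecke.
apply: tens_mxP => a j b k; rewrite addmxE mul_heckeE oppmxE scalemxE alpha2E !alpha3E
  -!val_eqE /=.
rewrite /omega; have := qpar0 t0; move: (qpar t) => r r0.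
have := ltn_ord b; have := ltn_ord k; have := ltn_ord a; have := ltn_ord j.
move: (val a) (val j) (val b) (val k) => {}a {}j {}b {}k bn kn an jn.
by do 12?[case: eqP => ?; try lia]; do 2?[case: ltnP => ?; try lia];
  rewrite /= ?mulr0n ?mulr1n; field.
Qed.

Lemma sigma_beta1 : sigma t (beta1 K n) = S *m alpha1 K n.
Proof. by rewrite /beta1 sigma_tens tensmx11 mul1mx. Qed.

Lemma sigma_beta2 : sigma t (beta2 K n) = alpha1 K n *m S.
Proof. by rewrite /beta2 sigma_tens tensmx11 mulmx1. Qed.

Lemma sum_ord_gt (V : zmodType) (a : 'I_n) (F : nat -> V) :
  \sum_(j < n | (a < j)%N) F j = \sum_(a.+1 <= j < n) F j.
Proof.
rewrite (big_nat_widenl _ 0) // big_mkord.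
by apply: eq_bigl => j.
Qed.

Lemma sigma_beta3 : sigma t (beta3 t n) = alpha1 K n.
Proof.
apply: tens_mxP => a i b l; rewrite sigmaE alpha1E.
under eq_bigr => j _ do rewrite beta3E eqxx andTb.
rewrite !beta3E eqxx -val_eqE /=; case: eqP => [_|ab] /=; last first.
  have /negPf -> : (b != a :> nat) by apply/eqP => ba; case: ab.
  by rewrite andbF mulr0.
rewrite -mulr_suml !mulrA -mulrDl -[RHS]mul1r; congr (_ * _).
rewrite (sum_ord_gt a (fun j => q ^- (2 * (n - j.+1) + 1))) mulr_sumr.
have q0 := qpar0 t0.
(* Since w q^-(2m+1) = q^-(2m) - q^-(2m+2), the tail telescopes to 1 - q^-(2(n-a-1)), and the
   diagonal term supplies q^-(2(n-a-1)). The exponents of [beta3] are those that solve this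
   triangular system. *)
have -> : \sum_(a.+1 <= j < n) w * q ^- (2 * (n - j.+1) + 1)
    = \sum_(a.+1 <= j < n) (q ^- (2 * (n - j.+1)) - q ^- (2 * (n - j))).
  rewrite big_nat [RHS]big_nat; apply: eq_bigr => j /andP[_ jn].
  have -> : (2 * (n - j) = 2 * (n - j.+1) + 2)%N by lia.
  rewrite !exprD omegaE; field.
  by rewrite q0 expf_neq0.
rewrite (telescope_sumr (fun j => q ^- (2 * (n - j)))); last by rewrite ltn_ord.
rewrite subnn muln0 expr0 invr1 exprD; field.
by rewrite q0 expf_neq0.
Qed.

Lemma sigma_beta4 : sigma t (beta4 t n) = alpha2 t n.
Proof.
apply: tens_mxP => a i b l; rewrite sigmaE.
rewrite big1 => [|j aj]; rewrite !beta4E.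
  rewrite alpha2E -val_eqE /=; case: (eqVneq (val a) (val b)) => /= ab.
    rewrite -ab; case: (eqVneq (val a) 0%N) => [->|_]; rewrite /= ?andbF ?mulr0 ?addr0 //.
    have /negPf -> : 1%N != n by lia. by rewrite /= !mulr0.
  by rewrite andbCA.
have /negPf -> : j != 0%N :> nat by lia.
by rewrite andbF mulr0.
Qed.

End SigmaValues.

(** * The adjoint module *)

Section Adjoint.
Variables (K : fieldType) (t : K) (n : nat).
#[local] Notation q := (qpar t).
#[local] Notation E := (e 1 n : 'M[K]_n).
#[local] Notation G := (gR t n).
Hypothesis t0 : t != 0.

(* [Dq] represents q^(2 rho) up to a scalar: conjugation by it is the square of
   the antipode, so that tr (Dq A) is the quantum trace. *)
Definition dq (k : nat) : K := q ^- (2 * k.-1).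
Definition Dq : 'M[K]_n := dg n dq.

Lemma dq_neq0 k : dq k != 0.
Proof. by rewrite invr_eq0 expf_neq0 // qpar0. Qed.

Lemma dqS k : dq k.+1 = q ^+ 2 * dq k.+2.
Proof.
have q0 := qpar0 t0; rewrite /dq /= !mulnS exprD; field.
by rewrite q0 expf_neq0.
Qed.

Lemma Dq_Xp i : Dq *m rho t (UqXp i) = q ^+ 2 *: (rho t (UqXp i) *m Dq).
Proof. by rewrite rhoXp dg_e e_dg scalerA dqS. Qed.

Lemma Xm_Dq i : rho t (UqXm i) *m Dq = q ^+ 2 *: (Dq *m rho t (UqXm i)).
Proof. by rewrite rhoXm dg_e e_dg scalerA dqS. Qed.

Lemma dgC (d d' : nat -> K) : dg n d *m dg n d' = dg n d' *m dg n d.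
Proof. by rewrite !dg_mul; apply: dg_ext => k; rewrite mulrC. Qed.

Lemma gR_highest : G E. Proof. by apply: mem_generated; rewrite mem_seq1. Qed.

Lemma gR_submodule : submodule (adR t (n := n)) G.
Proof. exact: generated_submodule. Qed.

Hypothesis n1 : (1 < n)%N.

(** The kernel of the quantum trace is a submodule: the factor q^2 from moving X past [Dq] balances
    the antipode constant and the factor in [rhoKi_Xp] or [rhoKi_Xm]. It contains e^1_n, whose
    diagonal is zero because n > 1. *)
Lemma gR_qtrace A : G A -> \tr (Dq *m A) = 0.
Proof.
apply: (_ : (G `<=` [set A | \tr (Dq *m A) = 0])%classic) => {A} A; apply.
  have DK i : Dq *m rho t (UqK i) = rho t (UqK i) *m Dq by rewrite rhoK dgC.
  have DKi i : Dq *m rho t (UqKinv i) = rho t (UqKinv i) *m Dq by rewrite rhoKinv dgC.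
  have trD (L R B : 'M[K]_n) : \tr (Dq *m (L *m B *m R)) = \tr (R *m Dq *m L *m B).
    by rewrite !mulmxA mxtrace_mulC !mulmxA.
  apply: submodule_gens => [||u v u0 v0|c v v0|v v0] /=.
  - exact: adR_right.
  - by rewrite mulmx0 raddf0.
  - by rewrite mulmxDr raddfD /= u0 v0 addr0.
  - by rewrite -scalemxAr linearZ /= v0 mulr0.
  - split=> i.
    + rewrite adR_H mulmxBr raddfB /= mulmxA mxtrace_mulC !mulmxA.
      by rewrite rho_H dgC subrr.
    + by rewrite adR_K trD -[_ *m Dq *m _]mulmxA DKi mulmxA rhoKKi // mul1mx.
    + by rewrite adR_Ki trD -[_ *m Dq *m _]mulmxA DK mulmxA rhoKiK // mul1mx.
    + rewrite adR_Xp mulmxBr raddfB /= -scalemxAr linearZ /= !trD -[_ *m Dq *m rho t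
      (UqXp i)]mulmxA Dq_Xp.
      rewrite -scalemxAr mulmxA rhoKi_Xp // -!scalemxAl !linearZ /= -[rho t (UqXp i) *m _
        *m Dq]mulmxA -DKi mulmxA.
      by move: (\tr _) => z; rewrite /qpar; field.
    + rewrite adR_Xm mulmxBr raddfB /= -scalemxAr linearZ /= !trD Xm_Dq -DKi.
      rewrite -[Dq *m _ *m rho t (UqXm i)]mulmxA rhoKi_Xm // -!scalemxAr -!scalemxAl
        !linearZ /= mulmxA.
      by move: (\tr _) => z; rewrite /qpar; ring.
by move=> w; rewrite mem_seq1 => /eqP ->;
  rewrite /= dg_e linearZ /= /mxtrace big1 ?mulr0 // => a _;
  rewrite mxE; do 2!case: eqP => //=; lia.
Qed.

(** The eigenvalue of q^(-H_i/2) on the k-th basis vector of the fundamental representation, with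
    labels from 1; [kdir] further on is the one of q^(H_i/2). *)
Definition kinv i k : K := if k == i.+1 then t^-1 else if k == i.+2 then t else 1.

Lemma kinv_neq0 i k : kinv i k != 0.
Proof. by rewrite /kinv; case: ifP => _; [|case: ifP => _];
  rewrite ?invr_eq0 ?oner_eq0. Qed.

Lemma kinv1 i : kinv i i.+1 = t^-1. Proof. by rewrite /kinv eqxx. Qed.
Lemma kinv2 i : kinv i i.+2 = t.
Proof. by rewrite /kinv eqn_leq ltnn /= eqxx. Qed.

Lemma adR_Xm_e (i : 'I_n.-1) a b : (0 < a <= n)%N -> (0 < b <= n)%N ->
  adR t (UqXm i) (e a b) = (if b == i.+2 then kinv i a *: e a i.+1 else 0)
    - q *: (if a == i.+1 then kinv i b *: e i.+2 b else 0).
Proof.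
move=> an bn; rewrite adR_Xm rhoKinv rhoXm dg_e -scalemxAl e_mul // -mulmxA e_dg
  -scalemxAr e_mul; last first.
  by have := ltn_ord i; lia.
by congr (_ - _ *: _); [case: (b == i.+2)|rewrite [i.+1 == a]eq_sym; case: (a == i.+1)];
  rewrite // scaler0.
Qed.

Lemma gR_scale c A : c != 0 -> G (c *: A) -> G A.
Proof.
move=> c0 gA; rewrite -[A]scale1r -(mulVf c0) -scalerA.
by have [_ _ + _] := gR_submodule; apply.
Qed.

Lemma gR_Xm (i : 'I_n.-1) A : G A -> G (adR t (UqXm i) A).
Proof. by have [_ _ _] := gR_submodule; apply. Qed.

(** X_a^- sends e^a_b to a multiple of one matrix unit unless b = a + 1. So, away from the diagonal,
    lowering operators lead from e^1_n down the rows, and to the left along the columns by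
    [gR_col]. *)
Lemma gR_row a b : (0 < a < n)%N -> (0 < b <= n)%N -> b != a.+1 -> G (e a b) -> G (e a.+1
  b).
Proof.
move=> an bn ba gab; have i_n : (a.-1 < n.-1)%N by lia.
pose i := Ordinal i_n; have ia : i.+1 = a by rewrite /=; lia.
have := gR_Xm i gab; rewrite adR_Xm_e //; last by lia.
rewrite ia (negPf ba) eqxx sub0r -scaleNr scalerA; apply: gR_scale.
by rewrite mulf_neq0 ?oppr_eq0 ?qpar0 ?kinv_neq0.
Qed.

Lemma gR_col a b : (0 < a <= n)%N -> (0 < b < n)%N -> a != b -> G (e a b.+1) -> G (e a b).
Proof.
move=> an bn ab gab; have i_n : (b.-1 < n.-1)%N by lia.
pose i := Ordinal i_n; have ib : i.+1 = b by rewrite /=; lia.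
have := gR_Xm i gab; rewrite adR_Xm_e; [|lia|lia].
rewrite ib (negPf ab) eqxx scaler0 subr0; apply: gR_scale.
exact: kinv_neq0.
Qed.

Lemma gR_upper a b : (0 < a)%N -> (a < b <= n)%N -> G (e a b).
Proof.
move=> a0; have [m] := ubnP (n - b); elim: m b => // m IHm b bm ab.
have [bn|bn] := eqVneq b n; last first.
  by apply: gR_col; [lia|lia|lia|apply: IHm; lia].
subst b; clear IHm bm.
elim: a a0 ab => // -[_ _ _|a IHa _ an]; first exact: gR_highest.
by apply: gR_row; [lia|lia|lia|apply: IHa; lia].
Qed.

(** The case b = a + 1 excluded from [gR_row], where both terms of X_a^- survive. These vectors play
    the part of the Cartan elements. *)
Lemma gR_diag a : (0 < a < n)%N -> G (e a a - q ^+ 2 *: e a.+1 a.+1).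
Proof.
move=> an; have i_n : (a.-1 < n.-1)%N by lia.
pose i := Ordinal i_n; have ia : i.+1 = a by rewrite /=; lia.
have := gR_Xm i (@gR_upper a a.+1 _ _); rewrite adR_Xm_e; [|lia|lia].
rewrite -ia kinv1 kinv2 !eqxx => /(_ ltac:(lia) ltac:(lia)).
move=> gA; apply: (@gR_scale t^-1); first by rewrite invr_eq0.
rewrite scalerBr scalerA; suff -> : t^-1 * q ^+ 2 = q * t by rewrite -scalerA.
by rewrite /qpar; field.
Qed.

Hypothesis q2 : q + q^-1 != 0.

(** The diagonal is crossed by a second application of X_a^-, to the vector of [gR_diag]. The
    coefficient that arises is - t^3 (q + q^-1), and this is where [q2] enters. *)
Lemma gR_lower a b : (0 < b)%N -> (b < a <= n)%N -> G (e a b).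
Proof.
move=> b0; elim: a => // a IHa ab.
have [ba|ab'] := eqVneq b a; last first.
  by apply: gR_row; [lia|lia|lia|apply: IHa; lia].
move: b0 ab; rewrite ba => {b ba IHa} a0 ab.
have i_n : (a.-1 < n.-1)%N by lia.
pose i := Ordinal i_n; have ia : i.+1 = a by rewrite /=; lia.
have := gR_Xm i (@gR_diag a _); have [lin _ _ _] := @adR_right K t n.
rewrite addrC -scaleNr lin !adR_Xm_e; try lia.
have /negPf iS : i.+1 != i.+2 by lia.
rewrite -ia !kinv1 !kinv2 !eqxx iS eq_sym iS => /(_ ltac:(lia)).
rewrite scaler0 subr0 sub0r !scalerA -scaleNr -scalerDl; apply: gR_scale.
suff -> : - q ^+ 2 * t - q * t^-1 = - t ^+ 3 * (q + q^-1).
  by rewrite mulf_neq0 // oppr_eq0 expf_neq0.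
by rewrite /qpar; field.
Qed.

Hypothesis trDq : \tr Dq != 0.

(** Testing against matrix units kills the entries of A off the diagonal, testing against the
    vectors of [gR_diag] makes the diagonal constant, and a scalar matrix of quantum trace zero
    vanishes. The transpose makes the form diagonal on matrix units. *)
Lemma gR_nondegenerate A : G A -> (forall B, G B -> \tr (Dq *m B *m A^T) = 0) -> A = 0.
Proof.
move=> gA A0.
have trE (a b : 'I_n) : \tr (Dq *m e a.+1 b.+1 *m A^T) = dq a.+1 * A a b.
  rewrite dg_e -scalemxAl linearZ /=; congr (_ * _).
  rewrite /mxtrace (sum_pick (i0 := a)) => [|c ca]; rewrite mxE.
    rewrite (sum_pick (i0 := b)) => [|d db]; rewrite !mxE ?eqxx ?mul1r //.
    by rewrite !eqSS -[_ == _ :> nat]/(d == b) (negPf db) andbF mul0r.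
  rewrite big1 // => d _; rewrite mxE !eqSS -[_ == _ :> nat]/(c == a) (negPf ca) mul0r.
  by [].
have off (a b : 'I_n) : a != b -> A a b = 0.
  move=> ab; have : G (e a.+1 b.+1).
    have := ltn_ord a; have := ltn_ord b; move: ab; rewrite -val_eqE /= neq_ltn => /orP[] *.
      by apply: gR_upper; lia.
    by apply: gR_lower; lia.
  by move/A0/eqP; rewrite trE mulf_eq0 (negPf (dq_neq0 _)) => /eqP.
have n0 : (0 < n)%N by lia.
have diag (a : 'I_n) : A a a = A (Ordinal n0) (Ordinal n0).
  case: a => a an; elim: a an => [an|a IHa an]; first by congr (A _ _); apply: val_inj.
  rewrite -(IHa (ltnW an)); have := A0 _ (@gR_diag a.+1 _).
  rewrite mulmxBr mulmxBl -scalemxAr -scalemxAl raddfB /= linearZ /=.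
  rewrite (trE (Ordinal (ltnW an)) (Ordinal (ltnW an))) (trE (Ordinal an) (Ordinal an))
    /= dqS mulrA -mulrBr.
  move=> /(_ ltac:(lia)) /eqP; rewrite mulf_eq0 (negPf (mulf_neq0 _ (dq_neq0 _)))
    ?expf_neq0 ?qpar0 //=.
  by rewrite subr_eq0 => /eqP.
have AE : A = A (Ordinal n0) (Ordinal n0) *: 1%:M.
  apply/matrixP => a b; rewrite [RHS]mxE mx1E.
  by case: (eqVneq a b) => [<-|/off ->]; rewrite ?mulr1 ?mulr0.
have := gR_qtrace gA; rewrite AE -scalemxAr mulmx1 linearZ /= => /eqP.
by rewrite mulf_eq0 (negPf trDq) orbF => /eqP ->; rewrite scale0r.
Qed.

End Adjoint.

(** * Hecke projections and quantum traces *)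

Section Projections.
Variables (K : fieldType) (t : K) (n : nat).
#[local] Notation q := (qpar t).
#[local] Notation w := (omega t).
#[local] Notation S := (hecke t n : 'M[K]_(n * n)).
#[local] Notation D := (Dq t n).
#[local] Notation D2 := (D *t D).
Hypothesis t0 : t != 0.

(** The left side is a diagonal entry of the quantum trace of S over its first leg; that it does not
    depend on j makes this partial trace a scalar. *)
Lemma dq_sum j : q * dq t j.+1 + w * \sum_(i < j) dq t i.+1 = q.
Proof.
have q0 := qpar0 t0; elim: j => [|j IHj].
  by rewrite big_ord0 /dq muln0 expr0 invr1 mulr1 mulr0 addr0.
rewrite big_ord_recr /= -[RHS]IHj (dqS t0 j) omegaE; field.
by [].
Qed.

Lemma dq_sum_ord (j : 'I_n) :
  q * dq t j.+1 + w * \sum_(i < n | (i < j)%N) dq t i.+1 = q.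
Proof.
rewrite -[RHS](dq_sum j) (big_ord_widen n (fun i => dq t i.+1)) //.
exact: ltnW.
Qed.

Lemma tens_Dq_mulE m (N : 'M[K]_n) (u : 'M_(n * n, m)) a j c :
  ((D *t N) *m u) (ix a j) c = dq t a.+1 * \sum_k N j k * u (ix a k) c.
Proof.
rewrite mxE sum_mxtens (sum_pick (i0 := a)) => [|b /negPf ba].
  by rewrite mulr_sumr; apply: eq_bigr => k _; rewrite tensmxE dgE eqxx mulr1n mulrA.
by rewrite big1 // => k _; rewrite tensmxE dgE eq_sym ba !mul0r.
Qed.

Lemma trace_tens_Dq (N : 'M[K]_n) (u : 'M_(n * n)) :
  \tr ((D *t N) *m u) = \sum_j \sum_k N j k * \sum_(a < n) dq t a.+1 * u (ix a k) (ix a j).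
Proof.
rewrite /mxtrace sum_mxtens exchange_big; apply: eq_bigr => j _ /=.
under eq_bigr => a _ do rewrite tens_Dq_mulE mulr_sumr.
rewrite exchange_big; apply: eq_bigr => k _ /=.
by rewrite mulr_sumr; apply: eq_bigr => a _; rewrite mulrCA.
Qed.

(** As N is arbitrary, the quantum trace of S over the first leg is q times the identity. *)
Lemma trace_hecke (N : 'M[K]_n) : \tr ((D *t N) *m S) = q * \tr N.
Proof.
rewrite trace_tens_Dq mulr_sumr; apply: eq_bigr => j _.
rewrite (sum_pick (i0 := j)) => [|k /negPf kj].
  rewrite mulrC -[in RHS](dq_sum_ord j); congr (_ * _).
  rewrite (bigD1 j) //= hecke_coef !eqxx mulrC; congr (_ + _).
  rewrite mulr_sumr [RHS]big_mkcond [LHS]big_mkcond; apply: eq_bigr => a _.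
  rewrite hecke_coef; case: (eqVneq a j) => [->|aj] /=; first by rewrite ltnn.
  by rewrite ?eqxx !andbT add0r mulrC; case: ifP; rewrite ?mul0r.
rewrite big1 ?mulr0 // => a _; rewrite hecke_coef.
case: (eqVneq a k) => [->|ak] /=; first by rewrite [j == k]eq_sym kj andbF mulr0.
by rewrite [j == k]eq_sym kj !andbF /= addr0 mulr0.
Qed.

Lemma hecke_sandwich_diag (A : 'M[K]_n) (a j : 'I_n) :
  (S *m (1%:M *t A) *m S) (ix a j) (ix a j)
  = A a a + w * A j j * (q *+ (a == j) + w *+ (a < j)%N).
Proof.
rewrite mul_heckeE !hecke_mulE !tensmxE !mx1E omegaE.
have q0 := qpar0 t0.
case: (eqVneq a j) => [<-|aj]; first by rewrite ?eqxx ltnn /= ?mulr1n ?mulr0n; field.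
rewrite ?eqxx.
move: aj; rewrite -val_eqE /=; case: (ltngtP a j) => //= aj _; rewrite ?mulr1n ?mulr0n;
  by field.
Qed.

Lemma hecke_sandwich_off (A : 'M[K]_n) (a j k : 'I_n) : j != k ->
  (S *m (1%:M *t A) *m S) (ix a j) (ix a k)
  = w * A j k * (q *+ (a == minn j k :> nat) + w *+ (a < minn j k)%N).
Proof.
move=> jk; rewrite mul_heckeE !hecke_mulE !tensmxE !mx1E.
have jk' : (j != k :> nat) by [].
case: (eqVneq a j) => [->|aj]; [|case: (eqVneq a k) => [->|ak]].
- have -> : (j == minn j k :> nat) = (j < k)%N by lia.
  have -> : (j < minn j k)%N = false by lia.
  by rewrite ?eqxx ?(negPf jk); case: (j < k)%N; rewrite /= ?mulr1n ?mulr0n; ring.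
- have -> : (k == minn j k :> nat) = (k < j)%N by lia.
  have -> : (k < minn j k)%N = false by lia.
  by rewrite ?eqxx; case: (k < j)%N; rewrite /= ?mulr1n ?mulr0n; ring.
- have aj' : (a != j :> nat) by []. have ak' : (a != k :> nat) by [].
  have -> : (a == minn j k :> nat) = false by lia.
  have -> : (a < minn j k)%N = (a < j)%N && (a < k)%N by lia.
  by rewrite ?eqxx ?(negPf jk); case: (a < j)%N; case: (a < k)%N;
    rewrite /= ?mulr1n ?mulr0n; ring.
Qed.

(** In other words, the quantum trace over the first leg takes S (1 (x) A) S to tr(D A) + w q A. On
    the adjoint module the first summand vanishes by [gR_qtrace]. *)
Lemma trace_hecke_sandwich (N A : 'M[K]_n) :
  \tr ((D *t N) *m (S *m (1%:M *t A) *m S)) = \tr (D *m A) * \tr N + w * q * \tr (N *m A).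
Proof.
have wsum (j : 'I_n) : \sum_(a < n) dq t a.+1 * (q *+ (a == j :> nat) + w *+ (a < j)%N) = q.
  rewrite -[RHS](dq_sum_ord j) (bigD1 j) //= eqxx ltnn addr0 mulrC; congr (_ + _).
  rewrite mulr_sumr [RHS]big_mkcond [LHS]big_mkcond; apply: eq_bigr => a _.
  rewrite -val_eqE /=; case: eqP => [->|_] /=; first by rewrite ltnn.
  by rewrite add0r mulrC; case: ifP; rewrite ?mul0r.
have qtrE : \tr (D *m A) = \sum_(a < n) dq t a.+1 * A a a.
  by apply: eq_bigr => a _; rewrite mul_diag_mx !mxE.
have pt (j k : 'I_n) : \sum_(a < n) dq t a.+1 * (S *m (1%:M *t A) *m S) (ix a k) (ix a j)
    = \tr (D *m A) *+ (k == j) + w * q * A k j.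
  case: (eqVneq k j) => [->|kj].
    under eq_bigr => a _ do rewrite hecke_sandwich_diag mulrDr mulrCA.
    by rewrite big_split -mulr_sumr qtrE mulr1n wsum mulrAC.
  under eq_bigr => a _ do rewrite hecke_sandwich_off // mulrCA.
  (* Off the diagonal the weights are those of [wsum] with min(j, k) in place of j. *)
  have [m mE] : exists m : 'I_n, m = minn k j :> nat.
    by case: (leqP k j) => _; [exists k|exists j].
  by rewrite -mulr_sumr -mE wsum mulr0n add0r mulrAC.
rewrite trace_tens_Dq /mxtrace !mulr_sumr -big_split; apply: eq_bigr => j _ /=.
under eq_bigr => k _ do rewrite pt mulrDr.
rewrite big_split (sum_pick (i0 := j)) => [|k /negPf kj]; last by rewrite kj mulr0.
rewrite eqxx mulr1n mulrC; congr (_ + _).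
by rewrite mxE mulr_sumr; apply: eq_bigr => k _; rewrite mulrCA.
Qed.

(* The eigenvalues q ([true]) and - q^-1 ([false]) of the Hecke matrix. *)
Definition hecke_eig (b : bool) : K := if b then q else - q^-1.
Definition hecke_proj (b : bool) : 'M[K]_(n * n) := (hecke_eig b - hecke_eig (~~ b))^-1
  *: (S - (hecke_eig (~~ b))%:M).
(* Since S commutes with U_q, each of these four maps intertwines the adjoint
   action with action (alpha); conjugation by S acts on the image by the scalar
   eigenvalue l / eigenvalue r. *)
Definition adj_embed (l r : bool) (A : 'M[K]_n) : M2 K n := hecke_proj l *m tens1 A *m
  hecke_proj r.

Hypothesis q2 : q + q^-1 != 0.

Lemma hecke_eig_neq b : hecke_eig b - hecke_eig (~~ b) != 0.
Proof.
by case: b; rewrite /hecke_eig /= ?opprK // -opprD oppr_eq0 addrC.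
Qed.

Lemma hecke_hecke_proj b : S *m hecke_proj b = hecke_eig b *: hecke_proj b.
Proof.
have q0 := qpar0 t0; rewrite /hecke_proj -scalemxAr scalerA mulrC -scalerA; congr (_ *: _).
rewrite mulmxBr hecke_sqr // mul_mx_scalar scalerBr scale_scalar_mx.
have -> : hecke_eig b * hecke_eig (~~ b) = -1.
  by case: b; rewrite /hecke_eig /= ?mulrN ?mulNr ?divff ?mulVf.
have -> : w = hecke_eig b + hecke_eig (~~ b) by rewrite omegaE; case: b => //=;
  rewrite addrC.
by apply/matrixP => x y; rewrite !mxE; ring.
Qed.

Lemma hecke_proj_hecke b : hecke_proj b *m S = hecke_eig b *: hecke_proj b.
Proof. by rewrite -hecke_hecke_proj /hecke_proj -scalemxAl -scalemxAr mulmxBl mulmxBr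
  scalar_mxC. Qed.

Lemma hecke_proj_idem b : hecke_proj b *m hecke_proj b = hecke_proj b.
Proof.
rewrite {1}/hecke_proj -scalemxAl mulmxBl hecke_hecke_proj mul_scalar_mx -scalerBl scalerA.
by rewrite mulVf ?scale1r // hecke_eig_neq.
Qed.

Lemma hecke_proj_orth b : hecke_proj b *m hecke_proj (~~ b) = 0.
Proof.
by rewrite {1}/hecke_proj -scalemxAl mulmxBl hecke_hecke_proj mul_scalar_mx -scalerBl
  subrr scale0r scaler0.
Qed.

Lemma hecke_proj_sum : hecke_proj true + hecke_proj false = 1%:M.
Proof.
rewrite /hecke_proj /hecke_eig /= opprK -[- q^-1 - q]opprD [q^-1 + q]addrC invrN scaleNr
  -scalerBr.
rewrite opprB [X in _ *: X]addrC addrA subrK raddfN opprK -raddfD /= scale_scalar_mx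
  mulVf //.
Qed.

End Projections.

(** * The four maps from the adjoint module and the invariant form *)

Section AdjointEmbedding.
Variables (K : fieldType) (t : K) (n : nat).
#[local] Notation q := (qpar t).
#[local] Notation w := (omega t).
#[local] Notation S := (hecke t n : 'M[K]_(n * n)).
#[local] Notation D := (Dq t n).
#[local] Notation D2 := (D *t D).
#[local] Notation lam := (hecke_eig t).
#[local] Notation P := (hecke_proj t n).
#[local] Notation Phi := (@adj_embed K t n).
#[local] Notation G := (gR t n).
Hypothesis t0 : t != 0.

Lemma hecke_projT b : (P b)^T = P b.
Proof. rewrite /hecke_proj linearZ /= raddfB /= heckeT tr_scalar_mx; exact: erefl. Qed.

Lemma D2_hecke : D2 *m S = S *m D2.
Proof. by rewrite hecke_comm_dg. Qed.

Lemma D2_hecke_proj b : D2 *m P b = P b *m D2.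
Proof. by rewrite /hecke_proj -scalemxAr -scalemxAl mulmxBr mulmxBl D2_hecke scalar_mxC;
  exact: erefl. Qed.

Fact adj_embed_linear l r : linear (Phi l r).
Proof.
move=> c A B; rewrite /adj_embed tens1_linear mulmxDr mulmxDl.
by rewrite -[_ *m (c *: _)]scalemxAr -[(c *: _) *m _]scalemxAl.
Qed.
HB.instance Definition _ l r :=
  GRing.isLinear.Build K 'M[K]_n (M2 K n) _ (Phi l r) (adj_embed_linear l r).

Fact act_alpha_linear x : linear (act_alpha t (n := n) x).
Proof. by have [lin _ _ _] := @act_alpha_right K t n; apply: lin. Qed.
HB.instance Definition _ x :=
  GRing.isLinear.Build K (M2 K n) (M2 K n) _ (act_alpha t (n := n) x) (act_alpha_linear x).

Lemma act_alpha_scale x c (v : 'M[K]_(n * n)) :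
  act_alpha t x (c *: v : M2 K n) = c *: act_alpha t x v.
Proof. exact: linearZ. Qed.

Lemma act_alpha_sub x (u v : 'M[K]_(n * n)) :
  act_alpha t x (u - v : M2 K n) = act_alpha t x u - act_alpha t x v.
Proof. exact: linearB. Qed.

Lemma act_alpha_projl x b (v : 'M[K]_(n * n)) :
  act_alpha t x (P b *m v : M2 K n) = P b *m act_alpha t x v.
Proof.
rewrite /hecke_proj -!scalemxAl !mulmxBl !mul_scalar_mx.
by rewrite act_alpha_scale act_alpha_sub act_alpha_scale act_alpha_heckel.
Qed.

Lemma act_alpha_projr x b (v : 'M[K]_(n * n)) :
  act_alpha t x (v *m P b : M2 K n) = act_alpha t x v *m P b.
Proof.
rewrite /hecke_proj -!scalemxAr !mulmxBr !mul_mx_scalar.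
by rewrite act_alpha_scale act_alpha_sub act_alpha_scale act_alpha_hecker.
Qed.

Lemma act_alpha_adj_embed x l r A : act_alpha t x (Phi l r A) = Phi l r (adR t x A).
Proof. by rewrite /adj_embed act_alpha_projr act_alpha_projl act_alpha_tens1. Qed.

(* The coefficient by which [Phi l r] scales the invariant form tr (D A B), up to
   the nonzero denominators of the projections. *)
Definition adj_embed_coef l r : K :=
  w * q - (lam (~~ l) + lam (~~ r)) * q + lam (~~ l) * lam (~~ r) * \tr D.

(** Expanding the two projections gives four traces. Cyclicity merges B into the weight of the
    second leg, so the partial quantum traces evaluate them all. The hypothesis removes the one
    contribution that is not a multiple of tr(D A B). *)
Lemma trace_adj_embed l r (A B : 'M[K]_n) : \tr (D *m A) = 0 ->
  \tr (D2 *m (Phi l r A *m tens1 B)) =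
  (lam l - lam (~~ l))^-1 * (lam r - lam (~~ r))^-1 * adj_embed_coef l r * \tr (D *m A *m
    B).
Proof.
move=> A0.
have cyc (X : 'M[K]_(n * n)) : \tr (D2 *m (X *m tens1 B)) = \tr ((D *t (B *m D)) *m X).
  by rewrite mulmxA mxtrace_mulC mulmxA tensmx_mul mul1mx.
have E1 : \tr (B *m D *m A) = \tr (D *m A *m B) by rewrite -mulmxA mxtrace_mulC.
have E2 : \tr (A *m (B *m D)) = \tr (D *m A *m B) by rewrite mulmxA mxtrace_mulC mulmxA.
have T1 : \tr ((D *t (B *m D)) *m (S *m tens1 A *m S)) = w * q * \tr (D *m A *m B).
  by rewrite trace_hecke_sandwich // A0 mul0r add0r E1.
have T2 : \tr ((D *t (B *m D)) *m (S *m tens1 A)) = q * \tr (D *m A *m B).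
  by rewrite mulmxA mxtrace_mulC mulmxA tensmx_mul mul1mx trace_hecke // E2.
have T3 : \tr ((D *t (B *m D)) *m (tens1 A *m S)) = q * \tr (D *m A *m B).
  by rewrite mulmxA tensmx_mul mulmx1 trace_hecke // E1.
have T4 : \tr ((D *t (B *m D)) *m (tens1 A)) = \tr D * \tr (D *m A *m B).
  by rewrite tensmx_mul mulmx1 -E1 -[D *t _]mulmx1 -tensmx11 -/(trace_pairing _ _)
    trace_pairing_tens !mulmx1.
have -> : Phi l r A = ((lam l - lam (~~ l))^-1 * (lam r - lam (~~ r))^-1) *:
  (S *m tens1 A *m S - lam (~~ r) *: (S *m tens1 A) - lam (~~ l) *: (tens1 A *m S)
   + (lam (~~ l) * lam (~~ r)) *: tens1 A).
  rewrite /adj_embed /hecke_proj -scalemxAl -scalemxAr -scalemxAl scalerA [_ * (lam l -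
    _)^-1]mulrC; congr (_ *: _).
  rewrite mulmxBl mulmxBr mulmxBl mul_scalar_mx !mul_mx_scalar -scalemxAl scalerBr.
  move: (S *m tens1 A *m S) (S *m tens1 A) (tens1 A *m S) (tens1 A) => X1 X2 X3 X4.
  by apply/matrixP => x y; rewrite !mxE; ring.
rewrite cyc -scalemxAr linearZ /= -[RHS]mulrA; congr (_ * _).
rewrite mulmxDr !mulmxBr -!scalemxAr raddfD /= !raddfB /= !linearZ /= T1 T2 T3 T4
  /adj_embed_coef.
by ring.
Qed.

Lemma adj_embed_ker l r A : (1 < n)%N -> q + q^-1 != 0 -> \tr D != 0 -> adj_embed_coef l
  r != 0 ->
  G A -> Phi l r A = 0 -> A = 0.
Proof.
move=> n1 q2 D0 c0 gA A0; apply: (gR_nondegenerate t0 n1 q2 D0 gA) => B gB.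
have c1 : (lam l - lam (~~ l))^-1 * (lam r - lam (~~ r))^-1 * adj_embed_coef l r != 0.
  by rewrite !mulf_neq0 // invr_eq0 hecke_eig_neq.
have := trace_adj_embed l r B^T (gR_qtrace t0 n1 gA).
rewrite A0 mul0mx mulmx0 raddf0 => /esym/eqP; rewrite mulf_eq0 (negPf c1) => /eqP E.
by rewrite -mxtrace_tr !trmx_mul trmxK dgT mulmxA mxtrace_mulC mulmxA.
Qed.

End AdjointEmbedding.

(** * Highest weight vectors *)

Section HighestWeight.
Variables (K : fieldType) (t : K) (n : nat).
#[local] Notation q := (qpar t).
#[local] Notation w := (omega t).
#[local] Notation S := (hecke t n : 'M[K]_(n * n)).
#[local] Notation lam := (hecke_eig t).
#[local] Notation P := (hecke_proj t n).
#[local] Notation Phi := (@adj_embed K t n).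
#[local] Notation E := (e 1 n : 'M[K]_n).
Hypothesis t0 : t != 0.

Definition bvec (a : nat) : 'cV[K]_n := \col_x (x.+1 == a)%:R.
Definition bvec2 (a b : nat) : 'M[K]_(n * n, 1 * 1) := bvec a *t bvec b.

Lemma e_bvec i j k : (0 < j <= n)%N -> (e i j : 'M[K]_n) *m bvec k = if j == k then bvec
  i else 0.
Proof.
case: j => // j /= jn; apply/matrixP => a b; rewrite !mxE.
rewrite (sum_pick (i0 := Ordinal jn)) => [|c cj]; rewrite !mxE /=.
  by rewrite eqxx andbT; case: ifP => _; rewrite !mxE ?mulr1 ?mulr0.
by rewrite eqSS -[_ == j]/(c == Ordinal jn) (negPf cj) andbF mul0r.
Qed.

Lemma dg_bvec (d : nat -> K) k : dg n d *m bvec k = d k *: bvec k.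
Proof.
apply/matrixP => a b; rewrite mul_diag_mx !mxE.
by case: eqP => [<-|_]; rewrite ?mulr0.
Qed.

Lemma bvec2E a b (c d : 'I_n) k : bvec2 a b (ix c d) k = ((c.+1 == a) && (d.+1 == b))%:R.
Proof. by rewrite !mxE !mxtens_indexK -natrM mulnb. Qed.

Definition kdir (i : 'I_n.-1) k : K := if k == i.+1 then t else if k == i.+2 then t^-1
  else 1.

Lemma kdir_neq0 i k : kdir i k != 0.
Proof. by rewrite /kdir; case: ifP => _; [|case: ifP => _];
  rewrite ?invr_eq0 ?oner_eq0. Qed.

Lemma Xp2_bvec2 i a b : Xp2 t i *m bvec2 a b =
  (if a == i.+2 then kinv t i b *: bvec2 i.+1 b else 0)
  + (if b == i.+2 then kdir i a *: bvec2 a i.+1 else 0).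
Proof.
have i2 : (0 < i.+2 <= n)%N by have := ltn_ord i; lia.
rewrite mulmxDl !tensmx_mul rhoXp rhoK rhoKinv !dg_bvec !e_bvec //.
congr (_ + _).
  by rewrite [i.+2 == a]eq_sym; case: (a == i.+2); rewrite ?tens0mx // tensmxZr.
by rewrite [i.+2 == b]eq_sym; case: (b == i.+2); rewrite ?tensmx0 // tensmxZl.
Qed.

Lemma hecke_bvec2 a b : S *m bvec2 a b =
  if a == b then q *: bvec2 a b else bvec2 b a + (w *+ (a < b)%N) *: bvec2 a b.
Proof.
apply/matrixP => x k; case: (mxtens_indexP x) => c d.
rewrite hecke_mulE !bvec2E; case: (eqVneq a b) => [<-|ab].
  rewrite scalemxE bvec2E; case: (eqVneq c d) => [->|cd] //.
  move: cd; rewrite -val_eqE /=; move: (val c) (val d) => {}c {}d cd.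
  have -> : (d.+1 == a) && (c.+1 == a) = false by lia.
  have -> : (c.+1 == a) && (d.+1 == a) = false by lia.
  by rewrite !mulr0 addr0.
rewrite addmxE scalemxE !bvec2E; case: (eqVneq c d) => [->|cd].
  have -> : (d.+1 == a) && (d.+1 == b) = false by lia.
  have -> : (d.+1 == b) && (d.+1 == a) = false by lia.
  by rewrite !mulr0 addr0.
rewrite [(d.+1 == a) && _]andbC; congr (_ + _).
case: (eqVneq c.+1 a) => [<-|_]; last by rewrite !mulr0.
by case: (eqVneq d.+1 b) => [<-|_]; rewrite ?mulr0 ?ltnS.
Qed.

Lemma bvec2_ext (v : 'M[K]_(n * n)) :
  (forall a b, (0 < a <= n)%N -> (0 < b <= n)%N -> v *m bvec2 a b = 0) -> v = 0.
Proof.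
move=> h; apply: tens_mxP => i j k l; rewrite [RHS]mxE.
have := congr1 (fun M : 'M_(_, _) => M (ix i j) (Ordinal (ltn0Sn 0))) (h k.+1 l.+1 _ _).
rewrite /= mxE sum_mxtens (sum_pick (i0 := k)) => [|c ck]; last first.
  by rewrite big1 // => d _; rewrite bvec2E eqSS -[_ == _ :> nat]/(c == k) (negPf ck) mulr0.
rewrite (sum_pick (i0 := l)) => [|d dl]; last first.
  by rewrite bvec2E !eqSS -[d == l :> nat]/(d == l) (negPf dl) andbF mulr0.
by rewrite bvec2E !eqxx mulr1 mxE; apply; exact: ltn_ord.
Qed.

Lemma bvec2_span a b (u : 'M[K]_(n * n, 1 * 1)) :
  (0 < a <= n)%N -> (0 < b <= n)%N -> a != b ->
  (forall c d : 'I_n, u (ix c d) 0 != 0 ->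
     ((c.+1 == a) && (d.+1 == b)) || ((c.+1 == b) && (d.+1 == a))) ->
  exists x y : K, u = x *: bvec2 a b + y *: bvec2 b a.
Proof.
case: a b => // a [//|b] /= an bn ab supp.
pose a' := Ordinal an; pose b' := Ordinal bn.
exists (u (ix a' b') 0), (u (ix b' a') 0); apply/matrixP => x k.
case: (mxtens_indexP x) => c d; rewrite [k]ord1 addmxE !scalemxE !bvec2E.
have [u0|/supp] := eqVneq (u (ix c d) 0) 0.
  rewrite u0; case: (boolP (_ && _)) => [/andP[/eqP ca /eqP db]|_].
    have [ca' db'] : c = a' /\ d = b' by split; apply: val_inj => /=; lia.
    rewrite -ca' -db' u0 mul0r add0r; case: (boolP (_ && _)) => [/andP[/eqP cb _]|_];
      [lia|by rewrite mulr0].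
  rewrite mulr0 add0r; case: (boolP (_ && _)) => [/andP[/eqP cb /eqP da]|_];
    last by rewrite mulr0.
  have [cb' da'] : c = b' /\ d = a' by split; apply: val_inj => /=; lia.
  by rewrite -cb' -da' u0 mul0r.
case/orP => /andP[/eqP E1 /eqP E2].
  have [ca' db'] : c = a' /\ d = b' by split; apply: val_inj => /=; lia.
  have -> : (c.+1 == b.+1) && (d.+1 == a.+1) = false by lia.
  by rewrite E1 E2 !eqxx -ca' -db' mulr1 mulr0 addr0.
have [ca' db'] : c = b' /\ d = a' by split; apply: val_inj => /=; lia.
have -> : (c.+1 == a.+1) && (d.+1 == b.+1) = false by lia.
by rewrite E1 E2 !eqxx -ca' -db' mulr1 mulr0 add0r.
Qed.

(** The eigenvalue of H_i on the k-th basis vector. In the right module [adR] the weight of e^1_n is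
    therefore [hwt i n - hwt i 1], and [kwt] is the matching eigenvalue of q^(H_i/2). *)
Definition hwt (i : 'I_n.-1) (k : nat) : K := (k == i.+1)%:R - (k == i.+2)%:R.
Definition kwt (i : 'I_n.-1) : K := kinv t i 1 * kdir i n.

Lemma H2_mulE (i : 'I_n.-1) m (u : 'M[K]_(n * n, m)) c d k :
  (H2 t i *m u) (ix c d) k = (hwt i c.+1 + hwt i d.+1) * u (ix c d) k.
Proof.
rewrite /H2 rho_H mulmxDl addmxE tens1_mulE mulrDl; congr (_ + _).
  rewrite mxE sum_mxtens (sum_pick (i0 := c)) => [|b /negPf ba]; last first.
    by rewrite big1 // => j _; rewrite tensmxE dgE [c == b]eq_sym ba mulr0n !mul0r.
  rewrite (sum_pick (i0 := d)) => [|b /negPf ba];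
    rewrite tensmxE dgE mx1E ?eqxx ?mulr1 ?mulr1n //.
  by rewrite [d == b]eq_sym ba mulr0 mul0r.
rewrite (sum_pick (i0 := d)) => [|b /negPf ba]; rewrite dgE ?eqxx ?mulr1n //.
by rewrite [d == b]eq_sym ba mulr0n mul0r.
Qed.

Lemma H2_bvec2 (i : 'I_n.-1) a b : H2 t i *m bvec2 a b = (hwt i a + hwt i b) *: bvec2 a b.
Proof.
apply/matrixP => x k; case: (mxtens_indexP x) => c d.
rewrite H2_mulE scalemxE bvec2E.
by case: (eqVneq c.+1 a) => [<-|_]; [case: (eqVneq d.+1 b) => [<-|_]|]; rewrite ?mulr0.
Qed.

Hypothesis natr_inj : injective (fun m : nat => m%:R : K).

(** If v has the weight of e^1_n, then eps_c + eps_d + eps_n and eps_a + eps_b + eps_1 take the same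
    value on every H_i. As H_i sees only differences of consecutive coordinates, the coordinates
    agree up to a common shift; hence each k is compared with 1. [natr_inj] turns the equality in K
    into one of natural numbers. *)
Lemma weight_support (v : M2 K n) a b (c d : 'I_n) :
  (forall i, act_alpha t (UqH i) v = (hwt i n - hwt i 1) *: v) ->
  (v *m bvec2 a b) (ix c d) 0 != 0 ->
  forall k, (0 < k <= n)%N ->
    ((c.+1 == k) + (d.+1 == k) + (n == k) + ((a == 1) + (b == 1) + 1) =
     (c.+1 == 1) + (d.+1 == 1) + (n == 1) + ((a == k) + (b == k) + (k == 1)))%N.
Proof.
move=> vH u0.
have telescope (F G : nat -> nat) :
    (forall k, (k < n.-1)%N -> (F k.+2 + G k.+1 = F k.+1 + G k.+2)%N) ->
    forall k, (0 < k <= n)%N -> (F k + G 1 = F 1 + G k)%N.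
  move=> FG; elim=> // -[//|k IHk kn].
  have := FG k; have := IHk (ltnW kn).
  by move: (F k.+2) (F k.+1) (G k.+1) (G k.+2) (F 1%N) (G 1%N) kn; lia.
apply: (telescope (fun k => (c.+1 == k) + (d.+1 == k) + (n == k))%N
  (fun k => (a == k) + (b == k) + (k == 1))%N) => k kn'.
apply: natr_inj; have := vH (Ordinal kn'); rewrite act_alpha_H.
move/(congr1 (fun M => (M *m bvec2 a b) (ix c d) 0)).
rewrite /= mulmxBl -scalemxAl -!mulmxA H2_bvec2 -scalemxAr.
rewrite addmxE oppmxE !scalemxE H2_mulE -mulrBl => /(mulIf u0).
rewrite /hwt /= ![1%N == _]eq_sym !natrD => E0.
apply/eqP; rewrite -subr_eq0; apply/eqP; move/eqP: E0; rewrite -subr_eq0 => /eqP E0.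
by rewrite -[RHS]E0; ring.
Qed.

Hypothesis q2 : q + q^-1 != 0.
Hypothesis n2 : (2 < n)%N.

(* The lowest weight vector of the q-antisymmetric square of the fundamental
   representation; that of the q-symmetric square is [bvec2 n n]. *)
Definition low_anti : 'M[K]_(n * n, 1 * 1) := bvec2 n n.-1 - q^-1 *: bvec2 n.-1 n.

Lemma hecke_low_anti : S *m low_anti = - q^-1 *: low_anti.
Proof.
rewrite /low_anti mulmxBr -scalemxAr !hecke_bvec2.
have /negPf -> : n != n.-1 by lia. have /negPf -> : n.-1 != n by lia.
have -> : (n < n.-1)%N = false by lia. have -> : (n.-1 < n)%N by lia.
rewrite mulr0n scale0r addr0 mulr1n; have q0 := qpar0 t0; rewrite omegaE.
move: (bvec2 n.-1 n) (bvec2 n n.-1) => u1 u2.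
by apply/matrixP => x y; rewrite !mxE; field.
Qed.

(* The kernel of such a [v] is stable under the raising operators, and these
   generate the tensor square of the fundamental representation from its two
   lowest weight vectors. *)
Lemma lowering_zero (v : 'M[K]_(n * n)) :
  (forall i, exists c, v *m Xp2 t i = c *: (Xp2 t i *m v)) ->
  v *m bvec2 n n = 0 -> v *m low_anti = 0 -> v = 0.
Proof.
move=> vX vnn vlow.
have step i u : v *m u = 0 -> v *m (Xp2 t i *m u) = 0.
  by case: (vX i) => c E0 u0; rewrite mulmxA E0 -scalemxAl -mulmxA u0 mulmx0 scaler0.
have ordI k : (0 < k < n)%N -> exists i : 'I_n.-1, i.+1 = k.
  move=> kn; have kn' : (k.-1 < n.-1)%N by lia.
  by exists (Ordinal kn'); rewrite /= prednK //; case/andP: kn.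
have scale0 c u : c != 0 -> v *m (c *: u) = 0 -> v *m u = 0.
  by move=> c0; rewrite -scalemxAr => /eqP; rewrite scalemx_eq0 (negPf c0) => /eqP.
have left k b : (0 < k < n)%N -> b != k.+1 -> v *m bvec2 k.+1 b = 0 -> v *m bvec2 k b = 0.
  move=> kn bk vu; have [i ik] := ordI _ kn.
  have := step _ i _ vu; rewrite Xp2_bvec2 ik eqxx (negPf bk) addr0.
  by apply: scale0; apply: kinv_neq0.
have right k a : (0 < k < n)%N -> a != k.+1 -> v *m bvec2 a k.+1 = 0 -> v *m bvec2 a k = 0.
  move=> kn ak vu; have [i ik] := ordI _ kn.
  have := step _ i _ vu; rewrite Xp2_bvec2 ik eqxx (negPf ak) add0r.
  by apply: scale0; apply: kdir_neq0.
have nn : n.-1.+1 = n by lia.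
(* X_(n-1)^+ maps b_(n,n) to t b_(n-1,n) + t^-1 b_(n,n-1). Together with [low_anti] this is a 2 by 2
   system whose determinant is t^-1 (q + q^-1) up to sign. *)
have base : v *m bvec2 n n.-1 = 0 /\ v *m bvec2 n.-1 n = 0.
  have [|i ik] := ordI n.-1; first by lia.
  have := step _ i _ vnn; rewrite Xp2_bvec2 ik nn eqxx.
  have -> : kinv t i n = t by have := kinv2 t i; rewrite ik nn.
  have -> : kdir i n = t^-1.
    have : kdir i i.+2 = t^-1 by rewrite /kdir eqxx; case: eqP => //; lia.
    by rewrite ik nn.
  move: vlow; rewrite /low_anti mulmxBr mulmxDr -!scalemxAr.
  move: (v *m bvec2 n n.-1) (v *m bvec2 n.-1 n) => u1 u2 /eqP; rewrite subr_eq0 => /eqP ->.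
  rewrite scalerA -scalerDl => /eqP; rewrite scalemx_eq0.
  have -> : t + t^-1 * q^-1 = t^-1 * (q + q^-1) by rewrite mulrDr /qpar expr2 mulKf.
  by rewrite (negPf (mulf_neq0 _ q2)) ?invr_eq0 //= => /eqP ->; rewrite scaler0.
have main m : (0 < m < n)%N -> forall a b, (m <= a <= n)%N -> (m <= b <= n)%N -> v *m
  bvec2 a b = 0.
  have [k] := ubnP (n - m); elim: k m => // k IHk m km mn a b am bm.
  have [mE|mn'] := eqVneq m n.-1.
    case: base => v1 v2.
    have v3 : v *m bvec2 n.-1 n.-1 = 0 by apply: left; rewrite ?nn //; lia.
    have [->|an] := eqVneq a n; have [->|bn] := eqVneq b n => //.
    - by have -> : b = n.-1 by lia.
    - by have -> : a = n.-1 by lia.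
    - by have [-> ->] : a = n.-1 /\ b = n.-1 by lia.
  have IH := IHk m.+1 _ _; have {}IH a' b' : (m < a' <= n)%N -> (m < b' <= n)%N -> v *m
    bvec2 a' b' = 0.
    by apply: IH; lia.
  (* On b_(m+1,m+1) the operator X_m^+ acts in both legs at once, so b_(m+1,m) is reached from
     b_(m+2,m) instead, which exists because m < n - 1. *)
  have mr a' : (m < a' <= n)%N -> v *m bvec2 a' m = 0.
    move=> a'm; have [->|a'm1] := eqVneq a' m.+1; last by apply: right;
      [lia|lia|apply: IH; lia].
    by apply: left; [lia|lia|apply: right; [lia|lia|apply: IH; lia]].
  have ml b' : (m < b' <= n)%N -> v *m bvec2 m b' = 0.
    move=> b'm; have [->|b'm1] := eqVneq b' m.+1; last by apply: left;
      [lia|lia|apply: IH; lia].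
    by apply: right; [lia|lia|apply: left; [lia|lia|apply: IH; lia]].
  have [->|am1] := eqVneq a m; have [->|bm1] := eqVneq b m.
  - by apply: left; [lia|lia|apply: mr; lia].
  - by apply: ml; lia.
  - by apply: mr; lia.
  - by apply: IH; lia.
by apply: bvec2_ext => a b an bn; apply: (main 1%N) => //; lia.
Qed.


Lemma hw_low_diag (v : M2 K n) :
  (forall i, act_alpha t (UqH i) v = (hwt i n - hwt i 1) *: v) ->
  exists x y : K, v *m bvec2 n n = x *: bvec2 1 n + y *: bvec2 n 1.
Proof.
move=> vH; apply: bvec2_span; [lia|lia|lia|] => c d u0.
(* The label 2 differs from 1 and n, so comparing it with 1 forces 1 to occur among c, d; the label
   n then forces n to occur as well. *)
have W := weight_support vH u0; have := W 2%N; have := W n.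
by move=> /(_ ltac:(lia)) + /(_ ltac:(lia)); do 16?[case: eqP => ? /=; try lia].
Qed.

Lemma hw_low_anti (v : M2 K n) :
  (forall i, act_alpha t (UqH i) v = (hwt i n - hwt i 1) *: v) ->
  exists x y : K, v *m low_anti = x *: bvec2 1 n.-1 + y *: bvec2 n.-1 1.
Proof.
move=> vH.
have [x [y E1]] : exists x y : K, v *m bvec2 n n.-1 = x *: bvec2 1 n.-1 + y *: bvec2 n.-1 1.
  apply: bvec2_span; [lia|lia|lia|] => c d u0.
  have W := weight_support vH u0; have := W n.-1; have := W n.
  by move=> /(_ ltac:(lia)) + /(_ ltac:(lia)); do 16?[case: eqP => ? /=; try lia].
have [x' [y' E2]] : exists x y : K, v *m bvec2 n.-1 n = x *: bvec2 1 n.-1 + y *: bvec2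
  n.-1 1.
  apply: bvec2_span; [lia|lia|lia|] => c d u0.
  have W := weight_support vH u0; have := W n.-1; have := W n.
  by move=> /(_ ltac:(lia)) + /(_ ltac:(lia)); do 16?[case: eqP => ? /=; try lia].
exists (x - q^-1 * x'), (y - q^-1 * y').
rewrite /low_anti mulmxBr -scalemxAr E1 E2 scalerDr !scalerA !scalerBl.
by rewrite opprD addrACA.
Qed.

Lemma adR_E_Xp i : adR t (UqXp i) E = 0.
Proof.
rewrite adR_Xp rhoXp -[_ *m E *m e _ _]mulmxA.
have -> : E *m e i.+1 i.+2 = 0 by rewrite e_mul; [case: eqP => //; have := ltn_ord i;
  lia|lia].
have -> : e i.+1 i.+2 *m E = 0 by rewrite e_mul; [|have := ltn_ord i; lia].
by rewrite mulmx0 mul0mx scaler0 subr0.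
Qed.

Lemma adR_E_H i : adR t (UqH i) E = (hwt i n - hwt i 1) *: E.
Proof. by rewrite adR_H rho_H dg_e e_dg -scalerBl. Qed.

Lemma adR_E_K i : adR t (UqK i) E = kwt i *: E.
Proof. by rewrite adR_K rhoK rhoKinv dg_e -scalemxAl e_dg scalerA. Qed.

Lemma kwt_neq0 (i : 'I_n.-1) : kwt i != 0.
Proof. by rewrite mulf_neq0 ?kinv_neq0 ?kdir_neq0. Qed.

(** Annihilation by X_i^+ reads k v X = q^-1 X v k with k = q^(-H_i/2). Multiplying by q^(H_i/2) on
    the left, the power of q cancels against the one from moving it past X, and the weight of v
    supplies the scalar. *)
Lemma hw_commute (v : M2 K n) (i : 'I_n.-1) :
  act_alpha t (UqXp i) v = 0 -> act_alpha t (UqK i) v = kwt i *: v ->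
  v *m Xp2 t i = (kwt i)^-1 *: (Xp2 t i *m v).
Proof.
rewrite act_alpha_Xp act_alpha_K => vX vK.
have KKi : K2 t i *m Ki2 t i = 1%:M :> 'M[K]_(n * n).
  by rewrite tensmx_mul rhoKKi // tensmx11.
have KiK : Ki2 t i *m K2 t i = 1%:M :> 'M[K]_(n * n) by apply: mulmx1C.
have KiX : Ki2 t i *m Xp2 t i = q^-1 *: (Xp2 t i *m Ki2 t i) :> 'M[K]_(n * n).
  rewrite mulmxDr mulmxDl !tensmx_mul rhoKi_Xp // rhoKKi // rhoKiK // tensmxZl tensmxZr.
  by rewrite -scalerDr.
have KX : K2 t i *m Xp2 t i = q *: (Xp2 t i *m K2 t i) :> 'M[K]_(n * n).
  have := congr1 (fun M => K2 t i *m M *m K2 t i) KiX.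
  rewrite /= mulmxA KKi mul1mx -scalemxAr -scalemxAl => ->.
  by rewrite scalerA divff ?qpar0 // scale1r -!mulmxA KiK mulmx1.
have KvKi : K2 t i *m v *m Ki2 t i = (kwt i)^-1 *: v.
  have vE : v = (kwt i)^-1 *: (Ki2 t i *m v *m K2 t i).
    by rewrite vK scalerA mulVf ?kwt_neq0 // scale1r.
  by rewrite {1}vE -scalemxAr -scalemxAl !mulmxA KKi mul1mx -mulmxA KKi mulmx1.
have : v *m Xp2 t i = q^-1 *: (K2 t i *m Xp2 t i *m v *m Ki2 t i).
  move/eqP: vX; rewrite subr_eq0 => /eqP/(congr1 (mulmx (K2 t i))).
  by rewrite !mulmxA KKi mul1mx -scalemxAr !mulmxA.
move=> ->; rewrite KX -!scalemxAl scalerA mulVf ?qpar0 // scale1r.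
by rewrite -[in LHS]mulmxA -[in LHS]mulmxA [K2 t i *m _]mulmxA KvKi -scalemxAr.
Qed.

Lemma proj_eig b b' m (u : 'M[K]_(n * n, m)) : S *m u = lam b *: u ->
  P b' *m u = (if b' == b then u else 0).
Proof.
move=> Su; rewrite /hecke_proj -scalemxAl mulmxBl Su mul_scalar_mx -scalerBl scalerA.
have [->|nb] := eqVneq b' b; first by rewrite mulVf ?scale1r // hecke_eig_neq.
have -> : lam b = lam (~~ b') by case: b b' nb {Su} => -[].
by rewrite subrr mulr0 scale0r.
Qed.

Lemma hw_span (v : M2 K n) :
  (forall i, act_alpha t (UqXp i) v = 0) ->
  (forall i, act_alpha t (UqK i) v = kwt i *: v) ->
  (forall i, act_alpha t (UqH i) v = (hwt i n - hwt i 1) *: v) ->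
  exists c : bool -> bool -> K, v = \sum_l \sum_r c l r *: Phi l r E.
Proof.
move=> vX vK vH.
have [x [y v1]] := hw_low_diag vH; have [x' [y' v2]] := hw_low_anti vH.
(* S maps b_(n,1) to b_(1,n), so v sends b_(n,n) to (x S + y) b_(n,1), with l-component (x lam l +
   y) P_l b_(n,1), while [Phi l true E] sends b_(n,n) to P_l b_(n,1). On [low_anti], 1 (x) E gives
   -q^-1 b_(n-1,1), whence the factor -q. *)
exists (fun l r => if r then x * lam l + y else - q * (x' * lam l + y')).
set u := \sum_l _.
have actu z c : (forall l r, act_alpha t z (Phi l r E) = c *: Phi l r E) -> act_alpha t z
  u = c *: u.
  move=> h; rewrite /u linear_sum scaler_sumr; apply: eq_bigr => l _.
  rewrite linear_sum scaler_sumr; apply: eq_bigr => r _.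
  by rewrite linearZ /= h !scalerA mulrC.
have uX i : act_alpha t (UqXp i) u = 0.
  by rewrite (actu _ 0) ?scale0r // => l r;
    rewrite act_alpha_adj_embed // adR_E_Xp linear0 scale0r.
have uK i : act_alpha t (UqK i) u = kwt i *: u.
  by apply: actu => l r; rewrite act_alpha_adj_embed // adR_E_K linearZ.
have spec a : S *m bvec2 a 1 = bvec2 1 a -> forall X Y : K,
    X *: bvec2 1 a + Y *: bvec2 a 1 = \sum_l (X * lam l + Y) *: (P l *m bvec2 a 1).
  move=> Sa X Y; have bE : bvec2 a 1 = P true *m bvec2 a 1 + P false *m bvec2 a 1.
    by rewrite -mulmxDl hecke_proj_sum // mul1mx.
  rewrite big_bool /= -Sa [in LHS]bE [S *m (_ + _)]mulmxDr !mulmxA !hecke_hecke_proj //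
    -![(lam _ *: _) *m _]scalemxAl.
  by rewrite !scalerDr !scalerA !scalerDl addrACA.
have n1 : n.-1 != 1%N by lia. have nn : n != n.-1 by lia.
have Sn1 : S *m bvec2 n 1 = bvec2 1 n.
  rewrite hecke_bvec2; have /negPf -> : n != 1%N by lia.
  have -> : (n < 1)%N = false by lia.
  by rewrite mulr0n scale0r addr0.
have Sn2 : S *m bvec2 n.-1 1 = bvec2 1 n.-1.
  rewrite hecke_bvec2 (negPf n1); have -> : (n.-1 < 1)%N = false by lia.
  by rewrite mulr0n scale0r addr0.
have Pnn r : P r *m bvec2 n n = if r == true then bvec2 n n else 0.
  by apply: proj_eig; rewrite hecke_bvec2 eqxx.
have Plow r : P r *m low_anti = if r == false then low_anti else 0.
  by apply: proj_eig; rewrite hecke_low_anti.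
apply/eqP; rewrite -subr_eq0; apply/eqP; apply: lowering_zero => //.
- move=> i; exists (kwt i)^-1; apply: hw_commute.
    by rewrite linearB /= vX uX subrr.
  by rewrite linearB /= vK uK scalerBr.
- rewrite mulmxBl v1 (spec _ Sn1) /u mulmx_suml -sumrB big1 // => l _.
  rewrite mulmx_suml big_bool /= -![(_ *: Phi _ _ _) *m _]scalemxAl /adj_embed -!mulmxA
    !Pnn /=.
  rewrite !mulmx0 scaler0 addr0 tensmx_mul mul1mx e_bvec; last by lia.
  by rewrite eqxx subrr.
- rewrite mulmxBl v2 (spec _ Sn2) /u mulmx_suml -sumrB big1 // => l _.
  rewrite mulmx_suml big_bool /= -![(_ *: Phi _ _ _) *m _]scalemxAl /adj_embed -!mulmxA
    !Plow /=.
  rewrite !mulmx0 scaler0 add0r /low_anti mulmxBr -scalemxAr !tensmx_mul !mul1mx !e_bvec;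
    try lia.
  rewrite eqxx (negPf nn) tensmx0 sub0r mulmxN -scalemxAr scalerN scalerA mulNr.
  by rewrite mulNr mulrAC divff ?qpar0 // mul1r scaleNr opprK subrr.
Qed.

End HighestWeight.

(** * The isotypic component for action (alpha) *)

Section IsotypicClosure.
Variables (K : fieldType) (n : nat) (V0 V : lmodType K).
Variables (act0 : Uq K n -> V0 -> V0) (W0 : set V0) (act : Uq K n -> V -> V).

Lemma isotypic0 : isotypic act0 W0 act 0.
Proof.
by exists 0%N, (fun=> set0), (fun=> 0); split=> [[]|[]|] //; rewrite big_ord0.
Qed.

Lemma isotypicD u v :
  isotypic act0 W0 act u -> isotypic act0 W0 act v -> isotypic act0 W0 act (u + v).
Proof.
move=> [k [W [w [WW Ww ->]]]] [k' [W' [w' [WW' Ww' ->]]]].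
exists (k + k')%N, (fun i => match fintype.split i with inl a => W a | inr b => W' b end).
exists (fun i => match fintype.split i with inl a => w a | inr b => w' b end); split.
- by move=> i; case: (fintype.split i).
- by move=> i; case: (fintype.split i).
rewrite big_split_ord /=; congr (_ + _); apply: eq_bigr => i _.
  by rewrite (unsplitK (inl i : 'I_k + 'I_k')).
by rewrite (unsplitK (inr i : 'I_k + 'I_k')).
Qed.

Lemma isotypic1 W w : submodule act W -> isomorphic act0 W0 act W -> W w ->
  isotypic act0 W0 act w.
Proof.
by move=> sW iW Ww; exists 1%N, (fun=> W), (fun=> w); split=> //; rewrite big_ord1.
Qed.

End IsotypicClosure.

Section AlphaComponent.
Variables (K : fieldType) (t : K) (n : nat).
#[local] Notation q := (qpar t).
#[local] Notation w := (omega t).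
#[local] Notation S := (hecke t n : 'M[K]_(n * n)).
#[local] Notation lam := (hecke_eig t).
#[local] Notation P := (hecke_proj t n).
#[local] Notation Phi := (@adj_embed K t n).
#[local] Notation E := (e 1 n : 'M[K]_n).
#[local] Notation G := (gR t n).
#[local] Notation act := (act_alpha t (n := n)).
Hypothesis t0 : t != 0.
Hypothesis q2 : q + q^-1 != 0.
Hypothesis n2 : (2 < n)%N.

Lemma proj_adj_embed l r l' r' A : P l' *m Phi l r A *m P r' = if (l' == l) && (r' == r)
  then Phi l r A else 0.
Proof.
rewrite /adj_embed !mulmxA -mulmxA.
have PP b b' : P b *m P b' = if b == b' then P b else 0.
  case: (eqVneq b b') => [->|bb']; first exact: hecke_proj_idem.
  by have -> : b' = ~~ b; [case: b b' bb' => -[]|exact: hecke_proj_orth].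
rewrite !PP [r == r']eq_sym; case: (eqVneq l' l) => [->|_] /=; last by rewrite !mul0mx.
by case: (r' == r); rewrite ?mulmx0.
Qed.

Lemma hecke_adj_embed l r A : S *m Phi l r A = lam l *: Phi l r A.
Proof. by rewrite /adj_embed !mulmxA hecke_hecke_proj // -[(lam l *: _) *m _]scalemxAl
  -[(lam l *: _) *m _]scalemxAl. Qed.

Lemma adj_embed_hecke l r A : Phi l r A *m S = lam r *: Phi l r A.
Proof. by rewrite /adj_embed -!mulmxA hecke_proj_hecke // -![_ *m (lam r *: _)]scalemxAr.
  Qed.

Lemma sum_proj (v : 'M[K]_(n * n)) : v = \sum_l \sum_r P l *m v *m P r.
Proof.
rewrite !big_bool /= -!mulmxDr hecke_proj_sum // !mulmx1.
by rewrite -[LHS]mul1mx -(hecke_proj_sum n q2) [LHS]mulmxDl.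
Qed.

Lemma adj_embed_gR_submodule l r : submodule act (Phi l r @` G)%classic.
Proof.
have [G0 GD GZ GA] := generated_submodule (adR t (n := n)) [:: E].
split.
- by exists 0; rewrite ?linear0.
- by move=> _ _ [A gA <-] [B gB <-]; exists (A + B); rewrite ?linearD //; apply: GD.
- by move=> c _ [A gA <-]; exists (c *: A); rewrite ?linearZ //; apply: GZ.
- by move=> x _ [A gA <-]; exists (adR t x A); rewrite -?act_alpha_adj_embed //; apply: GA.
Qed.

Lemma generated_adj_embed l r vs A : generated act vs (Phi l r E) -> G A ->
  generated act vs (Phi l r A).
Proof.
move=> gE gA; have [G0 GD GZ GA] := generated_submodule act vs.
apply: (gA [set B | generated act vs (Phi l r B)]%classic) => [|B]; last first.
  by rewrite mem_seq1 => /eqP ->.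
split=> [|B C gB gC|c B gB|x B gB] /=; rewrite ?linear0 ?linearD ?linearZ //.
- exact: GD.
- exact: GZ.
- by rewrite -act_alpha_adj_embed //; apply: GA.
Qed.

Lemma generated_adj_embed2 l r l' r' v : generated act [:: Phi l r E; Phi l' r' E] v <->
  exists A B, [/\ G A, G B & v = Phi l r A + Phi l' r' B].
Proof.
split=> [gv|[A [B [gA gB ->]]]]; last first.
  have [_ + _ _] := generated_submodule act [:: Phi l r E; Phi l' r' E]; apply.
    by apply: generated_adj_embed gA; apply: mem_generated; rewrite !inE eqxx.
  by apply: generated_adj_embed gB; apply: mem_generated; rewrite !inE eqxx orbT.
have [G0 GD GZ GA] := generated_submodule (adR t (n := n)) [:: E].
have gE : G E by apply: gR_highest.
apply: (gv [set v | exists A B, [/\ G A, G B & v = Phi l r A + Phi l' r' B]]%classic).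
  split.
  - by exists 0, 0; split; rewrite ?linear0 ?addr0.
  - move=> _ _ [A [B [gA gB ->]]] [A' [B' [gA' gB' ->]]]; exists (A + A'), (B + B').
    by split; [exact: GD|exact: GD|rewrite !linearD /= addrACA].
  - move=> c _ [A [B [gA gB ->]]]; exists (c *: A), (c *: B).
    by split; [exact: GZ|exact: GZ|rewrite !linearZ scalerDr].
  - move=> x _ [A [B [gA gB ->]]]; exists (adR t x A), (adR t x B).
    by split; [exact: GA|exact: GA|rewrite linearD /= !act_alpha_adj_embed].
move=> u; rewrite !inE => /orP[]/eqP ->; [exists E, 0|exists 0, E];
  by split=> //; rewrite ?linear0 ?addr0 ?add0r.
Qed.

Hypothesis natr_inj : injective (fun m : nat => m%:R : K).
Hypothesis D0 : \tr (Dq t n) != 0.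
Hypothesis coef0 : forall l r, adj_embed_coef t n l r != 0.

Lemma adj_embed_inj l r A : G A -> Phi l r A = 0 -> A = 0.
Proof. by apply: adj_embed_ker => //; apply: ltnW. Qed.

Lemma M2_alphaP v : M2_alpha t n v <->
  exists c : bool -> bool -> 'M[K]_n,
    (forall l r, G (c l r)) /\ v = \sum_l \sum_r Phi l r (c l r).
Proof.
have [G0 GD GZ GA] := generated_submodule (adR t (n := n)) [:: E].
split=> [[k [W [u [WW Wu ->]]]]|[c [gc ->]]]; last first.
  apply: (big_ind (M2_alpha t n)) => [||l _]; [exact: isotypic0|exact: isotypicD|].
  apply: (big_ind (M2_alpha t n)) => [||r _]; [exact: isotypic0|exact: isotypicD|].
  apply: (isotypic1 (W := (Phi l r @` G)%classic)); first exact: adj_embed_gR_submodule.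
    exists (Phi l r); split=> // [A B gA gB AB|x A gA]; last by rewrite act_alpha_adj_embed.
    apply/eqP; rewrite -subr_eq0; apply/eqP; apply: (@adj_embed_inj l r).
      by rewrite -scaleN1r; apply: GD => //; apply: GZ.
    by rewrite linearB /= AB subrr.
  by exists (c l r).
apply: (big_ind (fun v => exists c : bool -> bool -> 'M[K]_n,
    (forall l r, G (c l r)) /\ v = \sum_l \sum_r Phi l r (c l r))).
- by exists (fun _ _ => 0); split=> //; rewrite !big1 // => l _; rewrite big1 // => r _;
  rewrite linear0.
- move=> _ _ [c [gc ->]] [d [gd ->]]; exists (fun l r => c l r + d l r); split=> [l r|].
    exact: (GD _ _ (gc l r) (gd l r)).
  rewrite -big_split; apply: eq_bigr => l _; rewrite -big_split; apply: eq_bigr => r _.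
  by rewrite linearD.
move=> i _; have [sW [phi [phiI phiW phiA]]] := WW i.
have gE : G E by apply: gR_highest.
have [||j|c cE] := @hw_span K t n t0 natr_inj q2 n2 (phi E).
- by move=> j; rewrite -phiA // adR_E_Xp // linear0.
- by move=> j; rewrite -phiA // adR_E_K // linearZ.
- by rewrite -phiA // adR_E_H // linearZ.
(* Both sides are homomorphisms on [gR] that agree at e^1_n, and the matrices on which they agree
   form a submodule. *)
have phiE A : G A -> phi A = \sum_l \sum_r c l r *: Phi l r A.
  move=> gA; have : [set B | G B /\ phi B = \sum_l \sum_r c l r *: Phi l r B]%classic A;
    last by case.
  apply: gA => [|B]; last by rewrite mem_seq1 => /eqP ->.
  split=> [|B C [gB EB] [gC EC]|a B [gB EB]|x B [gB EB]] /=.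
  - split=> //; rewrite linear0 big1 // => l _; rewrite big1 // => r _.
    by rewrite linear0 scaler0.
  - split; first exact: GD.
    rewrite linearD EB EC -big_split; apply: eq_bigr => l _.
    by rewrite -big_split; apply: eq_bigr => r _; rewrite linearD scalerDr.
  - split; first exact: GZ.
    rewrite linearZ /= EB scaler_sumr; apply: eq_bigr => l _.
    by rewrite scaler_sumr; apply: eq_bigr => r _;
      rewrite [Phi l r (a *: B)]linearZ /= !scalerA mulrC.
  - split; first exact: GA.
    rewrite phiA // EB linear_sum; apply: eq_bigr => l _.
    by rewrite linear_sum; apply: eq_bigr => r _; rewrite linearZ /= act_alpha_adj_embed.
have : W i (u i) by []. rewrite -phiW => -[A gA <-].
exists (fun l r => c l r *: A); split=> [l r|]; first exact: GZ.
by rewrite phiE //; apply: eq_bigr => l _; apply: eq_bigr => r _; rewrite linearZ.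
Qed.

Lemma proj_alpha l r v : M2_alpha t n v -> exists A, G A /\ P l *m v *m P r = Phi l r A.
Proof.
case/M2_alphaP => c [gc ->]; exists (c l r); split=> //.
rewrite mulmx_sumr mulmx_suml (bigD1 l) //= [X in _ + X]big1 => [|l' ll']; last first.
  rewrite mulmx_sumr mulmx_suml big1 // => r' _.
  by rewrite proj_adj_embed eq_sym (negPf ll').
rewrite mulmx_sumr mulmx_suml (bigD1 r) //= big1 => [|r' rr']; last first.
  by rewrite proj_adj_embed [r == _]eq_sym (negPf rr') andbF.
by rewrite proj_adj_embed !eqxx !addr0.
Qed.

Lemma hecke_unit : S \in unitmx.
Proof.
have : S *m (S - w%:M) = 1%:M.
  by rewrite mulmxBr hecke_sqr // mul_mx_scalar addrC addKr.
by case/mulmx1_unit.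
Qed.

Lemma M2_alpha_eigenE c v : M2_alpha_eigen t c v <-> M2_alpha t n v /\ S *m v = c *: (v
  *m S).
Proof.
split=> -[av E]; split=> //.
  by rewrite scalemxAl -E mulmxKV // hecke_unit.
by rewrite E -scalemxAl mulmxK // hecke_unit.
Qed.

Lemma eigen_proj c v l r : S *m v = c *: (v *m S) -> lam l != c * lam r -> P l *m v *m P
  r = 0.
Proof.
move=> Sv lr; have := congr1 (fun M => P l *m M *m P r) Sv.
rewrite /=.
have -> : P l *m (S *m v) *m P r = lam l *: (P l *m v *m P r).
  by rewrite mulmxA hecke_proj_hecke // -![(lam l *: _) *m _]scalemxAl.
have -> : P l *m (c *: (v *m S)) *m P r = (c * lam r) *: (P l *m v *m P r).
  rewrite -[_ *m (c *: _)]scalemxAr -[(c *: _) *m _]scalemxAl -[_ *m P r in LHS]mulmxA.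
  rewrite -[v *m S *m _]mulmxA hecke_hecke_proj // -![_ *m (lam r *: _)]scalemxAr scalerA.
  by rewrite mulmxA.
move/eqP.
by rewrite -subr_eq0 -scalerBl scalemx_eq0 subr_eq0 (negPf lr) => /eqP.
Qed.

Lemma alpha1_sum : alpha1 K n = \sum_l \sum_r Phi l r E.
Proof. exact: sum_proj. Qed.

(** [alpha1] is the sum of its four blocks, and S scales the block (l, r) by [lam l] from the left
    and by [lam r] from the right. *)
Lemma alpha_combination (a b c d : K) :
  a *: alpha1 K n + b *: (S *m alpha1 K n) + c *: (alpha1 K n *m S)
    + d *: (S *m alpha1 K n *m S)
  = \sum_l \sum_r (a + b * lam l + c * lam r + d * (lam l * lam r)) *: Phi l r E.
Proof.
rewrite alpha1_sum mulmx_suml !mulmx_sumr mulmx_suml !scaler_sumr -!big_split /=.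
apply: eq_bigr => l _.
rewrite mulmx_suml !mulmx_sumr mulmx_suml !scaler_sumr -!big_split /=.
apply: eq_bigr => r _.
rewrite adj_embed_hecke hecke_adj_embed -[(lam l *: _) *m _]scalemxAl adj_embed_hecke
  !scalerA.
by rewrite -!scalerDl mulrA.
Qed.

Lemma hecke_eig_neq0 b : lam b != 0.
Proof. by case: b; rewrite /hecke_eig ?oppr_eq0 ?invr_eq0 qpar0. Qed.

Lemma M2_alpha_plusP v : M2_alpha_plus t n v <->
  exists A B, [/\ G A, G B & v = Phi true true A + Phi false false B].
Proof.
have q0 := qpar0 t0.
have offdiag b : lam b != 1 * lam (~~ b).
  by rewrite mul1r -subr_eq0 hecke_eig_neq.
split=> [/M2_alpha_eigenE[av Sv]|[A [B [gA gB ->]]]].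
  have [A [gA EA]] := proj_alpha true true av;
    have [B [gB EB]] := proj_alpha false false av.
  exists A, B; split=> //; rewrite [LHS]sum_proj !big_bool /= EA EB.
  by rewrite (eigen_proj Sv (offdiag true)) (eigen_proj Sv (offdiag false)) addr0 add0r.
apply/M2_alpha_eigenE; split.
  apply/M2_alphaP; exists (fun l r => if l == r then (if l then A else B) else 0).
  split; last by rewrite !big_bool /= !linear0 addr0 add0r.
  by have [gz _ _ _] := generated_submodule (adR t (n := n)) [:: E]; case=> -[].
by rewrite scale1r [LHS]mulmxDr [RHS]mulmxDl !hecke_adj_embed !adj_embed_hecke.
Qed.

(** It suffices that neither -q^2 nor -q^-2 equals 1, which follows from [q2]: this kills the two
    diagonal blocks, and both off-diagonal blocks occur on the right. *)
Lemma M2_alpha_minusP v : M2_alpha_minus t n v <->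
  exists A B, [/\ G A, G B & v = Phi true false A + Phi false true B].
Proof.
have q0 := qpar0 t0.
have gz : G 0 by have [] := generated_submodule (adR t (n := n)) [:: E].
have diag c u b : M2_alpha_eigen t c u -> c != 1 -> P b *m u *m P b = 0.
  move=> /M2_alpha_eigenE[_ Su] c1; apply: (eigen_proj Su).
  by rewrite -subr_eq0 -{1}[lam b]mul1r -mulrBl mulf_neq0 ?hecke_eig_neq0 // subr_eq0
    eq_sym.
have one_dir l r A c : G A -> lam l = c * lam r -> M2_alpha_eigen t c (Phi l r A).
  move=> gA lr; apply/M2_alpha_eigenE; split;
    last by rewrite hecke_adj_embed adj_embed_hecke lr scalerA.
  apply/M2_alphaP; exists (fun l' r' => if (l' == l) && (r' == r) then A else 0); split.
    by move=> l' r'; case: ifP.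
  by case: l r {lr} => -[]; rewrite !big_bool /= !linear0 ?addr0 ?add0r.
have s1 : 1 + q ^+ 2 != 0.
  have -> : 1 + q ^+ 2 = q * (q + q^-1) by rewrite mulrDr divff // addrC expr2.
  exact: mulf_neq0.
have c1 : - q ^+ 2 != 1 by rewrite -subr_eq0 -opprD oppr_eq0 addrC.
have c2 : - q ^- 2 != 1.
  rewrite -subr_eq0 -opprD oppr_eq0; have -> : q ^- 2 + 1 = q ^- 2 * (1 + q ^+ 2).
    by rewrite mulrDr mulr1 mulVf ?expf_neq0.
  by rewrite mulf_neq0 // invr_eq0 expf_neq0.
split=> [[u [u' [eu eu' ->]]]|[A [B [gA gB ->]]]].
  have [au _] := eu; have [au' _] := eu'.
  have av : M2_alpha t n (u + u') by apply: isotypicD.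
  have [A [gA EA]] := proj_alpha true false av;
    have [B [gB EB]] := proj_alpha false true av.
  exists A, B; split=> //; rewrite [LHS]sum_proj !big_bool /= EA EB.
  rewrite ![_ *m (u + u')]mulmxDr ![(_ + _) *m hecke_proj _ _ _]mulmxDl.
  by rewrite !(diag _ _ _ eu c1) !(diag _ _ _ eu' c2) !addr0 add0r.
exists (Phi true false A), (Phi false true B); split=> //; apply: one_dir => //.
- by rewrite /hecke_eig mulrN mulNr opprK expr2 mulfK.
- by rewrite /hecke_eig /=; field.
Qed.

(** For eigenvalues x on the left and y on the right, the vectors become x + y - w = x + 1/y and 1 +
    x y. Both vanish for x y = -1, that is on the off-diagonal blocks. *)
Lemma alpha_plus_vectors :
  alpha3 t n + alpha4 t n = (q + q^-1) *: Phi true true E + (- (q + q^-1)) *: Phi false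
    false E /\
  alpha1 K n + alpha2 t n + w *: alpha3 t n =
    (q * (q + q^-1)) *: Phi true true E + (q^-1 * (q + q^-1)) *: Phi false false E.
Proof.
have q0 := qpar0 t0; have n1 := ltnW n2.
rewrite alpha2_hecke // alpha3_hecke // alpha4_hecke //; split.
  have -> : S *m alpha1 K n + (alpha1 K n *m S - w *: alpha1 K n) =
      (- w) *: alpha1 K n + 1 *: (S *m alpha1 K n) + 1 *: (alpha1 K n *m S) + 0 *: (S *m
        alpha1 K n *m S).
    by rewrite !scale1r scale0r addr0 scaleNr addrA addrAC [- _ + _]addrC addrAC.
  rewrite alpha_combination !big_bool /= omegaE.
  have -> : - (q - q^-1) + 1 * q + 1 * - q^-1 + 0 * (q * - q^-1) = 0 by ring.
  have -> : - (q - q^-1) + 1 * - q^-1 + 1 * q + 0 * (- q^-1 * q) = 0 by ring.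
  by rewrite !scale0r addr0 add0r; congr (_ *: _ + _ *: _); ring.
have -> : alpha1 K n + (S *m alpha1 K n *m S - w *: (S *m alpha1 K n)) + w *: (S *m
  alpha1 K n) =
      1 *: alpha1 K n + 0 *: (S *m alpha1 K n) + 0 *: (alpha1 K n *m S) + 1 *: (S *m
        alpha1 K n *m S).
  by rewrite !scale1r !scale0r !addr0 -addrA subrK.
rewrite alpha_combination !big_bool /=.
have -> : 1 + 0 * q + 0 * - q^-1 + 1 * (q * - q^-1) = 0 by field.
have -> : 1 + 0 * - q^-1 + 0 * q + 1 * (- q^-1 * q) = 0 by field.
by rewrite !scale0r addr0 add0r; congr (_ *: _ + _ *: _); field.
Qed.

(** The polynomials factor as (q - x)(1 + 1/(q y)) and (q^-1 + x)(1 - q/y), so each vector lives on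
    a single block: x = -1/q, y = q for the first and x = q, y = -1/q for the second. *)
Lemma alpha_minus_vectors :
  q *: alpha1 K n - q^-1 *: alpha2 t n - alpha3 t n + alpha4 t n
    = (q^-1 * (q + q^-1) ^+ 2) *: Phi false true E /\
  q^-1 *: alpha1 K n - q *: alpha2 t n + alpha3 t n - alpha4 t n
    = (q * (q + q^-1) ^+ 2) *: Phi true false E.
Proof.
have q0 := qpar0 t0; have n1 := ltnW n2.
rewrite alpha2_hecke // alpha3_hecke // alpha4_hecke //; split.
  transitivity ((q - w) *: alpha1 K n + (q^-1 * w - 1) *: (S *m alpha1 K n)
     + 1 *: (alpha1 K n *m S) + (- q^-1) *: (S *m alpha1 K n *m S)).
    move: (alpha1 K n *m S) (S *m alpha1 K n *m S) (S *m alpha1 K n) (alpha1 K n) => X1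
      X2 X3 X4.
    by apply/matrixP => x y; rewrite !mxE; ring.
  rewrite alpha_combination !big_bool /= omegaE.
  rewrite [X in X *: Phi true true _](_ : _ = 0); last by field.
  rewrite [X in X *: Phi true false _](_ : _ = 0); last by field.
  rewrite [X in X *: Phi false false _](_ : _ = 0); last by field.
  by rewrite !scale0r !add0r addr0; congr (_ *: _); field.
transitivity ((q^-1 + w) *: alpha1 K n + (q * w + 1) *: (S *m alpha1 K n)
     + (- 1) *: (alpha1 K n *m S) + (- q) *: (S *m alpha1 K n *m S)).
  move: (alpha1 K n *m S) (S *m alpha1 K n *m S) (S *m alpha1 K n) (alpha1 K n) => X1 X2
    X3 X4.
  by apply/matrixP => x y; rewrite !mxE; ring.
rewrite alpha_combination !big_bool /= omegaE.
rewrite [X in X *: Phi true true _](_ : _ = 0); last by field.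
rewrite [X in X *: Phi false true _](_ : _ = 0); last by field.
rewrite [X in X *: Phi false false _](_ : _ = 0); last by field.
by rewrite !scale0r add0r !addr0; congr (_ *: _); field.
Qed.

End AlphaComponent.

(** * Generators for actions (alpha) and (beta) *)

Section AlphaBeta.
Variables (K : fieldType) (t : K) (n : nat).
#[local] Notation q := (qpar t).
#[local] Notation w := (omega t).
#[local] Notation S := (hecke t n : 'M[K]_(n * n)).
#[local] Notation lam := (hecke_eig t).
#[local] Notation P := (hecke_proj t n).
#[local] Notation Phi := (@adj_embed K t n).
#[local] Notation E := (e 1 n : 'M[K]_n).
#[local] Notation G := (gR t n).
Hypothesis t0 : t != 0.
Hypothesis q2 : q + q^-1 != 0.
Hypothesis n2 : (2 < n)%N.
Hypothesis natr_inj : injective (fun m : nat => m%:R : K).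
Hypothesis D0 : \tr (Dq t n) != 0.
Hypothesis coef0 : forall l r, adj_embed_coef t n l r != 0.

Lemma generated_lincomb (V : lmodType K) (act : Uq K n -> V -> V) vs a u b v :
  generated act vs u -> generated act vs v -> generated act vs (a *: u + b *: v).
Proof.
by move=> gu gv; have [_ GD GZ _] := generated_submodule act vs; apply: GD; apply: GZ.
Qed.

Lemma generated_span2 (V : lmodType K) (act : Uq K n -> V -> V) (a b c d : K) (u v : V) :
  a * d - b * c != 0 ->
  generated act [:: a *: u + b *: v; c *: u + d *: v] = generated act [:: u; v].
Proof.
move=> det0; set x := a *: u + _; set y := c *: u + _.
have uE : u = (d / (a * d - b * c)) *: x + (- b / (a * d - b * c)) *: y.
  rewrite !scalerDr !scalerA addrACA -!scalerDl.
  rewrite [X in X *: u](_ : _ = 1); last by field.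
  rewrite [X in X *: v](_ : _ = 0); last by field.
  by rewrite scale1r scale0r addr0.
have vE : v = (- c / (a * d - b * c)) *: x + (a / (a * d - b * c)) *: y.
  rewrite !scalerDr !scalerA addrACA -!scalerDl.
  rewrite [X in X *: u](_ : _ = 0); last by field.
  rewrite [X in X *: v](_ : _ = 1); last by field.
  by rewrite scale1r scale0r add0r.
apply: eq_generated => z; rewrite !inE => /orP[]/eqP ->.
- by rewrite uE; apply: generated_lincomb; apply: mem_generated; rewrite !inE eqxx ?orbT.
- by rewrite vE; apply: generated_lincomb; apply: mem_generated; rewrite !inE eqxx ?orbT.
- by apply: generated_lincomb; apply: mem_generated; rewrite !inE eqxx ?orbT.
- by apply: generated_lincomb; apply: mem_generated; rewrite !inE eqxx ?orbT.
Qed.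

#[local] Notation s := (q + q^-1).
#[local] Notation u1 := (alpha3 t n + alpha4 t n).
#[local] Notation u2 := (alpha1 K n + alpha2 t n + w *: alpha3 t n).
#[local] Notation u3 := (q *: alpha1 K n - q^-1 *: alpha2 t n - alpha3 t n + alpha4 t n).
#[local] Notation u4 := (q^-1 *: alpha1 K n - q *: alpha2 t n + alpha3 t n - alpha4 t n).
#[local] Notation x1 := (S *m alpha1 K n - alpha1 K n *m S : M2 K n).
#[local] Notation x2 := (alpha1 K n - alpha2 t n : M2 K n).

Lemma M2_alpha_plusE : M2_alpha_plus t n = generated (act_alpha t (n := n)) [:: u1; u2].
Proof.
have q0 := qpar0 t0.
have [E1 E2] := alpha_plus_vectors t0 q2 n2; rewrite E1 E2 generated_span2; last first.
  have -> : s * (q^-1 * s) - - s * (q * s) = s ^+ 3 by field.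
  by rewrite expf_neq0.
apply/seteqP; split=> v.
  by move/(M2_alpha_plusP t0 q2 n2 natr_inj D0 coef0)/generated_adj_embed2; apply.
by move/generated_adj_embed2 => gv; apply/M2_alpha_plusP => //; apply: gv.
Qed.

Lemma M2_alpha_minusE : M2_alpha_minus t n = generated (act_alpha t (n := n)) [:: u3; u4].
Proof.
have q0 := qpar0 t0.
have [-> ->] := alpha_minus_vectors t0 q2 n2.
have -> : (q^-1 * s ^+ 2) *: Phi false true E = 0 *: Phi true false E + (q^-1 * s ^+ 2)
  *: Phi false true E.
  by rewrite scale0r add0r.
have -> : (q * s ^+ 2) *: Phi true false E = (q * s ^+ 2) *: Phi true false E + 0 *: Phi
  false true E.
  by rewrite scale0r addr0.
rewrite generated_span2; last first.
  by rewrite mul0r sub0r oppr_eq0 !mulf_neq0 ?invr_eq0 ?expf_neq0.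
apply/seteqP; split=> v.
  by move/(M2_alpha_minusP t0 q2 n2 natr_inj D0 coef0)/generated_adj_embed2; apply.
by move/generated_adj_embed2 => gv; apply/M2_alpha_minusP => //; apply: gv.
Qed.

(** A second basis of the off-diagonal highest weight vectors, given by x - y and 1 - x/y. It
    consists of the [sigma]-images of [beta1 - beta2] and [beta3 - beta4], and it also serves action
    (delta). *)
Lemma offdiag_vectors :
  x1 = s *: Phi true false E + (- s) *: Phi false true E /\
  x2 = (q * s) *: Phi true false E + (q^-1 * s) *: Phi false true E.
Proof.
have q0 := qpar0 t0; have n1 := ltnW n2.
rewrite alpha2_hecke //; split.
  transitivity (0 *: alpha1 K n + 1 *: (S *m alpha1 K n) + (-1) *: (alpha1 K n *m S)
      + 0 *: (S *m alpha1 K n *m S)).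
    by rewrite !scale0r add0r addr0 scale1r scaleN1r.
  rewrite alpha_combination // !big_bool /=.
  rewrite [X in X *: Phi true true _](_ : _ = 0); last by ring.
  rewrite [X in X *: Phi false false _](_ : _ = 0); last by ring.
  by rewrite !scale0r add0r addr0; congr (_ *: _ + _ *: _); ring.
transitivity (1 *: alpha1 K n + w *: (S *m alpha1 K n) + 0 *: (alpha1 K n *m S)
      + (-1) *: (S *m alpha1 K n *m S)).
  by rewrite scale0r addr0 scale1r scaleN1r opprB addrA.
rewrite alpha_combination // !big_bool /= omegaE.
rewrite [X in X *: Phi true true _](_ : _ = 0); last by field.
rewrite [X in X *: Phi false false _](_ : _ = 0); last by field.
by rewrite !scale0r add0r addr0; congr (_ *: _ + _ *: _); field.
Qed.

Lemma M2_alpha_minusE' : M2_alpha_minus t n = generated (act_alpha t (n := n)) [:: x1; x2].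
Proof.
have q0 := qpar0 t0.
have [-> ->] := offdiag_vectors; rewrite generated_span2; last first.
  have -> : s * (q^-1 * s) - - s * (q * s) = s ^+ 3 by field.
  by rewrite expf_neq0.
apply/seteqP; split=> v.
  by move/(M2_alpha_minusP t0 q2 n2 natr_inj D0 coef0)/generated_adj_embed2; apply.
by move/generated_adj_embed2 => gv; apply/M2_alpha_minusP => //; apply: gv.
Qed.

Lemma E_neq0 : E != 0.
Proof.
have n0 : (0 < n)%N by lia. have n1 : (n.-1 < n)%N by lia.
apply/eqP => /matrixP /(_ (Ordinal n0) (Ordinal n1)); rewrite !mxE /= prednK // eqxx.
exact/eqP/oner_neq0.
Qed.

Lemma adj_embed_E_neq0 l r : Phi l r E != 0.
Proof.
apply: contraNneq E_neq0 => E0; apply/eqP.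
have gE : G E by apply: gR_highest.
exact: (adj_embed_inj t0 q2 n2 D0 coef0 gE E0).
Qed.

Lemma lincomb_adj_embed_neq0 l r l' r' a b : (l, r) != (l', r') -> a != 0 ->
  a *: Phi l r E + b *: Phi l' r' E <> 0.
Proof.
move=> lr a0 v0; have := congr1 (fun M => P l *m M *m P r) v0.
rewrite /= [_ *m (_ + _)]mulmxDr [(_ + _) *m hecke_proj _ _ _]mulmxDl -![_ *m (_ *: Phi _
  _ _)]scalemxAr.
rewrite -![(_ *: (_ *m _)) *m _]scalemxAl !proj_adj_embed // !eqxx /=.
move: lr; rewrite xpair_eqE => /negPf ->.
rewrite scaler0 addr0 mulmx0 mul0mx => /eqP.
by rewrite scalemx_eq0 (negPf a0) (negPf (adj_embed_E_neq0 _ _)).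
Qed.

Definition hw_relations (v : M2 K n) :=
  (forall i, act_alpha t (UqH i) v = (hwt K i n - hwt K i 1) *: v) /\
  (forall i, act_alpha t (UqXp i) v = 0).

Lemma hw_relations_comb l r l' r' a b :
  hw_relations (a *: Phi l r E + b *: Phi l' r' E).
Proof.
split=> i; rewrite linearD !linearZ /= !act_alpha_adj_embed //.
  by rewrite adR_E_H !linearZ /= scalerDr !scalerA.
by rewrite adR_E_Xp // !linear0 ?scaler0 addr0.
Qed.

Lemma alpha_plus1_hw : u1 <> 0 /\ hw_relations u1.
Proof.
have [-> _] := alpha_plus_vectors t0 q2 n2.
by split; [apply: lincomb_adj_embed_neq0|apply: hw_relations_comb].
Qed.
Lemma alpha_plus2_hw : u2 <> 0 /\ hw_relations u2.
Proof.
have [_ ->] := alpha_plus_vectors t0 q2 n2.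
by split; [apply: lincomb_adj_embed_neq0;
  rewrite // mulf_neq0 ?qpar0|apply: hw_relations_comb].
Qed.
(** The combination equals alpha1 + alpha2 - w alpha4, which [alpha_to_delta] maps to q times the
    first symmetric delta vector. *)
Lemma alpha_plus12_hw : let v := (- w) *: u1 + 1 *: u2 in v <> 0 /\ hw_relations v.
Proof.
have q0 := qpar0 t0.
have [-> ->] := alpha_plus_vectors t0 q2 n2;
  rewrite /= !scalerDr !scalerA addrACA -!scalerDl.
split; last exact: hw_relations_comb.
apply: lincomb_adj_embed_neq0 => //; rewrite omegaE.
have -> : - (q - q^-1) * s + 1 * (q * s) = q^-1 * s by ring.
by rewrite mulf_neq0 ?invr_eq0.
Qed.
Lemma alpha_minus1_hw : u3 <> 0 /\ hw_relations u3.
Proof.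
have [-> _] := alpha_minus_vectors t0 q2 n2.
have -> : (q^-1 * s ^+ 2) *: Phi false true E = (q^-1 * s ^+ 2) *: Phi false true E + 0
  *: Phi true true E.
  by rewrite scale0r addr0.
split; [apply: lincomb_adj_embed_neq0 => //|exact: hw_relations_comb].
by rewrite mulf_neq0 ?invr_eq0 ?qpar0 ?expf_neq0.
Qed.
Lemma alpha_minus2_hw : u4 <> 0 /\ hw_relations u4.
Proof.
have [_ ->] := alpha_minus_vectors t0 q2 n2.
have -> : (q * s ^+ 2) *: Phi true false E = (q * s ^+ 2) *: Phi true false E + 0 *: Phi
  true true E.
  by rewrite scale0r addr0.
split; [apply: lincomb_adj_embed_neq0 => //|exact: hw_relations_comb].
by rewrite mulf_neq0 ?qpar0 ?expf_neq0.
Qed.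
Lemma offdiag1_hw : x1 <> 0 /\ hw_relations x1.
Proof.
have [-> _] := offdiag_vectors.
by split; [apply: lincomb_adj_embed_neq0|apply: hw_relations_comb].
Qed.
Lemma offdiag2_hw : x2 <> 0 /\ hw_relations x2.
Proof.
have [_ ->] := offdiag_vectors.
by split; [apply: lincomb_adj_embed_neq0;
  rewrite // mulf_neq0 ?qpar0|apply: hw_relations_comb].
Qed.

Lemma hw_alpha v : v <> 0 /\ hw_relations v -> highest_weight (act_alpha t (n := n)) v.
Proof. by case=> v0 [vH vX]; split=> // i; exists (hwt K i n - hwt K i 1). Qed.

#[local] Notation y1 := (beta1 K n + beta2 K n - w *: beta3 t n).
#[local] Notation y2 := (beta3 t n + beta4 t n + w *: beta1 K n).
#[local] Notation y3 := (beta1 K n - beta2 K n).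
#[local] Notation y4 := (beta3 t n - beta4 t n).

Lemma sigma_beta_vectors :
  [/\ sigma t y1 = u1, sigma t y2 = u2, sigma t y3 = x1 & sigma t y4 = x2].
Proof.
have n1 := ltnW n2.
have sD u v : sigma t (u + v) = sigma t u + sigma t v by exact: linearD.
have sB u v : sigma t (u - v) = sigma t u - sigma t v by exact: linearB.
have sZ c v : sigma t (c *: v) = c *: sigma t v by exact: linearZ.
split; rewrite ?sB ?sD ?sZ.
- by rewrite sigma_beta1 sigma_beta2 sigma_beta3 // alpha3_hecke // alpha4_hecke // addrA.
- by rewrite sigma_beta1 sigma_beta3 // sigma_beta4 // alpha3_hecke.
- by rewrite sigma_beta1 sigma_beta2.
- by rewrite sigma_beta3 // sigma_beta4.
Qed.

Lemma hw_beta v : sigma t v <> 0 /\ hw_relations (sigma t v) ->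
  highest_weight (act_beta t (n := n)) v.
Proof.
case=> v0 [vH vX]; have sI := @sigma_inj K t n t0; split.
- by move=> v00; apply: v0; rewrite v00 linear0.
- move=> i; exists (hwt K i n - hwt K i 1); apply: sI.
  by rewrite sigma_act // vH linearZ.
- by move=> i; apply: sI; rewrite sigma_act // vX linear0.
Qed.

Lemma sigma_preimage vs (v : M2 K n) :
  generated (act_alpha t (n := n)) [seq sigma t u | u <- vs] (sigma t v)
  <-> generated (act_beta t (n := n)) vs v.
Proof.
rewrite (generated_image (act := act_beta t (n := n)) (F := sigma t (n := n)) (s := id))
  //; last first.
  by move=> x u; rewrite /= sigma_act.
by split=> [[u gu /(sigma_inj t0) <-]|gv] //; exists v.
Qed.

Lemma M2_beta_plusE : M2_beta_plus t n = generated (act_beta t (n := n)) [:: y1; y2].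
Proof.
have [E1 E2 _ _] := sigma_beta_vectors.
rewrite /M2_beta_plus M2_alpha_plusE -E1 -E2.
by apply/seteqP; split=> v /(sigma_preimage [:: y1; y2]).
Qed.

Lemma M2_beta_minusE : M2_beta_minus t n = generated (act_beta t (n := n)) [:: y3; y4].
Proof.
have [_ _ E1 E2] := sigma_beta_vectors.
rewrite /M2_beta_minus M2_alpha_minusE' -E1 -E2.
by apply/seteqP; split=> v /(sigma_preimage [:: y3; y4]).
Qed.

End AlphaBeta.

(** * Duality and action (delta) *)

Section Duality.
Variables (K : fieldType) (t : K) (n : nat).
#[local] Notation q := (qpar t).
#[local] Notation w := (omega t).
#[local] Notation S := (hecke t n : 'M[K]_(n * n)).
#[local] Notation D := (Dq t n).
#[local] Notation D2 := (D *t D).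
#[local] Notation E := (e 1 n : 'M[K]_n).
Hypothesis t0 : t != 0.

Lemma mx_linear_inverse m p (F : {linear 'M[K]_(m, p) -> 'M[K]_(m, p)}) :
  injective F -> exists G : {linear 'M[K]_(m, p) -> 'M[K]_(m, p)}, cancel F G /\ cancel G F.
Proof.
move=> FI; pose f := linfun F.
have fI : lker f == 0%VS by apply/lker0P => u v; rewrite !lfunE; apply: FI.
exists (f^-1)%VF; split=> u.
  by have := lker0_lfunK fI u; rewrite lfunE.
by have := lker0_lfunVK fI u; rewrite lfunE.
Qed.

Lemma trace_delta m p i j (U : 'M[K]_(m, p)) : \tr (delta_mx j i *m U) = U i j.
Proof.
rewrite /mxtrace (sum_pick (i0 := j)) => [|k /negPf kj]; rewrite mxE.
  by rewrite (sum_pick (i0 := i)) => [|k /negPf ki];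
    rewrite !mxE ?eqxx ?mul1r // ki andbF mul0r.
by rewrite big1 // => l _; rewrite mxE kj mul0r.
Qed.

Lemma trace_ext m p (Y Z : 'M[K]_(m, p)) :
  (forall X, \tr (X *m Y) = \tr (X *m Z)) -> Y = Z.
Proof. by move=> h; apply/matrixP => i j; rewrite -!trace_delta. Qed.

(* The anti-automorphism that [rho] turns into transposition; it exchanges left
   and right modules. *)
Fixpoint Uq_transpose (x : Uq K n) : Uq K n :=
  match x with
  | UqXp i => UqXm i
  | UqXm i => UqXp i
  | UqAdd x y => (Uq_transpose x + Uq_transpose y)%U
  | UqMul x y => (Uq_transpose y * Uq_transpose x)%U
  | _ => x
  end.

Lemma Uq_transposeK : involutive Uq_transpose.
Proof. by elim=> //= x -> y ->. Qed.

Section Invariance.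
Variables (m : nat) (act : Uq K n -> 'M[K]_m -> 'M[K]_m) (Dm : 'M[K]_m).
Variables h k l xp xm : 'I_n.-1 -> 'M[K]_m.
Hypothesis actR : right_action act.
Hypothesis actH : forall i v, act (UqH i) v = v *m h i - h i *m v.
Hypothesis actK : forall i v, act (UqK i) v = l i *m v *m k i.
Hypothesis actKi : forall i v, act (UqKinv i) v = k i *m v *m l i.
Hypothesis actXp : forall i v,
  act (UqXp i) v = l i *m v *m xp i - q^-1 *: (xp i *m v *m l i).
Hypothesis actXm : forall i v,
  act (UqXm i) v = l i *m v *m xm i - q *: (xm i *m v *m l i).
Hypotheses (hT : forall i, (h i)^T = h i) (kT : forall i, (k i)^T = k i).
Hypotheses (lT : forall i, (l i)^T = l i) (xT : forall i, (xp i)^T = xm i).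
Hypotheses (Dh : forall i, Dm *m h i = h i *m Dm) (Dk : forall i, Dm *m k i = k i *m Dm).
Hypotheses (Dl : forall i, Dm *m l i = l i *m Dm).
Hypothesis (Dxp : forall i, Dm *m xp i = q ^+ 2 *: (xp i *m Dm)).
Hypothesis (Dxm : forall i, xm i *m Dm = q ^+ 2 *: (Dm *m xm i)).

(** Transposition exchanges X_i^+ and X_i^-, and the factor q^2 from moving X past [Dm] turns the
    antipode constant of one into that of the other. The operators are abstract so that [adR] and
    action (alpha) are both instances. *)
Lemma form_invariant x u v :
  \tr (Dm *m act x u *m v^T) = \tr (Dm *m u *m (act (Uq_transpose x) v)^T).
Proof.
have q0 := qpar0 t0; have [actL aD aM aC] := actR.
have cyc (A B C X : 'M[K]_m) : \tr (A *m X *m B *m C) = \tr (C *m A *m X *m B).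
  by rewrite mxtrace_mulC !mulmxA.
have TB c (A B : 'M[K]_m) : (A - c *: B)^T = A^T - c *: B^T by rewrite linearB linearZ.
have trB c (A B : 'M[K]_m) : \tr (A - c *: B) = \tr A - c * \tr B by rewrite linearB
  linearZ.
have mulBr c (A B C : 'M[K]_m) : C *m (A - c *: B) = C *m A - c *: (C *m B).
  by rewrite mulmxBr -scalemxAr.
have mulBl c (A B C : 'M[K]_m) : (A - c *: B) *m C = A *m C - c *: (B *m C).
  by rewrite mulmxBl -scalemxAl.
elim: x u v => [i|i|i|i|i|c|x IHx y IHy|x IHx y IHy] u v /=.
- rewrite !actH -[h i *m u]scale1r -[h i *m v]scale1r TB !mulBr mulBl !trB !trmx_mul hT
  !mulmxA.
  by congr (_ - _ * _); rewrite Dh [RHS]mxtrace_mulC !mulmxA.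
- rewrite !actK !trmx_mul kT lT !mulmxA Dl [RHS]mxtrace_mulC !mulmxA //.
- by rewrite !actKi !trmx_mul kT lT !mulmxA Dk [RHS]mxtrace_mulC !mulmxA.
- rewrite actXp actXm TB !mulBr mulBl !trB !trmx_mul lT -xT trmxK !mulmxA; congr (_ - _).
    by rewrite Dl [RHS]mxtrace_mulC !mulmxA.
  rewrite Dxp -!scalemxAl linearZ /= mulrA [\tr (_ *m xp i)]mxtrace_mulC !mulmxA.
  by congr (_ * _); rewrite expr2 mulKf.
- rewrite actXp actXm TB !mulBr mulBl !trB !trmx_mul lT xT !mulmxA; congr (_ - _).
    by rewrite Dl [RHS]mxtrace_mulC !mulmxA.
  rewrite [\tr (_ *m xm i)]mxtrace_mulC !mulmxA Dxm -!scalemxAl linearZ /= mulrA.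
  by congr (_ * _); rewrite expr2 mulKf.
- by rewrite !aC [(c *: v)^T]linearZ /= -!scalemxAr -!scalemxAl.
- by rewrite !aD [(_ + _)^T]linearD /= !mulmxDr !mulmxDl ![\tr (_ + _)]linearD /= IHx IHy.
- by rewrite !aM IHy IHx.
Qed.

End Invariance.

Lemma adR_form_invariant x (A B : 'M[K]_n) :
  \tr (D *m adR t x A *m B^T) = \tr (D *m A *m (adR t (Uq_transpose x) B)^T).
Proof.
apply: (@form_invariant _ (adR t (n := n)) D (fun i => rho t (UqH i)) (fun i => rho t
  (UqK i))
  (fun i => rho t (UqKinv i)) (fun i => rho t (UqXp i)) (fun i => rho t (UqXm i))).
- exact: adR_right.
- exact: adR_H.
- exact: adR_K.
- exact: adR_Ki.
- exact: adR_Xp.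
- exact: adR_Xm.
- by move=> i; rewrite rho_H dgT.
- by move=> i; rewrite rhoK dgT.
- by move=> i; rewrite rhoKinv dgT.
- by move=> i; rewrite rho_XmT.
- by move=> i; rewrite rho_H dgC.
- by move=> i; rewrite rhoK dgC.
- by move=> i; rewrite rhoKinv dgC.
- by move=> i; rewrite Dq_Xp.
- by move=> i; rewrite Xm_Dq.
Qed.

Lemma act_alpha_form_invariant x (u v : M2 K n) :
  \tr (D2 *m act_alpha t x u *m v^T) = \tr (D2 *m u *m (act_alpha t (Uq_transpose x) v)^T).
Proof.
apply: (@form_invariant _ (act_alpha t (n := n)) D2 (H2 t (n := n)) (K2 t (n := n))
  (Ki2 t (n := n)) (Xp2 t (n := n)) (Xm2 t (n := n))).
- exact: act_alpha_right.
- exact: act_alpha_H.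
- exact: act_alpha_K.
- exact: act_alpha_Ki.
- exact: act_alpha_Xp.
- exact: act_alpha_Xm.
- by move=> i; rewrite /H2 raddfD /= !trmx_tens rho_H dgT trmx1.
- by move=> i; rewrite /K2 trmx_tens rhoK dgT.
- by move=> i; rewrite /Ki2 trmx_tens rhoKinv dgT.
- by move=> i; rewrite Xm2T.
- by move=> i; rewrite /H2 rho_H mulmxDr mulmxDl !tensmx_mul !mulmx1 !mul1mx dgC.
- by move=> i; rewrite /K2 rhoK !tensmx_mul dgC.
- by move=> i; rewrite /Ki2 rhoKinv !tensmx_mul dgC.
- move=> i; rewrite /Xp2 mulmxDr mulmxDl !tensmx_mul Dq_Xp // tensmxZl tensmxZr scalerDr.
  by rewrite rhoK rhoKinv ![D *m dg _ _]dgC.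
- move=> i; rewrite /Xm2 mulmxDr mulmxDl !tensmx_mul Xm_Dq // tensmxZl tensmxZr scalerDr.
  by rewrite rhoK rhoKinv ![D *m dg _ _]dgC.
Qed.

Lemma act_beta_delta x (X Y : M2 K n) :
  \tr (act_beta t x X *m Y) = \tr (X *m act_delta t x Y).
Proof.
rewrite /act_beta /act_delta mulmx_suml mulmx_sumr !raddf_sum;
  apply: eq_bigr => -[[[x1 x2] x3] x4] _ /=.
by rewrite -!mulmxA [LHS]mxtrace_mulC !mulmxA.
Qed.

Lemma adR_adL x (A B : 'M[K]_n) : \tr (adR t x A *m B) = \tr (A *m adL t x B).
Proof.
rewrite /adR /adL mulmx_suml mulmx_sumr !raddf_sum; apply: eq_bigr => s _ /=.
by rewrite -!mulmxA mxtrace_mulC !mulmxA.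
Qed.

(** The invariant form on the right adjoint module, rewritten as a trace pairing with the left
    one. *)
Definition dualR (A : 'M[K]_n) : 'M[K]_n := (D *m A)^T.
Fact dualR_linear : linear dualR.
Proof. by move=> c A B; rewrite /dualR mulmxDr -scalemxAr linearP. Qed.
HB.instance Definition _ := GRing.isLinear.Build K 'M[K]_n 'M[K]_n _ dualR dualR_linear.

Lemma dualR_pairing A B : \tr (A *m dualR B) = \tr (D *m A *m B^T).
Proof. by rewrite /dualR trmx_mul dgT mulmxA mxtrace_mulC mulmxA. Qed.

Lemma dualR_act x A : dualR (adR t (Uq_transpose x) A) = adL t x (dualR A).
Proof.
apply: trace_ext => X.
by rewrite -adR_adL !dualR_pairing adR_form_invariant.
Qed.

Lemma dualR_inj : injective dualR.
Proof.
apply: raddf_inj => A /(congr1 trmx); rewrite /dualR trmxK trmx0 => DA0.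
apply/matrixP => a b; have := congr1 (fun M : 'M_n => M a b) DA0.
rewrite /= mul_diag_mx !mxE => /eqP; rewrite mulf_eq0 (negPf (dq_neq0 t0 _)) => /eqP.
by [].
Qed.

Lemma dualR_E : dualR E = e n 1.
Proof.
rewrite /dualR dg_e linearZ /= /dq muln0 expr0 invr1 scale1r.
by apply/matrixP => a b; rewrite !mxE andbC.
Qed.

Lemma gL_dualR : gL t n = (dualR @` gR t n)%classic.
Proof.
have := generated_image (act := adR t (n := n)) (act' := adL t (n := n)) (F := dualR) [::
  E] Uq_transposeK dualR_act.
by rewrite /= dualR_E.
Qed.

(* The adjoint, for the trace pairing, of [sigma], precomposed with
   Z |-> (D2 Z)^T, which turns the dual of action (alpha) into (alpha) itself. *)
Definition alpha_to_delta (Z : M2 K n) : M2 K n :=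
  \matrix_(x, y) \tr (D2 *m sigma t (delta_mx y x) *m Z^T).

Fact alpha_to_delta_linear : linear alpha_to_delta.
Proof.
move=> c Y Z; apply/matrixP => x y; rewrite !mxE linearP /= mulmxDr raddfD /=.
by rewrite -scalemxAr linearZ.
Qed.
HB.instance Definition _ :=
  GRing.isLinear.Build K (M2 K n) (M2 K n) _ alpha_to_delta alpha_to_delta_linear.
#[local] Notation F := alpha_to_delta.

Lemma alpha_to_delta_pairing (X Z : M2 K n) : \tr (X *m F Z) = \tr (D2 *m sigma t X *m Z^T).
Proof.
have -> : sigma t X = \sum_y \sum_x X y x *: sigma t (delta_mx y x : M2 K n).
  rewrite {1}[X]matrix_sum_delta linear_sum; apply: eq_bigr => y _.
  by rewrite linear_sum; apply: eq_bigr => x _; rewrite linearZ.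
rewrite mulmx_sumr mulmx_suml raddf_sum; apply: eq_bigr => y _.
rewrite mxE mulmx_sumr mulmx_suml raddf_sum; apply: eq_bigr => x _.
by rewrite /= -scalemxAr -scalemxAl [\tr (_ *: _)]linearZ /= mxE.
Qed.

Lemma alpha_to_delta_act x Z : F (act_alpha t (Uq_transpose x) Z) = act_delta t x (F Z).
Proof.
apply: trace_ext => X.
by rewrite -act_beta_delta !alpha_to_delta_pairing sigma_act // act_alpha_form_invariant.
Qed.

Lemma sigma_surj (Y : M2 K n) : exists X, sigma t X = Y.
Proof.
have [G [_ GK]] := mx_linear_inverse (F := sigma t (n := n)) (@sigma_inj K t n t0).
exists (G Y); exact: GK.
Qed.

Lemma alpha_to_delta_inj : injective F.
Proof.
apply: raddf_inj => Z FZ.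
have {}FZ (X : 'M[K]_(n * n)) : \tr (D2 *m X *m Z^T) = 0.
  by have [Y <-] := sigma_surj X; rewrite -alpha_to_delta_pairing FZ mulmx0 raddf0.
have D2u : Z^T *m D2 = 0.
  apply: trace_ext => X; rewrite mulmx0 raddf0 mulmxA mxtrace_mulC mulmxA; exact: FZ.
apply: tens_mxP => a b c d; have := congr1 (fun M : 'M_(n * n) => M (ix c d) (ix a b)) D2u.
rewrite /= mxE sum_mxtens (sum_pick (i0 := a)) => [|i /negPf ia]; last first.
  by rewrite big1 // => j _; rewrite tensmxE dgE ia mulr0n mul0r mulr0.
rewrite (sum_pick (i0 := b)) => [|i /negPf ib]; last first.
  by rewrite tensmxE !dgE ib mulr0n !mulr0.
rewrite tensmxE !dgE !eqxx !mulr1n !mxE => /eqP.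
by rewrite mulf_eq0 (negPf (mulf_neq0 (dq_neq0 t0 _) (dq_neq0 t0 _))) orbF => /eqP.
Qed.

End Duality.

(** * The delta vectors as images of alpha vectors *)

Section DeltaValues.
Variables (K : fieldType) (t : K) (n : nat).
#[local] Notation q := (qpar t).
#[local] Notation w := (omega t).
#[local] Notation S := (hecke t n : 'M[K]_(n * n)).
#[local] Notation D := (Dq t n).
#[local] Notation D2 := (D *t D).
#[local] Notation E := (e 1 n : 'M[K]_n).
#[local] Notation N := (e n 1 : 'M[K]_n).
#[local] Notation F := (@alpha_to_delta K t n).
Hypothesis t0 : t != 0.
Hypothesis n1 : (1 < n)%N.

Lemma trace_tens_ext (Y Z : 'M[K]_(n * n)) :
  (forall A B : 'M[K]_n, \tr ((A *t B) *m Y) = \tr ((A *t B) *m Z)) -> Y = Z.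
Proof.
move=> h; apply: tens_mxP => i j k l; rewrite -[LHS]trace_delta -[RHS]trace_delta.
by rewrite delta_tens.
Qed.

Lemma trace_mul_e (A : 'M[K]_n) (i j : 'I_n) : \tr (A *m e i.+1 j.+1) = A j i.
Proof.
suff -> : e i.+1 j.+1 = delta_mx i j :> 'M[K]_n by rewrite mxtrace_mulC trace_delta.
by apply/matrixP => a b; rewrite !mxE !eqSS.
Qed.

(** Pairing with all A (x) B replaces the entrywise definition of F, and for Z built from [alpha1]
    and S the result is one of the partial quantum traces computed above. *)
Lemma alpha_to_delta_pairing_tens (A B : 'M[K]_n) (Z : M2 K n) :
  \tr ((A *t B) *m F Z) = \tr ((D *t (D *m A)) *m S *m (1%:M *t B) *m Z^T).
Proof.
by rewrite alpha_to_delta_pairing sigma_tens !mulmxA tensmx_mul mulmx1.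
Qed.

Lemma trT_alpha1 : (alpha1 K n)^T = 1%:M *t N.
Proof.
by rewrite trmx_tens trmx1; congr (_ *t _); apply/matrixP => a b; rewrite !mxE andbC.
Qed.

Lemma N_Dq : N *m D = N.
Proof. by rewrite e_dg /dq muln0 expr0 invr1 scale1r. Qed.

Lemma alpha_to_delta_alpha1 (A B : 'M[K]_n) :
  \tr ((A *t B) *m F (alpha1 K n)) = q * \tr (A *m B *m N).
Proof.
rewrite alpha_to_delta_pairing_tens trT_alpha1 -!mulmxA tensmx_mul mulmx1 mulmxA
  mxtrace_mulC [in LHS]mulmxA tensmx_mul mul1mx.
by rewrite trace_hecke // !mulmxA -[B *m N *m D]mulmxA N_Dq mxtrace_mulC !mulmxA.
Qed.

Lemma alpha_to_delta_hecke_alpha1 (A B : 'M[K]_n) :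
  \tr ((A *t B) *m F (S *m alpha1 K n)) =
    \tr (D *m A) * \tr (B *m N) + w * q * \tr (A *m B *m N).
Proof.
rewrite alpha_to_delta_pairing_tens trmx_mul heckeT trT_alpha1 !mulmxA -[_ *m (1%:M *t B)
  *m _]mulmxA tensmx_mul mulmx1.
rewrite -!mulmxA [S *m (_ *m _)]mulmxA trace_hecke_sandwich // mulrC.
have cycD (X : 'M[K]_n) : \tr (D *m (X *m N)) = \tr (X *m N).
  by rewrite mxtrace_mulC -mulmxA N_Dq.
by rewrite cycD -mulmxA [A *m (B *m _)]mulmxA cycD.
Qed.

Lemma alpha_to_delta_alpha1_hecke (A B : 'M[K]_n) :
  \tr ((A *t B) *m F (alpha1 K n *m S)) =
    \tr (D *m B) * \tr (A *m N) + w * q * \tr (A *m B *m N).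
Proof.
rewrite alpha_to_delta_pairing_tens trmx_mul heckeT trT_alpha1 !mulmxA mxtrace_mulC
  !mulmxA tensmx_mul mul1mx.
rewrite mulmxA N_Dq -!mulmxA [S *m (_ *m _)]mulmxA trace_hecke_sandwich //.
by rewrite -[N *m A *m B]mulmxA [\tr (N *m (A *m B))]mxtrace_mulC [\tr (N *m
  A)]mxtrace_mulC mulmxA.
Qed.

(** e^n_1 has no diagonal entry, so the diagonal part of S contributes nothing, and the flip turns
    the trace of a tensor product into the trace of the product. *)
Lemma trace_hecke_corner (X : 'M[K]_n) : \tr (S *m (N *t X)) = \tr (X *m N).
Proof.
have n0 : (0 < n)%N by lia. have n1' : (n.-1 < n)%N by lia.
pose o := Ordinal n0; pose m := Ordinal n1'.
have NE : N = e m.+1 o.+1 :> 'M[K]_n by rewrite /= prednK.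
have mo : m != o by rewrite -val_eqE /=; lia.
rewrite NE trace_mul_e /mxtrace sum_mxtens.
have eE (a b : 'I_n) : (e m.+1 o.+1 : 'M[K]_n) a b = ((a == m) && (b == o))%:R.
  by rewrite mxE !eqSS.
have diag (a : 'I_n) : (e m.+1 o.+1 : 'M[K]_n) a a = 0.
  by rewrite eE; case: (eqVneq a m) => [->|]; rewrite ?(negPf mo).
have term (a j : 'I_n) : (S *m (e m.+1 o.+1 *t X)) (ix a j) (ix a j) =
    ((j == m) && (a == o))%:R * X a j.
  rewrite hecke_mulE !tensmxE diag mul0r !mulr0 addr0 eE; case: (eqVneq a j) => [<-|//].
  by case: (eqVneq a m) => [->|]; rewrite ?(negPf mo) mul0r.
rewrite (sum_pick (i0 := o)) => [|a /negPf ao].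
  rewrite (sum_pick (i0 := m)) => [|j /negPf jm]; first by rewrite term !eqxx mul1r.
  by rewrite term jm mul0r.
by rewrite big1 // => j _; rewrite term ao andbF mul0r.
Qed.

Definition mid (i : nat) : K := if i == 1%N then q else if i == n then q^-1 else 1.

Lemma alpha2_tens : alpha2 t n = E *t dg n mid.
Proof.
rewrite /alpha2 -diag_e !sum_nat1; apply: tens_mxP => a j b k.
rewrite summxE tensmxE summxE mulr_sumr; apply: eq_bigr => i _.
by rewrite !scalemxE tensmxE mulrCA.
Qed.

Lemma alpha_to_delta_alpha2 (A B : 'M[K]_n) :
  \tr ((A *t B) *m F (alpha2 t n)) = \tr (B *m dg n mid *m D *m A *m N).
Proof.
have ET : E^T = N by apply/matrixP => a b; rewrite !mxE andbC.
rewrite alpha_to_delta_pairing_tens alpha2_tens trmx_tens dgT ET -!mulmxA mxtrace_mulC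
  -!mulmxA.
by rewrite !tensmx_mul mul1mx N_Dq trace_hecke_corner !mulmxA.
Qed.

Lemma trace_sum_tens (A B : 'M[K]_n) (c : nat -> K) (x y z u : nat -> nat) :
  \tr ((A *t B) *m (\sum_(1 <= i < n.+1) c i *: (e (x i) (y i) *t e (z i) (u i))))
  = \sum_(i < n) c i.+1 * (\tr (A *m e (x i.+1) (y i.+1)) * \tr (B *m e (z i.+1) (u i.+1))).
Proof.
rewrite mulmx_sumr raddf_sum sum_nat1; apply: eq_bigr => i _ /=.
by rewrite -scalemxAr linearZ /= -trace_pairing_tens.
Qed.

Lemma trace_Dq (A : 'M[K]_n) : \tr (D *m A) = \sum_(i < n) dq t i.+1 * A i i.
Proof. by apply: eq_bigr => i _; rewrite mul_diag_mx !mxE. Qed.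

(** The coefficients of [delta1] and [delta2] are the weights of the quantum trace up to a factor q,
    which is the factor q in front of the delta vectors below. *)
Lemma qpar_dq i : q * q ^- (2 * i.+1 - 1) = dq t i.+1.
Proof.
have q0 := qpar0 t0; rewrite /dq /=; have -> : (2 * i.+1 - 1 = 2 * i + 1)%N by lia.
by rewrite exprD expr1 invfM mulrCA divff // mulr1.
Qed.

Lemma trace_mulZ (M X : 'M[K]_(n * n)) c : \tr (M *m (c *: X)) = c * \tr (M *m X).
Proof. by rewrite -scalemxAr linearZ. Qed.

Lemma trace_mulB (M X Y : 'M[K]_(n * n)) c :
  \tr (M *m (X - c *: Y)) = \tr (M *m X) - c * \tr (M *m Y).
Proof. by rewrite mulmxBr raddfB /= trace_mulZ. Qed.

(** Subtracting w F(alpha1) replaces S by S^-1 and cancels the term w q tr(A B N), so that tr(D A)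
    tr(B N) is left. *)
Lemma delta1E : q *: delta1 t n = F (S *m alpha1 K n) - w *: F (alpha1 K n).
Proof.
apply: trace_tens_ext => A B.
rewrite trace_mulZ trace_mulB alpha_to_delta_hecke_alpha1 alpha_to_delta_alpha1 [w * (q *
  _)]mulrA addrK.
rewrite trace_sum_tens trace_Dq mulr_suml mulr_sumr; apply: eq_bigr => i _.
by rewrite mulrA qpar_dq trace_mul_e mulrA.
Qed.

Lemma delta2E : q *: delta2 t n = F (alpha1 K n *m S) - w *: F (alpha1 K n).
Proof.
apply: trace_tens_ext => A B.
rewrite trace_mulZ trace_mulB alpha_to_delta_alpha1_hecke alpha_to_delta_alpha1 [w * (q *
  _)]mulrA addrK.
have -> : delta2 t n = \sum_(1 <= i < n.+1) q ^- (2 * i - 1) *: (N *t e i i).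
  by apply: eq_bigr => i _; rewrite tensmxZr.
rewrite trace_sum_tens trace_Dq mulr_suml mulr_sumr; apply: eq_bigr => i _.
by rewrite mulrA qpar_dq trace_mul_e [in RHS]mulrAC mulrA.
Qed.

Lemma delta3E : q *: delta3 K n = F (alpha1 K n).
Proof.
have n0 : (0 < n)%N by lia. have n1' : (n.-1 < n)%N by lia.
pose o := Ordinal n0; pose m := Ordinal n1'.
have nE : n = m.+1 by rewrite /= prednK.
apply: trace_tens_ext => A B; rewrite trace_mulZ alpha_to_delta_alpha1; congr (_ * _).
have -> : delta3 K n = \sum_(1 <= i < n.+1) 1 *: (e i 1 *t e n i).
  by apply: eq_bigr => i _; rewrite scale1r.
rewrite trace_sum_tens.
have -> : N = e m.+1 o.+1 by rewrite -nE.
rewrite trace_mul_e mxE; apply: eq_bigr => i _.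
rewrite mul1r -[1%N]/(o.+1) trace_mul_e; congr (_ * _).
by rewrite -(trace_mul_e B m i) -nE.
Qed.

(** The coefficient of [alpha2] times the weight of the quantum trace is q for i = 1, q q^-(2i-1) in
    the middle and q q^-(2n) for i = n: this is the origin of the coefficients of [delta4]. *)
Lemma delta4E : q *: delta4 t n = F (alpha2 t n).
Proof.
have n0 : (0 < n)%N by lia. have n1' : (n.-1 < n)%N by lia.
pose o := Ordinal n0; pose m := Ordinal n1'.
have nE : n = m.+1 by rewrite /= prednK.
apply: trace_tens_ext => A B; rewrite trace_mulZ alpha_to_delta_alpha2 trace_sum_tens
  mulr_sumr.
have -> : N = e m.+1 o.+1 by rewrite -nE.
rewrite trace_mul_e mxE; apply: eq_bigr => i _.
have -> : \tr (A *m e n i.+1) = A i m by rewrite -(trace_mul_e A m i) -nE.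
rewrite -[1%N]/(o.+1) trace_mul_e -mulmxA dg_mul mulrA.
rewrite (_ : (B *m dg n _) o i = B o i * (mid i.+1 * dq t i.+1)); last first.
  by rewrite mul_mx_diag !mxE.
rewrite [RHS](_ : _ = mid i.+1 * dq t i.+1 * (A i m * B o i)); last by ring.
rewrite !mulrA; do 2!congr (_ * _).
have q0 := qpar0 t0; rewrite -qpar_dq /mid; case: eqP => [[i0]|_].
  by rewrite i0 mulr1 expr1 divff // mulr1.
case: eqP => [iE|_]; last by rewrite mul1r.
(* [o.+2] is the numeral 2, refolded when 1 was rewritten as [o.+1]. *)
have -> : (o.+2 * n = (2 * i.+1 - 1).+1)%N by rewrite /=; lia.
by rewrite exprS; field; rewrite q0 expf_neq0.
Qed.
End DeltaValues.

(** * The component for action (delta) and its generators *)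

Section Delta.
Variables (K : fieldType) (t : K) (n : nat).
#[local] Notation q := (qpar t).
#[local] Notation w := (omega t).
#[local] Notation S := (hecke t n : 'M[K]_(n * n)).
#[local] Notation D := (Dq t n).
#[local] Notation D2 := (D *t D).
#[local] Notation P := (hecke_proj t n).
#[local] Notation Phi := (@adj_embed K t n).
#[local] Notation G := (gR t n).
#[local] Notation F := (@alpha_to_delta K t n).
Hypothesis t0 : t != 0.
Hypothesis q2 : q + q^-1 != 0.
Hypothesis n2 : (2 < n)%N.
Hypothesis natr_inj : injective (fun m : nat => m%:R : K).
Hypothesis D0 : \tr (Dq t n) != 0.
Hypothesis coef0 : forall l r, adj_embed_coef t n l r != 0.

(** F and [dualR] are bijective and both twist the action by [Uq_transpose], so [isotypic_image]
    applies to them and to their inverses. *)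
Lemma M2_deltaP Y : M2_delta t n Y <-> exists2 Z, M2_alpha t n Z & F Z = Y.
Proof.
have [dinv [dK dinvK]] := mx_linear_inverse (F := @dualR K t n) (@dualR_inj K t n t0).
have [Finv [FK FinvK]] := mx_linear_inverse (F := F) (@alpha_to_delta_inj K t n t0).
have tK := @Uq_transposeK K n.
split=> [dY|[Z aZ <-]].
  exists (Finv Y); last exact: FinvK.
  apply: (isotypic_image (f := @dualR K t n) (F := Finv) (s := @Uq_transpose K n) _ _ _ _
    _ tK dY).
  - exact: dualR_inj.
  - exact: can_inj FinvK.
  - by rewrite gL_dualR.
  - by move=> x A; apply: dualR_act.
  - move=> x v; apply: (can_inj FK); rewrite FinvK -[x in RHS]tK.
    by rewrite [RHS]alpha_to_delta_act // -[X in _ = act_delta _ _ X]/(F (Finv v)) FinvK.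
apply: (isotypic_image (f := dinv) (F := F) (s := @Uq_transpose K n) _ _ _ _ _ tK aZ).
- exact: can_inj dinvK.
- exact: alpha_to_delta_inj.
- rewrite gL_dualR //; apply/seteqP; split=> [_ [_ [A gA <-] <-]|A gA]; first by rewrite dK.
  by exists (dualR t A); [exists A|rewrite dK].
- by move=> x A; apply: (can_inj dK);
  rewrite dinvK -[x in RHS]tK [RHS]dualR_act // -[X in _ = adL _ _ X]/(dualR t (dinv A))
    dinvK.
- by move=> x v; apply: alpha_to_delta_act.
Qed.

(** The projections are symmetric and commute with [D2], so they can be moved onto Z; blocks with
    different (l, r) are therefore orthogonal. *)
Lemma form_adj_embed l r A (Z : 'M[K]_(n * n)) :
  \tr (D2 *m Phi l r A *m Z^T) = \tr (D2 *m tens1 A *m (P l *m Z *m P r)^T).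
Proof.
rewrite !trmx_mul !hecke_projT // /adj_embed !mulmxA D2_hecke_proj // -!mulmxA
  [LHS]mxtrace_mulC.
by rewrite !mulmxA.
Qed.

Lemma form_adj_embed_sym l r A B :
  \tr (D2 *m tens1 A *m (Phi l r B)^T) = \tr (D2 *m (Phi l r B *m tens1 A^T)).
Proof.
have D2T : D2^T = D2 by rewrite trmx_tens /Dq dgT.
have tT : (tens1 A : 'M[K]_(n * n))^T = tens1 A^T by rewrite trmx_tens trmx1.
by rewrite -mxtrace_tr [(_ *m (Phi l r B)^T)^T]trmx_mul trmxK [(D2 *m _)^T]trmx_mul D2T
  tT [RHS]mxtrace_mulC !mulmxA.
Qed.

(** On one block the form is a nonzero multiple of the form on the adjoint module, by
    [trace_adj_embed], and [gR_nondegenerate] applies. *)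
Lemma form_adj_embed_nondegenerate l r Z : M2_alpha t n Z ->
  (forall A, G A -> \tr (D2 *m Phi l r A *m Z^T) = 0) -> P l *m Z *m P r = 0.
Proof.
move=> aZ Z0; have [B [gB EB]] := proj_alpha t0 q2 n2 natr_inj D0 coef0 l r aZ.
rewrite EB; suff -> : B = 0 by exact: linear0.
have n1 := ltnW n2.
apply: (gR_nondegenerate t0 n1 q2 D0 gB) => A gA.
have := Z0 A gA; rewrite form_adj_embed EB form_adj_embed_sym trace_adj_embed ?(gR_qtrace
  t0 n1 gB) //.
have c1 : (hecke_eig t l - hecke_eig t (~~ l))^-1 * (hecke_eig t r - hecke_eig t (~~
  r))^-1 * adj_embed_coef t n l r != 0.
  by rewrite !mulf_neq0 // invr_eq0 hecke_eig_neq.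
move=> /eqP; rewrite mulf_eq0 (negPf c1) => /eqP E0.
by rewrite -mxtrace_tr !trmx_mul trmxK dgT mulmxA mxtrace_mulC mulmxA.
Qed.

Lemma M2_alpha_plus_proj Z : M2_alpha_plus t n Z <->
  M2_alpha t n Z /\ forall b, P b *m Z *m P (~~ b) = 0.
Proof.
split=> [pZ|[aZ Z0]].
  split=> [|b]; first by case: pZ.
  have [A [B [_ _ ->]]] := (M2_alpha_plusP t0 q2 n2 natr_inj D0 coef0 Z).1 pZ.
  rewrite [_ *m (_ + _)]mulmxDr [(_ + _) *m _]mulmxDl !proj_adj_embed //.
  by case: b; rewrite /= addr0.
have [A [gA EA]] := proj_alpha t0 q2 n2 natr_inj D0 coef0 true true aZ.
have [B [gB EB]] := proj_alpha t0 q2 n2 natr_inj D0 coef0 false false aZ.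
apply/(M2_alpha_plusP t0 q2 n2 natr_inj D0 coef0); exists A, B; split=> //.
rewrite [LHS](sum_proj q2) !big_bool /= EA EB.
by rewrite (Z0 true) (Z0 false) addr0 add0r.
Qed.

Lemma M2_alpha_minus_proj Z : M2_alpha_minus t n Z <->
  M2_alpha t n Z /\ forall b, P b *m Z *m P b = 0.
Proof.
split=> [pZ|[aZ Z0]].
  split=> [|b]; first by case: pZ => u [v [[au _] [av _] ->]]; apply: isotypicD.
  have [A [B [_ _ ->]]] := (M2_alpha_minusP t0 q2 n2 natr_inj D0 coef0 Z).1 pZ.
  rewrite [_ *m (_ + _)]mulmxDr [(_ + _) *m _]mulmxDl !proj_adj_embed //.
  by case: b; rewrite /= addr0.
have [A [gA EA]] := proj_alpha t0 q2 n2 natr_inj D0 coef0 true false aZ.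
have [B [gB EB]] := proj_alpha t0 q2 n2 natr_inj D0 coef0 false true aZ.
apply/(M2_alpha_minusP t0 q2 n2 natr_inj D0 coef0); exists A, B; split=> //.
rewrite [LHS](sum_proj q2) !big_bool /= EA EB.
by rewrite (Z0 true) (Z0 false) addr0 add0r.
Qed.

(** X enters the pairing only through [sigma] X, and [sigma] is onto, so F Z is tested against the
    whole antisymmetric alpha part. By nondegeneracy on each block this kills exactly the
    off-diagonal blocks of Z. *)
Lemma M2_delta_plus_image : M2_delta_plus t n = (F @` M2_alpha_plus t n)%classic.
Proof.
have gz : G 0 by have [] := generated_submodule (adR t (n := n)) [:: e 1 n : 'M[K]_n].
apply/seteqP; split=> [Y [/M2_deltaP[Z aZ <-] orth]|_ [Z pZ <-]].
  exists Z => //; apply/M2_alpha_plus_proj; split=> // b.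
  apply: form_adj_embed_nondegenerate => // A gA.
  have [X XE] := sigma_surj t0 (Phi b (~~ b) A).
  have := orth X; rewrite /trace_pairing alpha_to_delta_pairing XE; apply.
  rewrite /M2_beta_minus /= XE; apply/M2_alpha_minusP => //.
  by case: b {XE}; [exists A, 0|exists 0, A]; split=> //; rewrite linear0 ?addr0 ?add0r.
have [aZ Z0] := (M2_alpha_plus_proj Z).1 pZ.
split=> [|X mX]; first by apply/M2_deltaP; exists Z.
rewrite /trace_pairing alpha_to_delta_pairing.
have [A [B [_ _ ->]]] := (M2_alpha_minusP t0 q2 n2 natr_inj D0 coef0 _).1 mX.
rewrite [_ *m (_ + _)]mulmxDr [(_ + _) *m _]mulmxDl raddfD /= !form_adj_embed.
by rewrite (Z0 true) (Z0 false) trmx0 !mulmx0 !raddf0 addr0.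
Qed.

Lemma M2_delta_minus_image : M2_delta_minus t n = (F @` M2_alpha_minus t n)%classic.
Proof.
have gz : G 0 by have [] := generated_submodule (adR t (n := n)) [:: e 1 n : 'M[K]_n].
apply/seteqP; split=> [Y [/M2_deltaP[Z aZ <-] orth]|_ [Z pZ <-]].
  exists Z => //; apply/M2_alpha_minus_proj; split=> // b.
  apply: form_adj_embed_nondegenerate => // A gA.
  have [X XE] := sigma_surj t0 (Phi b b A).
  have := orth X; rewrite /trace_pairing alpha_to_delta_pairing XE; apply.
  rewrite /M2_beta_plus /= XE; apply/M2_alpha_plusP => //.
  by case: b {XE}; [exists A, 0|exists 0, A]; split=> //; rewrite linear0 ?addr0 ?add0r.
have [aZ Z0] := (M2_alpha_minus_proj Z).1 pZ.
split=> [|X mX]; first by apply/M2_deltaP; exists Z.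
rewrite /trace_pairing alpha_to_delta_pairing.
have [A [B [_ _ ->]]] := (M2_alpha_plusP t0 q2 n2 natr_inj D0 coef0 _).1 mX.
rewrite [_ *m (_ + _)]mulmxDr [(_ + _) *m _]mulmxDl raddfD /= !form_adj_embed.
by rewrite (Z0 true) (Z0 false) trmx0 !mulmx0 !raddf0 addr0.
Qed.

#[local] Notation u1 := (alpha3 t n + alpha4 t n).
#[local] Notation u2 := (alpha1 K n + alpha2 t n + w *: alpha3 t n).
#[local] Notation x1 := (S *m alpha1 K n - alpha1 K n *m S : M2 K n).
#[local] Notation x2 := (alpha1 K n - alpha2 t n : M2 K n).
#[local] Notation z1 := (delta3 K n + delta4 t n - w *: delta2 t n).
#[local] Notation z2 := (delta1 t n + delta2 t n + w *: delta3 K n).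
#[local] Notation z3 := (delta1 t n - delta2 t n).
#[local] Notation z4 := (delta3 K n - delta4 t n).

Lemma delta_vectors :
  [/\ F ((- w) *: u1 + 1 *: u2) = q *: z1, F u1 = q *: z2, F x1 = q *: z3 & F x2 = q *: z4].
Proof.
have n1 := ltnW n2.
have FD u v : F (u + v) = F u + F v by exact: linearD.
have FB u v : F (u - v) = F u - F v by exact: linearB.
have FZ c v : F (c *: v) = c *: F v by exact: linearZ.
have E1 := delta1E t0 n1; have E2 := delta2E t0 n1.
have E3 := delta3E t0 n1; have E4 := delta4E t0 n1.
have qZ (c : K) (v : M2 K n) : q *: (c *: v) = c *: (q *: v) by rewrite !scalerA mulrC.
have qB (u v : M2 K n) : q *: (u - v) = q *: u - q *: v by exact: scalerBr.
have qD (u v : M2 K n) : q *: (u + v) = q *: u + q *: v by exact: scalerDr.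
split; rewrite ?(qB, qD, qZ) ?(E1, E2, E3, E4) ?alpha3_hecke ?alpha4_hecke // ?(FB, FD, FZ);
  move: (F (S *m _)) (F (_ *m S)) (F (alpha1 K n)) (F (alpha2 t n)) => f1 f2 f3 f4;
  by apply/matrixP => x y; rewrite !mxE; ring.
Qed.

(** Highest weight becomes lowest weight because F twists the action by [Uq_transpose], which
    exchanges X_i^+ and X_i^-. *)
Lemma lw_delta Z Y : Z <> 0 /\ hw_relations t Z -> F Z = q *: Y ->
  lowest_weight (act_delta t (n := n)) Y.
Proof.
move=> [Z0 [ZH ZX]] FZ; have q0 := qpar0 t0.
have YE : Y = F (q^-1 *: Z) by rewrite linearZ /= FZ scalerA mulVf // scale1r.
split.
- move=> Y0; apply: Z0; apply: (@alpha_to_delta_inj K t n t0).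
  by rewrite FZ Y0 scaler0 linear0.
- move=> i; exists (hwt K i n - hwt K i 1).
  by rewrite YE -alpha_to_delta_act //= act_alpha_scale ZH !linearZ /= !linearZ /=
    !scalerA mulrC.
- by move=> i; rewrite YE -alpha_to_delta_act //= act_alpha_scale ZX scaler0 linear0.
Qed.

Lemma image_generated (vs : seq (M2 K n)) :
  (F @` generated (act_alpha t (n := n)) vs)%classic
  = generated (act_delta t (n := n)) [seq F v | v <- vs].
Proof. by rewrite (generated_image (F := F) vs (@Uq_transposeK K n) (@alpha_to_delta_act
  K t n t0)). Qed.

Lemma generated_scale2 (V : lmodType K) (act : Uq K n -> V -> V) (c : K) u v : c != 0 ->
  generated act [:: c *: u; c *: v] = generated act [:: u; v].
Proof.
move=> c0; have -> : c *: u = c *: u + 0 *: v by rewrite scale0r addr0.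
have -> : c *: v = 0 *: u + c *: v by rewrite scale0r add0r.
by rewrite generated_span2 // mul0r subr0 mulf_neq0.
Qed.

Lemma M2_delta_plusE : M2_delta_plus t n = generated (act_delta t (n := n)) [:: z1; z2].
Proof.
have [E1 E2 _ _] := delta_vectors.
rewrite M2_delta_plus_image M2_alpha_plusE //.
have <- : generated (act_alpha t (n := n)) [:: (- w) *: u1 + 1 *: u2; 1 *: u1 + 0 *: u2]
        = generated (act_alpha t (n := n)) [:: u1; u2].
  by rewrite generated_span2 // mulr0 mulr1 sub0r oppr_eq0 oner_neq0.
have -> : 1 *: u1 + 0 *: u2 = u1 by rewrite scale0r scale1r addr0.
by rewrite image_generated /= E1 E2 generated_scale2 // qpar0.
Qed.

Lemma M2_delta_minusE : M2_delta_minus t n = generated (act_delta t (n := n)) [:: z3; z4].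
Proof.
have [_ _ E1 E2] := delta_vectors.
rewrite M2_delta_minus_image M2_alpha_minusE' //.
by rewrite image_generated /= E1 E2 generated_scale2 // qpar0.
Qed.

End Delta.

(** * Genericity of q *)

Section Nonvanishing.
Variables (K : fieldType) (t : K) (n : nat).
#[local] Notation q := (qpar t).
Hypothesis t0 : t != 0.

Let mulf_neq0r (c d : K) : c * d != 0 -> d != 0.
Proof. by rewrite mulf_eq0 negb_or => /andP[]. Qed.

Lemma q_plus_inv_neq0 : t ^+ 4 + 1 != 0 -> q + q^-1 != 0.
Proof.
move=> nz; apply: (mulf_neq0r (c := q)).
by rewrite mulrDr divff ?qpar0 // -expr2 -exprM.
Qed.

Lemma trace_Dq_powers : q ^+ (2 * n) * \tr (Dq t n) = \sum_(i < n) t ^+ (4 * (n - i)).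
Proof.
have q0 := qpar0 t0.
rewrite /mxtrace mulr_sumr; apply: eq_bigr => i _ /=.
rewrite dgE eqxx mulr1n /dq /= -exprM.
have -> : (2 * (2 * n) = 4 * (n - i) + 2 * (2 * i))%N by have := ltn_ord i; lia.
by rewrite exprD -[q ^+ _]exprM mulfK // expf_neq0.
Qed.

(** The coefficients with l different from r are both - tr D. Those for (true, true) and (false,
    false), multiplied by q^(2n+2) and q^(2n), become the other two polynomials in t. *)
Lemma adj_embed_coef_neq0 :
  \sum_(i < n) t ^+ (4 * (n - i)) != 0 ->
  t ^+ (4 * n + 8) + t ^+ (4 * n + 4) + \sum_(i < n) t ^+ (4 * (n - i)) != 0 ->
  t ^+ 4 * (\sum_(i < n) t ^+ (4 * (n - i))) - t ^+ (4 * n + 4) - t ^+ (4 * n) != 0 ->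
  forall l r, adj_embed_coef t n l r != 0.
Proof.
have q0 := qpar0 t0; rewrite -trace_Dq_powers.
have E4 : t ^+ (4 * n) = q ^+ (2 * n) by rewrite -exprM mulnA.
have E2 : t ^+ 4 = q ^+ 2 by rewrite -exprM.
have E8 : t ^+ 8 = q ^+ 4 by rewrite -exprM.
rewrite (exprD t (4 * n) 8) (exprD t (4 * n) 4) E2 E4 E8 /adj_embed_coef;
  move: (q ^+ (2 * n)) (\tr _) => Q g nz ntt nff.
have g0 : g != 0 by apply: mulf_neq0r nz.
case=> -[]; rewrite /hecke_eig /= omegaE.
- apply: (mulf_neq0r (c := Q * q ^+ 2)); apply: contraNneq ntt => E.
  by apply/eqP; rewrite -[RHS]E; field.
- by apply: contraNneq g0 => E; rewrite -oppr_eq0; apply/eqP; rewrite -[RHS]E; field.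
- by apply: contraNneq g0 => E; rewrite -oppr_eq0; apply/eqP; rewrite -[RHS]E; field.
- apply: (mulf_neq0r (c := Q)); apply: contraNneq nff => E.
  by apply/eqP; rewrite -[RHS]E; field.
Qed.

Lemma trace_Dq_neq0 : (forall l r, adj_embed_coef t n l r != 0) -> \tr (Dq t n) != 0.
Proof.
have q0 := qpar0 t0; move/(_ true false); apply: contraNneq => g0.
by apply/eqP; rewrite /adj_embed_coef g0 /hecke_eig /= omegaE; field.
Qed.

End Nonvanishing.

(** The conditions on K and t collect everything that genericity of q has to provide; [D0] follows
    from [coef0], as the mixed coefficient is - tr D. *)
Lemma isotypic_components (K : fieldType) (t : K) (n : nat) : (2 < n)%N ->
  t != 0 -> qpar t + (qpar t)^-1 != 0 -> injective (fun m : nat => m%:R : K) ->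
  (forall l r, adj_embed_coef t n l r != 0) ->
  let q := qpar t in
  let w := omega t in
  let a1 := alpha1 (K) n in let a2 := alpha2 t n in
  let a3 := alpha3 t n in let a4 := alpha4 t n in
  let b1 := beta1 (K) n in let b2 := beta2 (K) n in
  let b3 := beta3 t n in let b4 := beta4 t n in
  let d1 := delta1 t n in let d2 := delta2 t n in
  let d3 := delta3 (K) n in let d4 := delta4 t n in
  let alpha_plus_vectors := [:: a3 + a4; a1 + a2 + w *: a3] in
  let alpha_minus_vectors :=
    [:: q *: a1 - q^-1 *: a2 - a3 + a4; q^-1 *: a1 - q *: a2 + a3 - a4] in
  let beta_plus_vectors := [:: b1 + b2 - w *: b3; b3 + b4 + w *: b1] in
  let beta_minus_vectors := [:: b1 - b2; b3 - b4] in
  let delta_plus_vectors := [:: d3 + d4 - w *: d2; d1 + d2 + w *: d3] in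
  let delta_minus_vectors := [:: d1 - d2; d3 - d4] in
  [/\ forall v, v \in alpha_plus_vectors ++ alpha_minus_vectors ->
        highest_weight (@act_alpha (K) t n) v,
      forall v, v \in beta_plus_vectors ++ beta_minus_vectors ->
        highest_weight (@act_beta (K) t n) v
    & forall v, v \in delta_plus_vectors ++ delta_minus_vectors ->
        lowest_weight (@act_delta (K) t n) v]
  /\ [/\ M2_alpha_plus t n =
           generated (@act_alpha (K) t n) alpha_plus_vectors
       & M2_alpha_minus t n =
           generated (@act_alpha (K) t n) alpha_minus_vectors]
  /\ [/\ M2_beta_plus t n =
           generated (@act_beta (K) t n) beta_plus_vectors
       & M2_beta_minus t n =
           generated (@act_beta (K) t n) beta_minus_vectors]
  /\ [/\ M2_delta_plus t n =
           generated (@act_delta (K) t n) delta_plus_vectors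
       & M2_delta_minus t n =
           generated (@act_delta (K) t n) delta_minus_vectors].
Proof.
move=> hn t0 q2 natr_inj coef0 q w a1 a2 a3 a4 b1 b2 b3 b4 d1 d2 d3 d4 ap am bp bm dp dm.
have D0 := trace_Dq_neq0 t0 coef0.
have [s1 s2 s3 s4] := sigma_beta_vectors t0 hn.
have [f1 f2 f3 f4] := delta_vectors t0 hn.
have hu1 := alpha_plus1_hw t0 q2 hn D0 coef0; have hu2 := alpha_plus2_hw t0 q2 hn D0 coef0.
have hx1 := offdiag1_hw t0 q2 hn D0 coef0; have hx2 := offdiag2_hw t0 q2 hn D0 coef0.
split; [split=> v|split; [|split]].
- rewrite !inE => /or4P[]/eqP ->; apply: hw_alpha => //.
  + exact: alpha_minus1_hw.
  + exact: alpha_minus2_hw.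
- by rewrite !inE => /or4P[]/eqP ->; apply: (hw_beta t0); rewrite ?s1 ?s2 ?s3 ?s4.
- rewrite !inE => /or4P[]/eqP ->.
  + exact: (lw_delta t0 (alpha_plus12_hw t0 q2 hn D0 coef0) f1).
  + exact: (lw_delta t0 hu1 f2).
  + exact: (lw_delta t0 hx1 f3).
  + exact: (lw_delta t0 hx2 f4).
- by split; [exact: M2_alpha_plusE|exact: M2_alpha_minusE].
- by split; [exact: M2_beta_plusE|exact: M2_beta_minusE].
- by split; [exact: M2_delta_plusE|exact: M2_delta_minusE].
Qed.

(** * The generic scalars: nonvanishing by evaluation at q = 1 *)

Section GenericScalars.
Variable R : realType.
#[local] Notation t := (sqrt_q R).
#[local] Notation tofracR := (@tofrac {poly R[i]}).

Lemma tofrac_neq0 (p : {poly R[i]}) : p.[1] != 0 -> tofrac p != 0.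
Proof. by rewrite tofrac_eq0; apply: contraNneq => ->; rewrite horner0. Qed.

Lemma sqrt_q_neq0 : t != 0.
Proof. by apply: tofrac_neq0; rewrite hornerX oner_neq0. Qed.

Lemma Cq_natr_inj : injective (fun m : nat => m%:R : Cq R).
Proof.
have natr0 m : (m%:R : Cq R) = 0 -> m = 0%N.
  move=> /eqP; rewrite -(rmorph_nat tofracR) tofrac_eq0 -polyC_natr polyC_eq0.
  by rewrite Num.Theory.pnatr_eq0 => /eqP.
move=> a b /= ab; wlog le_ab : a b ab / (a <= b)%N.
  by move=> h; case: (leqP a b) => [/h -> //|/ltnW /h ->].
have /natr0 : ((b - a)%N%:R : Cq R) = 0 by rewrite natrB // ab subrr.
by move/eqP; rewrite subn_eq0 => ba; apply/eqP; rewrite eqn_leq le_ab.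
Qed.

Lemma tofracXn k : tofracR ('X^k) = t ^+ k.
Proof. exact: (rmorphXn tofracR). Qed.

Lemma Cq_q_plus_inv_neq0 : qpar t + (qpar t)^-1 != 0.
Proof.
apply: (q_plus_inv_neq0 sqrt_q_neq0).
rewrite -tofracXn -(rmorph1 tofracR) -rmorphD; apply: tofrac_neq0.
by rewrite hornerD hornerXn hornerC expr1n -(natrD _ 1 1) Num.Theory.pnatr_eq0.
Qed.

Variable n : nat.
Hypothesis n2 : (2 < n)%N.

(** At q = 1 the three polynomials take the values n, n + 2 and n - 2; the last is nonzero by
    [n2]. *)
Lemma Cq_adj_embed_coef_neq0 l r : adj_embed_coef t n l r != 0.
Proof.
pose T : {poly R[i]} := \sum_(i < n) 'X^(4 * (n - i)).
have TE : \sum_(i < n) t ^+ (4 * (n - i)) = tofracR T.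
  by rewrite rmorph_sum; apply: eq_bigr => i _; rewrite -tofracXn.
have T1 : T.[1] = n%:R.
  rewrite horner_sum (eq_bigr (fun=> 1)) => [|i _]; last by rewrite hornerXn expr1n.
  by rewrite sumr_const card_ord.
apply: (adj_embed_coef_neq0 sqrt_q_neq0); rewrite TE.
- by apply: tofrac_neq0; rewrite T1 Num.Theory.pnatr_eq0; lia.
- rewrite -!tofracXn -!rmorphD; apply: tofrac_neq0.
  rewrite !hornerD !hornerXn !expr1n T1 -(natrD _ 1 1) -natrD Num.Theory.pnatr_eq0.
  by [].
- rewrite -!tofracXn -rmorphM -!rmorphB; apply: tofrac_neq0.
  rewrite !hornerD !hornerN hornerM !hornerXn !expr1n T1 mul1r -addrA -opprD -(natrD _ 1 1).
  by rewrite -natrB ?Num.Theory.pnatr_eq0 -?lt0n ?subn_gt0 // ltnW.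
Qed.

End GenericScalars.

Theorem proposition8p1 (R : realType) (n : nat) (hn : (2 < n)%N) :
  let t := sqrt_q R in
  let q := qpar t in
  let w := omega t in
  let a1 := alpha1 (Cq R) n in let a2 := alpha2 t n in
  let a3 := alpha3 t n in let a4 := alpha4 t n in
  let b1 := beta1 (Cq R) n in let b2 := beta2 (Cq R) n in
  let b3 := beta3 t n in let b4 := beta4 t n in
  let d1 := delta1 t n in let d2 := delta2 t n in
  let d3 := delta3 (Cq R) n in let d4 := delta4 t n in
  let alpha_plus_vectors := [:: a3 + a4; a1 + a2 + w *: a3] in
  let alpha_minus_vectors :=
    [:: q *: a1 - q^-1 *: a2 - a3 + a4; q^-1 *: a1 - q *: a2 + a3 - a4] in
  let beta_plus_vectors := [:: b1 + b2 - w *: b3; b3 + b4 + w *: b1] in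
  let beta_minus_vectors := [:: b1 - b2; b3 - b4] in
  let delta_plus_vectors := [:: d3 + d4 - w *: d2; d1 + d2 + w *: d3] in
  let delta_minus_vectors := [:: d1 - d2; d3 - d4] in
  [/\ forall v, v \in alpha_plus_vectors ++ alpha_minus_vectors ->
        highest_weight (@act_alpha (Cq R) t n) v,
      forall v, v \in beta_plus_vectors ++ beta_minus_vectors ->
        highest_weight (@act_beta (Cq R) t n) v
    & forall v, v \in delta_plus_vectors ++ delta_minus_vectors ->
        lowest_weight (@act_delta (Cq R) t n) v]
  /\ [/\ M2_alpha_plus t n =
           generated (@act_alpha (Cq R) t n) alpha_plus_vectors
       & M2_alpha_minus t n =
           generated (@act_alpha (Cq R) t n) alpha_minus_vectors]
  /\ [/\ M2_beta_plus t n =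
           generated (@act_beta (Cq R) t n) beta_plus_vectors
       & M2_beta_minus t n =
           generated (@act_beta (Cq R) t n) beta_minus_vectors]
  /\ [/\ M2_delta_plus t n =
           generated (@act_delta (Cq R) t n) delta_plus_vectors
       & M2_delta_minus t n =
           generated (@act_delta (Cq R) t n) delta_minus_vectors].
Proof.
exact: (isotypic_components hn (sqrt_q_neq0 R) (Cq_q_plus_inv_neq0 R)
  (@Cq_natr_inj R) (Cq_adj_embed_coef_neq0 R hn)).
Qed.
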